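(* Let $\xi_1,\dots,\xi_n$ be independent real random variables with $\mathbf{E}\xi_i=0$, satisfying Bernstein's condition: there is a constant $\varepsilon>0$ such that $|\mathbf{E}\xi_i^k|\le \frac12 k!\,\varepsilon^{k-2}\mathbf{E}\xi_i^2$ for all $k\ge 3$ and $i=1,\dots,n$. Let $S_n=\sum_{i=1}^n\xi_i$ and $\sigma^2=\sum_{i=1}^n\mathbf{E}\xi_i^2>0$. Let $0\le\alpha\le \frac1{9.6}$. Then for all $0\le x\le\alpha\sigma/\varepsilon$, \[ \mathbf{P}(S_n>x\sigma)\ge \big(1-\Phi(\check{x})\big)\Big[1-c_\alpha(1+\check{x})\frac{\varepsilon}{\sigma}\Big], \] where $\check{x}=\frac{\lambda\sigma}{(1-\lambda\varepsilon)^3}$ with $\lambda=\frac{2x/\sigma}{1+\sqrt{1-9.6x\varepsilon/\sigma}}$, and $c_\alpha=67.38\,R\Big(\frac{2\alpha}{1+\sqrt{1-9.6\alpha}}\Big)$ (a bounded function of $\alpha$). Moreover, if $\varepsilon/\sigma\to0$ and $0\le x=o(\sigma/\varepsilon)$, then $\mathbf{P}(S_n>x\sigma)\ge(1-\Phi(\check{x}))[1-o(1)]$.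
   Context: $\Phi$ is the standard normal distribution function. The function $R$ is defined by $R(t)=\frac{(1-t+6t^2)^3}{(1-3t)^{3/2}(1-t)^7}$ for $0\le t<\frac13$ and $R(t)=\infty$ for $t\ge\frac13$. The asymptotic statement is understood along any sequence of such families (with $n,\varepsilon,\sigma,x$ varying) with $\varepsilon/\sigma\to0$ and $x\varepsilon/\sigma\to0$. *)

(* Defs.v *)
From HB Require Import structures.
From mathcomp Require Import all_boot all_order all_algebra.
From mathcomp Require Import all_classical all_reals all_analysis.
Set Implicit Arguments. Unset Strict Implicit. Unset Printing Implicit Defensive.
Import Order.TTheory GRing.Theory Num.Theory.
Local Open Scope classical_set_scope.
Local Open Scope ring_scope.

Definition mutually_independent {d} {T : measurableType d} {R : realType}
  (P : probability T R) (n : nat) (X : 'I_n -> {RV P >-> R}) : Prop :=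
  forall (J : {set 'I_n}) (B : 'I_n -> set R),
    (forall j, measurable (B j)) ->
    P (\bigcap_(j in [set j | j \in J]) (X j @^-1` B j)) =
    (\prod_(j in J) P (X j @^-1` B j))%E.

Definition Phi {R : realType} (x : R) : R :=
  fine (normal_prob 0 1 `]-oo, x]).

(* The function R(t) of the paper on its finite range 0 <= t < 1/3
   (only evaluated there): (1-t+6t^2)^3 / ((1-3t)^{3/2} (1-t)^7). *)
Definition Rfun {R : realType} (t : R) : R :=
  (1 - t + 6 * t ^+ 2) ^+ 3 /
  (((1 - 3 * t) * Num.sqrt (1 - 3 * t)) * (1 - t) ^+ 7).

Definition c96 {R : realType} : R := 48%:R / 5%:R.

Definition lambda_ {R : realType} (x eps sigma : R) : R :=
  (2 * x / sigma) / (1 + Num.sqrt (1 - c96 * x * eps / sigma)).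

Definition xcheck {R : realType} (x eps sigma : R) : R :=
  lambda_ x eps sigma * sigma / (1 - lambda_ x eps sigma * eps) ^+ 3.

Definition c_alpha {R : realType} (alpha : R) : R :=
  (6738%:R / 100%:R) * Rfun (2 * alpha / (1 + Num.sqrt (1 - c96 * alpha))).

(* Hypotheses of the theorem on a family xi_1..xi_n with parameter eps;
   sigma^2 = sum_i E xi_i^2 (real moments; all moments assumed integrable,
   as implicit in Bernstein's condition). *)
Definition bernstein_family {d} {T : measurableType d} {R : realType}
  (P : probability T R) (n : nat) (xi : 'I_n -> {RV P >-> R}) (eps : R) : Prop :=
  [/\ mutually_independent xi,
      forall i k, P.-integrable setT (fun w => (xi i w ^+ k)%R%:E),
      forall i, ('E_P[xi i] = 0)%E,
      0 < eps &
      forall i k, (3 <= k)%N ->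
        (`| 'E_P[fun w => (xi i w ^+ k)%R] |
          <= ((k`!%:R / 2 * eps ^+ (k - 2))%R%:E * 'E_P[fun w => (xi i w ^+ 2)%R]))%E ].

Definition sigma2 {d} {T : measurableType d} {R : realType}
  (P : probability T R) (n : nat) (xi : 'I_n -> {RV P >-> R}) : R :=
  \sum_(i < n) fine 'E_P[fun w => (xi i w ^+ 2)%R].

(* Main.v *)
(** Tilt the law [P] of the summands by [exp (lambda S) / E exp (lambda S)], with
    [lambda] chosen so that the tilted mean [B] of [S] is at least [x sigma].  Then
      [P (S > B) >= E exp (lambda S) * exp (- lambda B) *
                    E_tilted (exp (- theta (S - B)) 1_{S > B})]
    for every [theta >= lambda].  Replacing the tilted law of [S - B] by the normal
    law of the same variance turns the last factor into Mills' ratio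
    [exp (y^2 / 2) (1 - Phi y)] with [y = theta * sd], which decreases in [y] and is
    at least [1 / (sqrt (2 pi) (1 + y))]; the latter makes an additive error
    [O (eps / sigma)] a relative error [O ((1 + y) eps / sigma)].

    The normal approximation is Esseen's: [c |-> E exp (- theta (Y - c)) 1_{Y > c}]
    grows at most like [exp (theta c)], so it is controlled by its convolution with
    Jackson's kernel, whose Fourier transform is a cubic spline supported in
    [[-2, 2]].  On that interval the characteristic functions are compared factor
    by factor, using only the second and third moments of the tilted summands, which
    Bernstein's condition bounds through the exponential series. *)
Require Import Defs.
From HB Require Import structures.
From mathcomp Require Import all_boot all_order all_algebra.
From mathcomp Require Import all_classical all_reals all_analysis.
From mathcomp Require Import measurable_realfun complex ring lra zify.
Import Order.TTheory GRing.Theory Num.Theory.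
Import numFieldNormedType.Exports.
Local Open Scope classical_set_scope.
Local Open Scope ring_scope.
Set Implicit Arguments.
Unset Strict Implicit.
Unset Printing Implicit Defensive.

(** * Densities and dominated integrals *)

(** All estimates are made under [lambda eps + eps / sigma <= 3/200]. This is no restriction:
    [lambda eps] is at most [xcheck eps / sigma], so the sum is below 1/67 as soon as the bracket
    with constant 67 is positive, and otherwise the claim is trivial. Since R >= 1, [c_alpha] is at
    least 67.38, so 67 is enough.

    The tilted mean is at least [lambda sigma^2 (1 - 2.4 t)], where [t = lambda eps], and [lambda]
    is the smaller root of the quadratic equating this to [x sigma]; hence 9.6, four times 2.4. The
    cube in [xcheck] pays twice through [(1 - t)^-3 >= 1 + 3 t]: for the tilted standard deviation,
    at most [sigma (1 + 3 t)], and for the normalizer, at least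
    [exp (- lambda^2 sigma^2 (1 + 6 t) / 2)].

    Sums are measured in units of [9 eps]. Each tilted summand then has variance at most 1/4 and
    third absolute moment at most half its variance, as the comparison on [[0, 2]] needs. The
    smoothing error, 6.71 times the peak of the normal density, stays below 67 after rescaling by 9
    and allowing for the loss in the standard deviation. *)

Section density.
Local Open Scope ereal_scope.
Context d (T : measurableType d) (R : realType) (mu : {measure set T -> \bar R}).

(** The two proofs are arguments so that the measure structure can be inferred from the term
    itself. *)
Definition density (w : T -> R) (mw : measurable_fun setT w)
  (w0 : forall x, (0 <= w x)%R) (A : set T) : \bar R :=
  \int[mu]_(x in A) (w x)%:E.

Variables (w : T -> R) (mw : measurable_fun setT w) (w0 : forall x, (0 <= w x)%R).
Local Notation nu := (density mw w0).

Let density0 : nu set0 = 0.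
Proof. by rewrite /density integral_set0. Qed.

Let density_ge0 A : 0 <= nu A.
Proof. by apply: integral_ge0 => x _; rewrite lee_fin. Qed.

Let density_sigma_additive : semi_sigma_additive nu.
Proof.
move=> A mA tA mUA; rewrite /density ge0_integral_bigcup//.
- by apply: is_cvg_ereal_nneg_natsum_cond => n _ _; exact: density_ge0.
- by apply/measurable_EFinP; apply: measurable_funS mw.
- by move=> x _; rewrite lee_fin.
Qed.

HB.instance Definition _ := isMeasure.Build _ _ _ nu
  density0 density_ge0 density_sigma_additive.

Import HBNNSimple.

(** Both sides are limits along the same increasing simple functions; for a simple function the
    identity is the definition of the density on level sets. *)
Lemma ge0_integral_density (f : T -> \bar R) : measurable_fun setT f ->
  (forall x, 0 <= f x) ->
  \int[nu]_x f x = \int[mu]_x (f x * (w x)%:E).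
Proof.
move=> mf f0; pose f_ := nnsfun_approx measurableT mf.
have f_cvg x : (f_ n x)%:E @[n --> \oo] --> f x.
  by apply: cvg_nnsfun_approx => // y _; exact: f0.
have f_nd x : {homo (fun n => (f_ n x)%:E) : a b / (a <= b)%N >-> a <= b}.
  by move=> a b ab; rewrite lee_fin; exact/lefP/nd_nnsfun_approx.
have mEf n : measurable_fun setT (fun x => (f_ n x)%:E).
  exact/measurable_EFinP.
have mEw : measurable_fun setT (EFin \o w) by exact/measurable_EFinP.
transitivity (limn (fun n => \int[nu]_x (f_ n x)%:E)).
  rewrite -monotone_convergence//.
  - by apply: eq_integral => x _; apply/esym/cvg_lim => //; exact: f_cvg.
  - by move=> n x _; rewrite lee_fin.
transitivity (limn (fun n => \int[mu]_x ((f_ n x)%:E * (w x)%:E))); last first.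
  rewrite -monotone_convergence//.
  - apply: eq_integral => x _; apply/cvg_lim => //.
    by apply: cvgeZr => //; exact: f_cvg.
  - by move=> n; apply: emeasurable_funM.
  - by move=> n x _; rewrite mule_ge0// lee_fin.
  - by move=> x _ a b ab; rewrite lee_wpmul2r ?lee_fin//; exact: f_nd.
congr (limn _); apply/funext => n.
rewrite integralT_nnsfun sintegralE.
under [RHS]eq_integral => x _.
  rewrite fimfunE -fsumEFin// ge0_mule_fsuml; last first.
    by move=> r; rewrite EFinM nnfun_muleindic_ge0.
  over.
rewrite ge0_integral_fsum//; last 2 first.
- move=> r; apply: emeasurable_funM => //.
  exact/measurable_EFinP/measurableT_comp.
- move=> r x _; rewrite mule_ge0 ?lee_fin//.
  by rewrite -lee_fin EFinM nnfun_muleindic_ge0.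
apply: eq_fsbigr => r; rewrite inE => -[t _ rE].
have r0 : (0 <= r)%R by rewrite -rE.
under [RHS]eq_integral do rewrite EFinM -muleA.
rewrite ge0_integralZl//; last 2 first.
- by apply: emeasurable_funM => //; exact/measurable_EFinP.
- by move=> x _; rewrite mule_ge0// lee_fin.
congr (_ * _); rewrite [LHS]/= /density [LHS]integral_mkcond.
apply: eq_integral => x _.
by rewrite patchE indicE; case: (_ \in _); rewrite ?mul1e ?mul0e.
Qed.

End density.

Lemma integrable_EFinZl d (T : measurableType d) (R : realType)
    (m : {measure set T -> \bar R}) (A : set T) (f : T -> R) (k : R) :
  measurable A -> m.-integrable A (EFin \o f) ->
  m.-integrable A (EFin \o (fun x => k * f x)).
Proof.
move=> mA fi; apply: (eq_integrable _ (fun x => k%:E * (EFin \o f) x)%E) => //.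
exact: integrableZl.
Qed.

Lemma integrable_EFinB d (T : measurableType d) (R : realType)
    (m : {measure set T -> \bar R}) (A : set T) (f g : T -> R) :
  measurable A -> m.-integrable A (EFin \o f) -> m.-integrable A (EFin \o g) ->
  m.-integrable A (EFin \o (fun x => f x - g x)).
Proof.
move=> mA fi gi; apply: (eq_integrable _ (fun x => (f x)%:E - (g x)%:E)%E) => //.
exact: integrableB.
Qed.

Lemma integrable_EFinD d (T : measurableType d) (R : realType)
    (m : {measure set T -> \bar R}) (A : set T) (f g : T -> R) :
  measurable A -> m.-integrable A (EFin \o f) -> m.-integrable A (EFin \o g) ->
  m.-integrable A (EFin \o (fun x => f x + g x)).
Proof.
move=> mA fi gi; apply: (eq_integrable _ (fun x => (f x)%:E + (g x)%:E)%E) => //.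
exact: integrableD.
Qed.

Lemma Rintegral_sum_seq d (T : measurableType d) (R : realType)
    (m : {measure set T -> \bar R}) (A : set T) (I : Type) (s : seq I) (h : I -> T -> R) :
  measurable A -> (forall i, m.-integrable A (EFin \o h i)) ->
  m.-integrable A (EFin \o (fun w => \sum_(i <- s) h i w)) /\
  \int[m]_(w in A) (\sum_(i <- s) h i w) = \sum_(i <- s) \int[m]_(w in A) h i w.
Proof.
move=> mA ih; elim: s => [|i s [IH1 IH2]].
  have E : (fun w => \sum_(i <- [::]) h i w) = cst 0 by apply/funext => w; rewrite
      big_nil.
  rewrite E big_nil; split; first exact: integrable0.
  by rewrite /Rintegral integral0.
have -> : (fun w => \sum_(j <- i :: s) h j w) = fun w => h i w + \sum_(j <- s) h j w.
  by apply/funext => w; rewrite big_cons.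
split; first exact: integrable_EFinD.
by rewrite RintegralD// IH2 big_cons.
Qed.

Lemma Rintegral_cst_probability {R : realType} d (T : measurableType d)
  (Q : probability T R) (c : R) : \int[Q]_w c = c.
Proof.
rewrite /Rintegral integral_cst//.
transitivity (fine (c%:E * 1%:E)); last by rewrite mule1.
by congr (fine (_ * _)%E); exact: probability_setT.
Qed.

Lemma integrable_bounded {R : realType} d (T : measurableType d)
    (Q : probability T R) (f : T -> R) (M : R) :
  measurable_fun setT f -> (forall w, `|f w| <= M) ->
  Q.-integrable setT (EFin \o f).
Proof.
move=> mf fM; apply: measurable_bounded_integrable => //.
  by rewrite ltey_eq fin_num_measure.
exists M; split; first by rewrite num_real.
by move=> N MN w _; exact: le_trans (fM w) (ltW MN).
Qed.

Section density_Rintegral.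
Context d (T : measurableType d) (R : realType) (mu : {measure set T -> \bar R}).
Variables (w : T -> R) (mw : measurable_fun setT w) (w0 : forall x, 0 <= w x).
Hypothesis iw : mu.-integrable setT (EFin \o w).

Lemma integrable_bounded_mul (f : T -> R) (M : R) : measurable_fun setT f ->
  (forall x, `|f x| <= M) -> mu.-integrable setT (EFin \o (fun x => f x * w x)).
Proof.
move=> mf fM; apply: (@le_integrable _ _ _ mu setT _ _ (EFin \o (fun x => M * w x))) =>
    //.
- by apply/measurable_EFinP; exact: measurable_funM.
- move=> x _; rewrite lee_fin !normrM ler_wpM2r//.
  by apply: le_trans (fM x) (ler_norm _).
- exact: integrable_EFinZl.
Qed.

Lemma Rintegral_density (f : T -> R) (M : R) : measurable_fun setT f ->
  (forall x, `|f x| <= M) ->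
  \int[density mu mw w0]_x f x = \int[mu]_x (f x * w x).
Proof.
move=> mf fM.
(* Adding the bound [K] makes the integrand nonnegative, where the previous formula applies; the
   constant is then subtracted on both sides. *)
pose K : R := `|M|; have K0 : 0 <= K by exact: normr_ge0.
have fK x : `|f x| <= K by exact: le_trans (fM x) (ler_norm M).
have M0 x : 0 <= f x + K by have := fK x; rewrite ler_norml => /andP[+ _]; lra.
have nuT : (density mu mw w0 setT < +oo)%E.
  have /integrableP[_] := iw; apply: le_lt_trans.
  rewrite /density; apply: ge0_le_integral => //.
  - by move=> x _; rewrite lee_fin.
  - exact/measurable_EFinP.
  - by apply/measurable_EFinP; exact: measurableT_comp.
  - by move=> x _; rewrite lee_fin ler_norm.
have ib (g : T -> R) (N : R) : measurable_fun setT g -> (forall x, `|g x| <= N) ->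
    (density mu mw w0).-integrable setT (EFin \o g).
  move=> mg gN; apply: measurable_bounded_integrable => //.
  exists N; split; first by rewrite num_real.
  by move=> L NL x _; exact: le_trans (gN x) (ltW NL).
have ge0 (g : T -> R) : measurable_fun setT g -> (forall x, 0 <= g x) ->
    \int[density mu mw w0]_x g x = \int[mu]_x (g x * w x).
  move=> mg g0; rewrite /Rintegral ge0_integral_density//.
  exact/measurable_EFinP.
have mfM : measurable_fun setT (fun x => f x + K) by exact: measurable_funD.
have -> : \int[density mu mw w0]_x f x = \int[density mu mw w0]_x (f x + K) -
    \int[density mu mw w0]_x K.
  rewrite -RintegralB//.
  - by apply: eq_Rintegral => x _; rewrite addrK.
  - apply: (ib _ (K + K)) => // x; rewrite (le_trans (ler_normD _ _))//.
    by rewrite lerD// ger0_norm.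
  - by apply: (ib (cst K) K) => // x; rewrite ger0_norm.
rewrite ge0// (ge0 (cst K))// -RintegralB//.
- by apply: eq_Rintegral => x _; rewrite -mulrBl addrK.
- apply: (integrable_bounded_mul (M := K + K)) => // x.
  by rewrite (le_trans (ler_normD _ _))// lerD// ger0_norm.
- exact: integrable_EFinZl.
Qed.

End density_Rintegral.

Section prob_density.
Context d (T : measurableType d) (R : realType) (mu : {measure set T -> \bar R}).
Variables (w : T -> R) (mw : measurable_fun setT w) (w0 : forall x, 0 <= w x).
Hypothesis mass : density mu mw w0 setT = 1%E.

(* The proof argument makes the probability instance inferable. *)
Definition prob_density of (density mu mw w0 setT = 1%E) := density mu mw w0.

HB.instance Definition _ := Measure.on (prob_density mass).
HB.instance Definition _ :=
  Measure_isProbability.Build _ _ R (prob_density mass) mass.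

End prob_density.

Section fubini_dominated.
Context d1 d2 (T1 : measurableType d1) (T2 : measurableType d2) (R : realType).
Variables (m1 : {sigma_finite_measure set T1 -> \bar R})
  (m2 : {sigma_finite_measure set T2 -> \bar R}).
Variables (f : T1 * T2 -> R) (g : T1 -> R) (h : T2 -> R).
Hypothesis mf : measurable_fun setT f.
Hypothesis ig : m1.-integrable setT (EFin \o g).
Hypothesis ih : m2.-integrable setT (EFin \o h).
Hypothesis fgh : forall x y, `|f (x, y)| <= g x * h y.

Let mg : measurable_fun setT g.
Proof. by apply/measurable_EFinP; exact: measurable_int ig. Qed.

Let mh : measurable_fun setT h.
Proof. by apply/measurable_EFinP; exact: measurable_int ih. Qed.

Lemma integrable_dominated1 x : m2.-integrable setT (fun y => (f (x, y))%:E).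
Proof.
apply: (@le_integrable _ _ _ m2 setT measurableT _ (fun y => ((g x)%:E * (h y)%:E)%E)).
- by apply/measurable_EFinP; exact: measurableT_comp.
- move=> y _; rewrite lee_fin (le_trans (fgh x y))//.
  exact: ler_norm.
- exact: integrableZl.
Qed.

Lemma integrable_dominated2 y : m1.-integrable setT (fun x => (f (x, y))%:E).
Proof.
apply: (@le_integrable _ _ _ m1 setT measurableT _ (fun x => ((g x)%:E * (h y)%:E)%E)).
- by apply/measurable_EFinP; exact: measurableT_comp.
- move=> x _; rewrite lee_fin (le_trans (fgh x y))//.
  exact: ler_norm.
- exact: integrableZr.
Qed.

(** Under the product bound the double integral of [|f|] is at most a product of two finite
    integrals. *)
Lemma integrable_dominated : (m1 \x m2)%E.-integrable setT (EFin \o f).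
Proof.
apply/integrable12ltyP; first exact/measurable_EFinP.
have mA : measurable_fun setT (fun z : T1 * T2 => (`|f z|%:E)).
  by apply/measurable_EFinP; exact: measurableT_comp.
have mah : measurable_fun setT (fun y => (`|h y|)%:E).
  by apply/measurable_EFinP; exact: measurableT_comp.
have mag : measurable_fun setT (fun y => (`|g y|)%:E).
  by apply/measurable_EFinP; exact: measurableT_comp.
have /integrableP[_ ihy] := ih.
have /integrableP[_ igy] := ig.
have h0 : (0 <= \int[m2]_y `|(h y)%:E|)%E by exact: integral_ge0.
apply: (@le_lt_trans _ _ (\int[m1]_x ((`|g x|)%:E * \int[m2]_y (`|h y|)%:E))%E).
  apply: ge0_le_integral => //.
  - by move=> x _; exact: integral_ge0.
  - have := @measurable_fun_fubini_tonelli_F _ _ _ _ _ m2 (fun z => (`|f z|%:E)) mA _.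
    by apply.
  - by apply: emeasurable_funM.
  - move=> x _; rewrite -ge0_integralZl ?lee_fin//.
    apply: ge0_le_integral => //.
    + by apply/measurable_EFinP; apply: measurableT_comp => //; exact: measurableT_comp.
    + by apply: emeasurable_funM.
    + move=> y _; rewrite lee_fin (le_trans (fgh x y))//.
      by rewrite -normrM ler_norm.
rewrite ge0_integralZr//.
by apply: lte_mul_pinfty => //; [exact: integral_ge0|rewrite ge0_fin_numE//; exact:
    integral_ge0].
Qed.

Lemma Rintegral_dominated_Fubini :
  \int[m1]_x \int[m2]_y f (x, y) = \int[m2]_y \int[m1]_x f (x, y).
Proof.
rewrite /Rintegral; congr fine.
transitivity (\int[m1]_x \int[m2]_y (f (x, y))%:E)%E.
  apply: eq_integral => x _; rewrite fineK//.
  exact: (integrable_fin_num measurableT (integrable_dominated1 x)).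
rewrite (Fubini integrable_dominated)/=.
apply: eq_integral => y _; rewrite fineK//.
exact: (integrable_fin_num measurableT (integrable_dominated2 y)).
Qed.

Lemma integrable_dominated_inner1 :
  m1.-integrable setT (fun x => (\int[m2]_y f (x, y))%:E).
Proof.
have := integrable_fubini_F integrable_dominated.
apply: eq_integrable => // x _; rewrite /fubini_F /Rintegral fineK//.
exact: (integrable_fin_num measurableT (integrable_dominated1 x)).
Qed.

End fubini_dominated.

(** * Independence *)

Section independence.
Local Open Scope ereal_scope.
Context d (T : measurableType d) (R : realType) (P : probability T R).
Context (n : nat) (X : 'I_n -> {RV P >-> R}).
Hypothesis indX : mutually_independent X.

Let mX j : measurable_fun setT (X j).
Proof. exact: measurable_funPT. Qed.


(** Induction on the number [k] of coordinates carrying arbitrary functions, the others carrying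
    indicators. For [k = 0] the claim is independence itself. To free coordinate [i], the product of
    the other factors is taken as a density: by induction, the image of this measure under [X i] and
    a multiple of the law of [X i] agree on every measurable set, hence integrate [g i] alike. *)
Lemma independent_integral_prod_ge0 (g : 'I_n -> R -> R) :
  (forall j, measurable_fun setT (g j)) -> (forall j x, (0 <= g j x)%R) ->
  (forall j, \int[P]_w (g j (X j w))%:E < +oo) ->
  \int[P]_w (\prod_(j < n) g j (X j w))%:E =
  \prod_(j < n) \int[P]_w (g j (X j w))%:E.
Proof.
move=> mg g0 gfin.
suff claim k : forall g : 'I_n -> R -> R,
    (forall j, measurable_fun setT (g j)) -> (forall j x, (0 <= g j x)%R) ->
    (forall j, \int[P]_w (g j (X j w))%:E < +oo) ->
    (forall j : 'I_n, (k <= j)%N ->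
      exists2 B : set R, measurable B & g j = \1_B) ->
    \int[P]_w (\prod_(j < n) g j (X j w))%:E =
    \prod_(j < n) \int[P]_w (g j (X j w))%:E.
  by apply: (claim n) => // j; rewrite leqNgt ltn_ord.
elim: k => [|k IH] {}g {}mg {}g0 {}gfin gB.
  have /choice[B HB] : forall j, exists B : set R, measurable B /\ g j = \1_B.
    by move=> j; have [B mB gE] := gB j (leq0n _); exists B.
  have gE j w : g j (X j w) = \1_(X j @^-1` B j) w.
    by rewrite (HB j).2 !indicE; congr (_%:R); apply/idP/idP; rewrite !inE.
  have mXB j : measurable (X j @^-1` B j).
    by rewrite -[X in measurable X]setTI; apply: mX => //; exact: (HB j).1.
  transitivity (P (\bigcap_(j in [set j | j \in [set: 'I_n]%SET]) (X j @^-1` B j))).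
    rewrite -[in RHS](setIT (\bigcap_(_ in _) _)) -integral_indic//; last first.
      by apply: fin_bigcap_measurable => // j _; exact: mXB.
    apply: eq_integral => w _; congr EFin.
    under eq_bigr do rewrite gE.
    rewrite indicE; case: (boolP (w \in _)) => [|].
      rewrite inE => wB; rewrite big1// => j _; rewrite indicE mem_set//.
      by apply: (wB j); rewrite /= inE.
    rewrite notin_setE => wB.
    have [j jB] : exists j, ~ B j (X j w).
      by apply/existsNP => H; apply: wB => j _; exact: H.
    rewrite (bigD1 j)//= indicE memNset ?mul0r//.
  rewrite (indX _ (fun j => (HB j).1)).
  rewrite (eq_bigl xpredT); last by move=> j; rewrite inE.
  apply: eq_bigr => j _; rewrite -[in LHS](setIT (_ @^-1` _)) -integral_indic//.
  by apply: eq_integral => w _; rewrite gE.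
have [kn|] := ltnP k n; last first.
  move=> nk; apply: IH => // j kj; apply: gB.
  by have := leq_ltn_trans kj (ltn_ord j); rewrite ltnNge nk.
pose i := Ordinal kn.
pose F w := (\prod_(j < n | j != i) g j (X j w))%R.
have mF : measurable_fun setT F.
  rewrite /F; under eq_fun do rewrite big_mkcond; apply: measurable_prod => j _.
  by case: (j != i) => //; exact: measurableT_comp.
have F0 w : (0 <= F w)%R by exact: prodr_ge0.
have fg0 j : 0 <= \int[P]_w (g j (X j w))%:E.
  by apply: integral_ge0 => w _; rewrite lee_fin.
have fgE j : \int[P]_w (g j (X j w))%:E = (fine (\int[P]_w (g j (X j w))%:E))%:E.
  by rewrite fineK// ge0_fin_numE.
pose c := (\prod_(j < n | j != i) fine (\int[P]_w (g j (X j w))%:E))%R.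
have c0 : (0 <= c)%R by apply: prodr_ge0 => j _; exact: fine_ge0.
pose h B j := if j == i then \1_B : R -> R else g j.
have HB B : measurable B -> pushforward (density P mF F0) (X i) B =
    mscale (NngNum c0) (distribution P (X i)) B.
  move=> mB; have mXB : measurable (X i @^-1` B).
    by rewrite -[X in measurable X]setTI; exact: mX.
  have hi w : h B i w = \1_B w by rewrite /h eqxx.
  have hE j : j != i -> h B j = g j by rewrite /h => /negbTE ->.
  have intI : \int[P]_w (h B i (X i w))%:E = P (X i @^-1` B).
    under eq_integral do rewrite hi.
    by rewrite -[in RHS](setIT (_ @^-1` _)) -integral_indic.
  transitivity (\int[P]_w (\prod_(j < n) h B j (X j w))%:E).
    rewrite /pushforward /density integral_mkcond; apply: eq_integral => w _.
    rewrite patchE (bigD1 i)//= hi (eq_bigr (fun j => g j (X j w))); last first.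
      by move=> j /hE ->.
    rewrite indicE; case: ifPn => [/set_mem/= wB|/negP wB].
      by rewrite mem_set// mul1r.
    by rewrite memNset ?mul0r// => Bw; apply: wB; rewrite inE.
  rewrite IH.
  - rewrite (bigD1 i)//= intI /mscale/= muleC; congr (_ * _).
    under eq_bigr => j ji do rewrite (hE _ ji) fgE.
    by rewrite prodEFin.
  - move=> j; rewrite /h; case: ifP => // _; exact: measurable_indic.
  - by move=> j x; rewrite /h; case: ifP.
  - move=> j; have [->|ji] := eqVneq j i; last by rewrite hE.
    by rewrite intI (le_lt_trans (probability_le1 _ _))// ltry.
  - move=> j kj; rewrite /h; case: eqP => [_|ji]; first by exists B.
    apply: gB; rewrite ltn_neqAle kj andbT; apply/eqP => kE; apply: ji.
    by apply: val_inj.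
transitivity (\int[pushforward (density P mF F0) (X i)]_x (g i x)%:E).
  rewrite ge0_integral_pushforward//=.
  - rewrite preimage_setT ge0_integral_density//=.
    + apply: eq_integral => w _; rewrite (bigD1 i)//=.
    + by apply/measurable_EFinP; exact: measurableT_comp.
    + by move=> w; rewrite lee_fin.
  - exact/measurable_EFinP.
  - by move=> x _; rewrite lee_fin.
rewrite (eq_measure_integral (mscale (NngNum c0) (distribution P (X i)))).
  rewrite ge0_integral_mscale//=.
  - rewrite ge0_integral_pushforward//=.
    + rewrite preimage_setT (bigD1 i)//= muleC; congr (_ * _).
      by under [RHS]eq_bigr do rewrite fgE; rewrite prodEFin.
    + exact/measurable_EFinP.
    + by move=> x _; rewrite lee_fin.
  - exact/measurable_EFinP.
  - by move=> x _; rewrite lee_fin.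
by move=> A mA _; exact: HB.
Qed.

Local Close Scope ereal_scope.
Local Open Scope ring_scope.

Lemma independent_integrable_prod (g : 'I_n -> R -> R) :
  (forall j, measurable_fun setT (g j)) ->
  (forall j, P.-integrable setT (fun w => (g j (X j w))%:E)) ->
  P.-integrable setT (fun w => (\prod_(j < n) g j (X j w))%:E).
Proof.
move=> mg ig.
have gfin j : (\int[P]_w (`|g j (X j w)|)%:E < +oo)%E.
  by have /integrableP[_] := ig j.
apply/integrableP; split.
  apply/measurable_EFinP; apply: measurable_prod => j _.
  exact: measurableT_comp.
under eq_integral do rewrite /= normr_prod.
rewrite (independent_integral_prod_ge0 (g := fun j x => `|g j x|))//; last first.
  by move=> j; exact: measurableT_comp.
rewrite (eq_bigr (fun j => (fine (\int[P]_w (`|g j (X j w)|)%:E))%:E)).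
  by rewrite prodEFin ltry.
move=> j _; rewrite fineK// ge0_fin_numE//.
by apply: integral_ge0 => w _; rewrite lee_fin.
Qed.

(** The sign restriction is removed one coordinate at a time: the product is linear in the factor
    [g i], which splits into positive and negative parts. *)
Lemma independent_Rintegral_prod (g : 'I_n -> R -> R) :
  (forall j, measurable_fun setT (g j)) ->
  (forall j, P.-integrable setT (fun w => (g j (X j w))%:E)) ->
  \int[P]_w (\prod_(j < n) g j (X j w)) = \prod_(j < n) \int[P]_w g j (X j w).
Proof.
move=> mg ig.
suff claim k : forall g : 'I_n -> R -> R,
    (forall j, measurable_fun setT (g j)) ->
    (forall j, P.-integrable setT (fun w => (g j (X j w))%:E)) ->
    (forall j : 'I_n, (k <= j)%N -> forall x, 0 <= g j x) ->
    \int[P]_w (\prod_(j < n) g j (X j w)) =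
    \prod_(j < n) \int[P]_w g j (X j w).
  by apply: (claim n) => // j; rewrite leqNgt ltn_ord.
elim: k => [|k IH] {}g {}mg {}ig g0.
  rewrite /Rintegral independent_integral_prod_ge0//.
  - transitivity (fine (\prod_(j < n) (\int[P]_w g j (X j w))%:E)%E).
      congr fine; apply: eq_bigr => j _.
      by rewrite /Rintegral fineK//; exact: (integrable_fin_num measurableT (ig j)).
    by rewrite prodEFin.
  - by move=> j x; exact: g0.
  - move=> j; have /integrableP[_] := ig j.
    by under eq_integral do rewrite /= ger0_norm ?g0//.
have [kn|] := ltnP k n; last first.
  move=> nk; apply: IH => // j kj; apply: g0.
  by have := leq_ltn_trans kj (ltn_ord j); rewrite ltnNge nk.
pose i := Ordinal kn.
pose h (f : R -> R) j := if j == i then f else g j.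
pose gp x := Num.max (g i x) 0.
pose gm x := Num.max (- g i x) 0.
have gpm x : g i x = gp x - gm x.
  rewrite /gp /gm; have [gx|gx] := leP 0 (g i x).
    by rewrite max_r ?oppr_le0// subr0.
  by rewrite max_l ?oppr_ge0 1?ltW// sub0r opprK.
have mgp : measurable_fun setT gp by exact: measurable_maxr.
have mgm : measurable_fun setT gm.
  by apply: measurable_maxr => //; exact: measurableT_comp.
have igp : P.-integrable setT (fun w => (gp (X i w))%:E).
  apply: le_integrable (ig i) => //.
    by apply/measurable_EFinP; exact: measurableT_comp.
  move=> w _; rewrite lee_fin /gp.
  by have [gx|gx] := leP 0 (g i (X i w)); rewrite ?normr0.
have igm : P.-integrable setT (fun w => (gm (X i w))%:E).
  apply: le_integrable (ig i) => //.
    by apply/measurable_EFinP; exact: measurableT_comp.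
  move=> w _; rewrite lee_fin /gm.
  by have [gx|gx] := leP 0 (- g i (X i w)); rewrite ?normr0 ?normrN.
have step (f : R -> R) : measurable_fun setT f -> (forall x, 0 <= f x) ->
    P.-integrable setT (fun w => (f (X i w))%:E) ->
    P.-integrable setT (fun w =>
      (f (X i w) * \prod_(j < n | j != i) g j (X j w))%:E) /\
    \int[P]_w (f (X i w) * \prod_(j < n | j != i) g j (X j w)) =
    \int[P]_w f (X i w) * \prod_(j < n | j != i) \int[P]_w g j (X j w).
  move=> mf f0 fi.
  have mh j : measurable_fun setT (h f j) by rewrite /h; case: eqP.
  have ih j : P.-integrable setT (fun w => (h f j (X j w))%:E).
    by rewrite /h; case: eqP => [->|].
  have hE w : \prod_(j < n) h f j (X j w) =
      f (X i w) * \prod_(j < n | j != i) g j (X j w).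
    rewrite (bigD1 i)//= {1}/h eqxx; congr (_ * _).
    by apply: eq_bigr => j /negbTE ji; rewrite /h ji.
  split.
    by under eq_fun do rewrite -hE; exact: independent_integrable_prod.
  under eq_Rintegral do rewrite -hE.
  rewrite IH//.
    rewrite (bigD1 i)//= {1}/h eqxx; congr (_ * _).
    by apply: eq_bigr => j /negbTE ji; rewrite /h ji.
  move=> j kj; rewrite /h; case: eqP => // /eqP ji; apply: g0.
  rewrite ltn_neqAle kj andbT; apply: contra ji => /eqP kE.
  exact/eqP/val_inj.
have gp0 x : 0 <= gp x by rewrite le_max lexx orbT.
have gm0 x : 0 <= gm x by rewrite le_max lexx orbT.
have [ip Ep] := step _ mgp gp0 igp.
have [im Em] := step _ mgm gm0 igm.
under eq_Rintegral => w _ do rewrite (bigD1 i)//= gpm mulrBl.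
rewrite RintegralB// Ep Em -mulrBl [RHS](bigD1 i)//=; congr (_ * _).
rewrite -RintegralB//; by apply: eq_Rintegral => w _; rewrite gpm.
Qed.

(** The same scheme for imaginary parts: [c + i s] is the real factor [c] plus [i] times the real
    factor [s], so each step replaces one complex coordinate by two real ones. *)
Lemma independent_Rintegral_prod_complex (c s : 'I_n -> R -> R) :
  (forall j, measurable_fun setT (c j)) ->
  (forall j, measurable_fun setT (s j)) ->
  (forall j, P.-integrable setT (fun w => (c j (X j w))%:E)) ->
  (forall j, P.-integrable setT (fun w => (s j (X j w))%:E)) ->
  (\int[P]_w complex.Re (\prod_(j < n) (c j (X j w) +i* s j (X j w))%C) +i*
   \int[P]_w complex.Im (\prod_(j < n) (c j (X j w) +i* s j (X j w))%C))%C =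
  \prod_(j < n) (\int[P]_w c j (X j w) +i* \int[P]_w s j (X j w))%C.
Proof.
move=> mc ms ic is_.
pose z (c s : 'I_n -> R -> R) w : R[i] :=
  \prod_(j < n) (c j (X j w) +i* s j (X j w))%C.
suff claim k : forall c s : 'I_n -> R -> R,
    (forall j, measurable_fun setT (c j)) ->
    (forall j, measurable_fun setT (s j)) ->
    (forall j, P.-integrable setT (fun w => (c j (X j w))%:E)) ->
    (forall j, P.-integrable setT (fun w => (s j (X j w))%:E)) ->
    (forall j : 'I_n, (k <= j)%N -> forall x, s j x = 0) ->
    [/\ P.-integrable setT (fun w => (complex.Re (z c s w))%:E),
        P.-integrable setT (fun w => (complex.Im (z c s w))%:E) &
        (\int[P]_w complex.Re (z c s w) +i* \int[P]_w complex.Im (z c s w))%C =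
        \prod_(j < n) (\int[P]_w c j (X j w) +i* \int[P]_w s j (X j w))%C].
  have s0 (j : 'I_n) : (n <= j)%N -> forall x, s j x = 0.
    by rewrite leqNgt ltn_ord.
  by have [] := claim n c s mc ms ic is_ s0.
elim: k => [|k IH] {}c {}s {}mc {}ms {}ic {}is_ s0.
  have zE w : z c s w = ((\prod_(j < n) c j (X j w)) +i* 0)%C.
    rewrite -/(real_complex R _) rmorph_prod; apply: eq_bigr => j _.
    by rewrite s0.
  split.
  - by under eq_fun do rewrite zE/=; exact: independent_integrable_prod.
  - by under eq_fun do rewrite zE/=; exact: integrable0.
  - under eq_Rintegral do rewrite zE/=.
    under [X in (_ +i* X)%C]eq_Rintegral do rewrite zE/=.
    rewrite independent_Rintegral_prod// Rintegral_cst// mul0r.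
    rewrite -/(real_complex R _) rmorph_prod; apply: eq_bigr => j _.
    by under [X in (_ +i* X)%C]eq_Rintegral do rewrite s0//;
      rewrite Rintegral_cst// mul0r.
have [kn|] := ltnP k n; last first.
  move=> nk; apply: IH => // j kj; apply: s0.
  by have := leq_ltn_trans kj (ltn_ord j); rewrite ltnNge nk.
pose i := Ordinal kn.
pose c' j := if j == i then s i else c j.
pose s' j := if j == i then cst 0 : R -> R else s j.
have cE j : j != i -> c' j = c j by rewrite /c' => /negbTE ->.
have sE j : j != i -> s' j = s j by rewrite /s' => /negbTE ->.
have ji (j : 'I_n) : (k <= j)%N -> j != i -> (k < j)%N.
  rewrite leq_eqVlt => /orP[/eqP kj|//] /eqP; case.
  exact/val_inj.
have ms' j : measurable_fun setT (s' j) by rewrite /s'; case: eqP.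
have mc' j : measurable_fun setT (c' j) by rewrite /c'; case: eqP.
have is' j : P.-integrable setT (fun w => (s' j (X j w))%:E).
  by rewrite /s'; case: eqP => // _; exact: integrable0.
have ic' j : P.-integrable setT (fun w => (c' j (X j w))%:E).
  by rewrite /c'; case: eqP => // ->.
have s'0 (j : 'I_n) : (k <= j)%N -> forall x, s' j x = 0.
  by move=> kj x; rewrite /s'; case: eqP => // /eqP /(ji _ kj)/s0.
have [iRc iIc Ec] := IH c s' mc ms' ic is' s'0.
have [iRs iIs Es] := IH c' s' mc' ms' ic' is' s'0.
have zE w : z c s w = z c s' w + 'i%C * z c' s' w.
  rewrite /z (bigD1 i)//= [in X in _ = X + _](bigD1 i)//=.
  rewrite [in X in _ = _ + X](bigD1 i)//=.
  under [in X in _ = X + _]eq_bigr => j jni do rewrite (sE j jni).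
  under [in X in _ = _ + X]eq_bigr => j jni do rewrite (sE j jni) (cE j jni).
  rewrite mulrA -mulrDl; congr (_ * _); rewrite /c' /s' eqxx.
  by apply/eqP; rewrite eq_complex/=; apply/andP; split; apply/eqP; ring.
have RzE w : complex.Re (z c s w) = complex.Re (z c s' w) - complex.Im (z c' s' w).
  by rewrite zE; case: (z c s' w) => ? ?; case: (z c' s' w) => ? ? /=; ring.
have IzE w : complex.Im (z c s w) = complex.Im (z c s' w) + complex.Re (z c' s' w).
  by rewrite zE; case: (z c s' w) => ? ?; case: (z c' s' w) => ? ? /=; ring.
split.
- by under eq_fun do rewrite RzE EFinB; exact: integrableB.
- by under eq_fun do rewrite IzE EFinD; exact: integrableD.
- under eq_Rintegral do rewrite RzE.
  under [X in (_ +i* X)%C]eq_Rintegral do rewrite IzE.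
  rewrite RintegralB// RintegralD//.
  transitivity ((\int[P]_w complex.Re (z c s' w) +i* \int[P]_w complex.Im (z c s' w))%C +
      'i%C * (\int[P]_w complex.Re (z c' s' w) +i* \int[P]_w complex.Im (z c' s' w))%C).
    by apply/eqP; rewrite eq_complex/=; apply/andP; split; apply/eqP; ring.
  rewrite Ec Es (bigD1 i)//= [in X in _ + X](bigD1 i)//= [RHS](bigD1 i)//=.
  under [in X in X + _]eq_bigr => j jni do rewrite (sE j jni).
  under [in X in _ + X]eq_bigr => j jni do rewrite (sE j jni) (cE j jni).
  rewrite mulrA -mulrDl; congr (_ * _).
  rewrite /c' /s' eqxx !Rintegral_cst// mul0r.
  by apply/eqP; rewrite eq_complex/=; apply/andP; split; apply/eqP; ring.
Qed.

End independence.

(** * Elementary inequalities *)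

Section calculus.
Context {R : realType}.
Implicit Types (f F : R -> R) (a b c x y z : R).

Lemma is_derive_continuous F f : (forall x, is_derive x 1 F (f x)) -> continuous F.
Proof.
by move=> dF x; apply/differentiable_continuous/derivable1_diffP; case: (dF x).
Qed.

(** The Taylor inequalities below reduce to this: differentiate until the inequality is evident,
    each difference vanishing at 0. *)
Lemma derive_ge0_ge0 F f : (forall x, is_derive x 1 F (f x)) -> F 0 = 0 ->
  (forall x, 0 <= x -> 0 <= f x) -> forall x, 0 <= x -> 0 <= F x.
Proof.
move=> dF F0 f0 x; rewrite le_eqVlt => /predU1P[<-|x0]; first by rewrite F0.
have [|c c0x] := MVT x0 (fun z _ => dF z).
  by apply: continuous_subspaceT; exact: is_derive_continuous dF.
rewrite F0 !subr0 => ->; rewrite mulr_ge0 ?(ltW x0)// f0//.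
by move: c0x; rewrite in_itv/= => /andP[/ltW].
Qed.

Lemma sin_le_id x : 0 <= x -> sin x <= x.
Proof.
move=> x0; rewrite -subr_ge0.
apply: (@derive_ge0_ge0 (fun x => x - sin x) (fun x => 1 - cos x)) => //.
- by rewrite sin0 subrr.
Qed.

Lemma cos_ge_taylor2 x : 1 - x ^+ 2 / 2 <= cos x.
Proof.
suff H (z : R) : 0 <= z -> 1 - z ^+ 2 / 2 <= cos z.
  have [/H//|x0] := leP 0 x.
  by rewrite -cosN -sqrrN; apply: H; rewrite oppr_ge0 ltW.
move=> z0; rewrite -subr_ge0.
apply: (@derive_ge0_ge0 (fun x => cos x - (1 - x ^+ 2 / 2)) (fun x => x - sin x)) => //.
- by move=> y; apply: is_derive_eq; rewrite /GRing.scale/=; field.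
- by rewrite cos0; field.
- by move=> y y0; rewrite subr_ge0 sin_le_id.
Qed.

Lemma sin_ge_taylor3 x : 0 <= x -> x - x ^+ 3 / 6 <= sin x.
Proof.
move=> x0; rewrite -subr_ge0.
apply: (@derive_ge0_ge0 (fun x => sin x - (x - x ^+ 3 / 6))
  (fun x => cos x - (1 - x ^+ 2 / 2))) => //.
- by move=> y; apply: is_derive_eq; rewrite /GRing.scale/=; field.
- by rewrite sin0; field.
- by move=> y y0; rewrite subr_ge0 cos_ge_taylor2.
Qed.

Lemma cos_le_taylor4 x : cos x <= 1 - x ^+ 2 / 2 + x ^+ 4 / 24.
Proof.
suff H (z : R) : 0 <= z -> cos z <= 1 - z ^+ 2 / 2 + z ^+ 4 / 24.
  have [/H//|x0] := leP 0 x.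
  rewrite -cosN -(sqrrN x).
  rewrite (_ : x ^+ 4 = (- x) ^+ 4); last by ring.
  by apply: H; rewrite oppr_ge0 ltW.
move=> z0; rewrite -subr_ge0.
apply: (@derive_ge0_ge0 (fun x => 1 - x ^+ 2 / 2 + x ^+ 4 / 24 - cos x)
  (fun x => sin x - (x - x ^+ 3 / 6))) => //.
- by move=> y; apply: is_derive_eq; rewrite /GRing.scale/=; field.
- by rewrite cos0; field.
- by move=> y y0; rewrite subr_ge0 sin_ge_taylor3.
Qed.

(* The bound on [|exp(iy) - 1 - iy + y^2/2|], tested against the unit vector
   (a, b) so that it passes through integrals. *)
Lemma cis_taylor2 a b y : a ^+ 2 + b ^+ 2 <= 1 ->
  a * (cos y - 1 + y ^+ 2 / 2) + b * (sin y - y) <= `|y| ^+ 3 / 6.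
Proof.
suff {a b y} H (a b y : R) : 0 <= y -> a ^+ 2 + b ^+ 2 <= 1 ->
    a * (cos y - 1 + y ^+ 2 / 2) + b * (sin y - y) <= y ^+ 3 / 6.
  move=> ab1; have [y0|y0] := leP 0 y; first by rewrite ger0_norm//; exact: H.
  rewrite ltr0_norm//; have := H a (- b) (- y); rewrite cosN sinN sqrrN oppr_ge0 sqrrN
      => /(_ (ltW y0) ab1).
  by apply: le_trans; rewrite le_eqVlt; apply/orP; left; apply/eqP; ring.
move=> y0 ab1.
(* The third derivative of the difference is 1 minus a scalar product of [(a, b)] with a unit
   vector. *)
have unit z : a * sin z - b * cos z <= 1.
  have := cos2Dsin2 z; move: (cos z) (sin z) => u v uv.
  have := sqr_ge0 (a - v); have := sqr_ge0 (b + u); nra.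
rewrite -subr_ge0.
apply: (@derive_ge0_ge0
  (fun y => y ^+ 3 / 6 - (a * (cos y - 1 + y ^+ 2 / 2) + b * (sin y - y)))
  (fun y => y ^+ 2 / 2 - (a * (- sin y + y) + b * (cos y - 1)))) => //.
- by move=> z; apply: is_derive_eq; rewrite /GRing.scale/=; field.
- by rewrite cos0 sin0; field.
apply: (@derive_ge0_ge0 _
  (fun y => y - (a * (- cos y + 1) - b * sin y))) => //.
- by move=> z; apply: is_derive_eq; rewrite /GRing.scale/=; field.
- by rewrite cos0 sin0; field.
apply: (@derive_ge0_ge0 _ (fun y => 1 - (a * sin y - b * cos y))) => //.
- by move=> z; apply: is_derive_eq; rewrite /GRing.scale/=; field.
- by rewrite cos0 sin0; field.
by move=> z _; rewrite subr_ge0.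
Qed.

(** Taylor polynomials of odd degree stay below the exponential on the whole line; for negative [y]
    the argument runs on [z = - y]. *)
Lemma expR_taylor3_ge y : 1 + y + y ^+ 2 / 2 + y ^+ 3 / 6 <= expR y.
Proof.
have [y0|y0] := leP 0 y.
- rewrite -subr_ge0.
  apply: (@derive_ge0_ge0 (fun y => expR y - (1 + y + y ^+ 2 / 2 + y ^+ 3 / 6))
    (fun y => expR y - (1 + y + y ^+ 2 / 2))) => //.
  + by move=> z; apply: is_derive_eq; rewrite /GRing.scale/=; field.
  + by rewrite expR0; field.
  apply: (@derive_ge0_ge0 _ (fun y => expR y - (1 + y))) => //.
  + by move=> z; apply: is_derive_eq; rewrite /GRing.scale/=; field.
  + by rewrite expR0; field.
  by move=> z _; rewrite subr_ge0 expR_ge1Dx.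
- rewrite -subr_ge0.
  have -> : expR y - (1 + y + y ^+ 2 / 2 + y ^+ 3 / 6) =
      expR (- - y) - (1 - - y + (- y) ^+ 2 / 2 - (- y) ^+ 3 / 6).
    by rewrite opprK; field.
  apply: (@derive_ge0_ge0 (fun z => expR (- z) - (1 - z + z ^+ 2 / 2 - z ^+ 3 / 6))
    (fun z => - expR (- z) + (1 - z + z ^+ 2 / 2))); last by rewrite oppr_ge0 ltW.
  + by move=> z; apply: is_derive_eq; rewrite /GRing.scale/=; field.
  + by rewrite oppr0 expR0; field.
  apply: (@derive_ge0_ge0 _ (fun z => expR (- z) - 1 + z)) => //.
  + by move=> z; apply: is_derive_eq; rewrite /GRing.scale/=; field.
  + by rewrite oppr0 expR0; field.
  move=> z _; have := expR_ge1Dx (- z); lra.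
Qed.

Let expR_sub1_le y : 0 <= y -> expR y - 1 <= y * expR y.
Proof.
move=> y0; have := expR_ge1Dx (- y); have := expR_gt0 y.
rewrite expRN => e0 h; have : (1 - y) * expR y <= 1.
  by rewrite -ler_pdivlMr// div1r.
lra.
Qed.

Let expR_sub2_le y : 0 <= y -> expR y - 1 - y <= y ^+ 2 / 2 * expR y.
Proof.
move=> y0; rewrite -subr_ge0.
apply: (@derive_ge0_ge0 (fun y => y ^+ 2 / 2 * expR y - (expR y - 1 - y))
  (fun y => y ^+ 2 / 2 * expR y + y * expR y - (expR y - 1))) => //.
- by move=> z; apply: is_derive_eq; rewrite /GRing.scale/=; field.
- by rewrite expR0; field.
move=> z z0; have := expR_sub1_le z0; have := expR_ge0 z; have := sqr_ge0 z; nra.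
Qed.

Let expR_sub3_le y : 0 <= y ->
  expR y - 1 - y - y ^+ 2 / 2 <= y ^+ 3 / 6 * expR y.
Proof.
move=> y0; rewrite -subr_ge0.
apply: (@derive_ge0_ge0 (fun y => y ^+ 3 / 6 * expR y - (expR y - 1 - y - y ^+ 2 / 2))
  (fun y => y ^+ 3 / 6 * expR y + y ^+ 2 / 2 * expR y - (expR y - 1 - y))) => //.
- by move=> z; apply: is_derive_eq; rewrite /GRing.scale/=; field.
- by rewrite expR0; field.
move=> z z0; have := expR_sub2_le z0; have := expR_ge0 z.
have : 0 <= z ^+ 3 by exact: exprn_ge0.
nra.
Qed.

Let expRN_sub2_le z : 0 <= z -> expR (- z) - 1 + z <= z ^+ 2 / 2.
Proof.
move=> z0; rewrite -subr_ge0.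
apply: (@derive_ge0_ge0 (fun z => z ^+ 2 / 2 - (expR (- z) - 1 + z))
  (fun z => z + expR (- z) - 1)) => //.
- by move=> y; apply: is_derive_eq; rewrite /GRing.scale/=; field.
- by rewrite oppr0 expR0; field.
by move=> y _; have := expR_ge1Dx (- y); lra.
Qed.

Let expRN_sub3_ge z : 0 <= z ->
  - (z ^+ 3 / 6) <= expR (- z) - 1 + z - z ^+ 2 / 2.
Proof.
move=> z0; rewrite -subr_ge0.
apply: (@derive_ge0_ge0 (fun z => expR (- z) - 1 + z - z ^+ 2 / 2 - - (z ^+ 3 / 6))
  (fun z => z ^+ 2 / 2 - (expR (- z) - 1 + z))) => //.
- by move=> y; apply: is_derive_eq; rewrite /GRing.scale/=; field.
- by rewrite oppr0 expR0; field.
by move=> y y0; rewrite subr_ge0 expRN_sub2_le.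
Qed.

(** The factor [1 + expR y] serves both signs: [expR y] is needed for [0 <= y], and 1 for [y < 0]. A
    bound linear in 1 and [expR y] integrates into plain and tilted moments. *)
Lemma expR_taylor1_le y : expR y - 1 - y <= y ^+ 2 / 2 * (1 + expR y).
Proof.
have [y0|y0] := leP 0 y.
  by have := expR_sub2_le y0; have := sqr_ge0 y; lra.
have := @expRN_sub2_le (- y); rewrite opprK sqrrN oppr_ge0 (ltW y0) => /(_ isT).
by have := expR_ge0 y; have := sqr_ge0 y; nra.
Qed.

(** The extra factor [y] gives the remainder a fixed sign; with [y = l X] this controls [l] times
    the tilted first moment. *)
Lemma mul_expR_taylor2 y :
  0 <= y * (expR y - 1 - y - y ^+ 2 / 2) <= y ^+ 4 / 6 * (1 + expR y).
Proof.
have [y0|y0] := leP 0 y.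
  have h1 := expR_sub3_le y0.
  have h2 := @derive_ge0_ge0 (fun y => expR y - 1 - y - y ^+ 2 / 2).
  have y3 : 0 <= y ^+ 3 by exact: exprn_ge0.
  have h : 0 <= expR y - 1 - y - y ^+ 2 / 2.
    by have := expR_taylor3_ge y; lra.
  rewrite mulr_ge0//= (_ : y ^+ 4 = y * y ^+ 3); last by ring.
  by have := expR_ge0 y; nra.
have z0 : 0 <= - y by rewrite oppr_ge0 ltW.
have := expRN_sub3_ge z0; have := expRN_sub2_le z0; rewrite opprK sqrrN => h1.
rewrite (_ : (- y) ^+ 3 = - y ^+ 3); last by ring.
rewrite mulNr opprK => h2; have e0 := expR_ge0 y.
have y4 : 0 <= y ^+ 4 by rewrite -[4%N]/(2 * 2)%N exprM sqr_ge0.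
apply/andP; split; first nra.
have : y * (expR y - 1 - y - y ^+ 2 / 2) <= y * (y ^+ 3 / 6) by nra.
rewrite mulrA -exprS; nra.
Qed.

End calculus.

(** Twice [(y + z)^2 <= 1.1 y^2 + 11 z^2]; the weights favour [x], since [b] will be a small tilted
    mean. *)
Lemma quartic_shift_le {R : realFieldType} (x b : R) :
  (x - b) ^+ 4 <= (11 / 10) ^+ 3 * x ^+ 4 + 11 ^+ 3 * b ^+ 4.
Proof.
have H (y z : R) : (y + z) ^+ 2 <= 11 / 10 * (y ^+ 2 + 10 * z ^+ 2).
  by have := sqr_ge0 (y - 10 * z); lra.
have h4 : ((x - b) ^+ 2) ^+ 2 <= (11 / 10 * (x ^+ 2 + 10 * b ^+ 2)) ^+ 2.
  rewrite lerXn2r// ?nnegrE ?sqr_ge0//; last by have := H x (- b); rewrite sqrrN.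
  by rewrite mulr_ge0// addr_ge0 ?sqr_ge0// mulr_ge0 ?sqr_ge0.
rewrite [leLHS](_ : _ = ((x - b) ^+ 2) ^+ 2); last by rewrite -exprM.
apply: le_trans h4 _.
rewrite exprMn; apply: le_trans (ler_wpM2l (sqr_ge0 _) (H _ _)) _.
by rewrite le_eqVlt; apply/orP; left; apply/eqP; field.
Qed.

(** * The fundamental theorem of calculus *)

Section ftc.
Context {R : realType}.
Implicit Types (f F : R -> R) (a b c x y z l : R).
Notation mu := (@lebesgue_measure R).

Lemma continuous_integrable_itv f a b : continuous f ->
  mu.-integrable `[a, b] (EFin \o f).
Proof.
move=> cf; apply: continuous_compact_integrable; first exact: segment_compact.
exact: continuous_subspaceT.
Qed.

Lemma Rintegral_FTC2 F f a b : a <= b -> (forall x, is_derive x 1 F (f x)) ->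
  continuous f -> \int[mu]_(x in `[a, b]) f x = F b - F a.
Proof.
move=> + dF cf; rewrite le_eqVlt => /predU1P[->|ab].
  by rewrite set_itv1 Rintegral_set1 subrr.
have cF := is_derive_continuous dF.
rewrite /Rintegral (continuous_FTC2 (F := F)) ?EFinN -?EFinD//.
- exact: continuous_subspaceT.
- split.
  + by move=> x _; case: (dF x).
  + exact/cvg_at_right_filter/cF.
  + exact/cvg_at_left_filter/cF.
- by move=> x _; rewrite derive1E; case: (dF x).
Qed.

Lemma ge0_integral_FTC2y F f a l : (forall x, a <= x -> 0 <= f x) ->
  (forall x, a <= x -> is_derive x 1 F (f x)) ->
  (forall x, a <= x -> {for x, continuous f}) ->
  F x @[x --> +oo] --> l ->
  (\int[mu]_(x in `[a, +oo[) (f x)%:E = (l - F a)%:E)%E.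
Proof.
move=> f0 dF cf Fl.
rewrite (ge0_continuous_FTC2y (F := F) (l := l))//.
- apply/continuous_within_itvcyP; split.
    by move=> x; rewrite in_itv/= andbT => /ltW; exact: cf.
  by apply: cvg_at_right_filter; exact: cf.
- by move=> x /ltW ax; case: (dF x ax).
- apply: cvg_at_right_filter; apply/differentiable_continuous/derivable1_diffP.
  by case: (dF a (lexx a)).
- by move=> x; rewrite in_itv/= andbT derive1E => /ltW ax; case: (dF x ax).
Qed.

(** Truncation to [[-n, n]] and dominated convergence. It serves to integrate by parts against the
    normal density. *)
Lemma Rintegral_FTC2T F f : (forall x, is_derive x 1 F (f x)) ->
  continuous f -> mu.-integrable setT (EFin \o f) ->
  F x @[x --> +oo] --> 0 -> F x @[x --> -oo] --> 0 ->
  \int[mu]_x f x = 0.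
Proof.
move=> dF cf intf Fy FNy.
pose g n x := (f \_ `[- n%:R, n%:R]) x.
have mf : measurable_fun setT f by exact: continuous_measurable_fun.
have g_cvg : (\int[mu]_x (g n x)%:E)%E @[n --> \oo] --> (\int[mu]_x (f x)%:E)%E.
  apply: (@dominated_cvg _ _ _ mu setT _ (fun n x => (g n x)%:E) _
    (fun x => `|f x|%:E)) => //.
  - move=> n; apply/measurable_EFinP/(measurable_restrict _ _ _).1 => //.
    by rewrite setTI; exact: measurable_funTS.
  - move=> x _; apply: cvg_near_cst; near=> n.
    rewrite /g patchE mem_set//= in_itv/= -ler_norml; near: n.
    exact: nbhs_infty_ger.
  - have := integrable_norm intf; exact.
  - move=> n x _; rewrite lee_fin /g patchE; case: ifP => // _.
    by rewrite normr0.
have gE n : (\int[mu]_x (g n x)%:E)%E = (F n%:R - F (- n%:R))%:E.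
  rewrite -(Rintegral_FTC2 _ dF cf); last by rewrite ge0_cp.
  rewrite /Rintegral fineK; last first.
    by apply: integrable_fin_num => //; exact: continuous_integrable_itv.
  by rewrite [RHS]integral_mkcond; apply: eq_integral => x _;
    rewrite /g !patchE; case: ifP.
have g0 : (\int[mu]_x (g n x)%:E)%E @[n --> \oo] --> 0%:E.
  under eq_cvg do rewrite gE.
  apply: cvg_EFin; first exact: nearW.
  rewrite -[X in _ --> X]subr0; apply: cvgB.
    exact: (cvg_comp _ _ (@cvgr_idn R) Fy).
  apply: (cvg_comp _ _ _ FNy); apply/cvgNry.
  by under eq_cvg do rewrite /= opprK; exact: cvgr_idn.
rewrite /Rintegral.
by have -> := cvg_unique _ g_cvg g0.
Unshelve. all: end_near. Qed.

End ftc.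

(** * Jackson's kernel *)

Section kernel.
Context {R : realType}.
Implicit Types (a c s v x y z : R).
Notation mu := (@lebesgue_measure R).

(* Jackson's kernel [4 (1 - cos y)^2 / y^4], written as the cosine transform
   of a cubic spline supported in [0, 2]. *)
Definition spline s : R :=
  ((2 - s) ^+ 3 - 4 * Num.max (1 - s) 0 ^+ 3) / 3.

Definition jackson y : R := \int[mu]_(s in `[0, 2]) (spline s * cos (s * y)).

Let cubic c y := \int[mu]_(s in `[0, c]) ((c - s) ^+ 3 * cos (s * y)).

Let continuous_cubic c y : continuous (fun s => (c - s) ^+ 3 * cos (s * y)).
Proof. by apply: is_derive_continuous => x; exact: is_derive_eq. Qed.

Let cubicE c y : 0 <= c -> y != 0 ->
  cubic c y = (3 * c ^+ 2 * y ^+ 2 - 6 + 6 * cos (c * y)) / y ^+ 4.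
Proof.
move=> c0 y0; rewrite /cubic.
have dF x : is_derive x 1 (fun s => (c - s) ^+ 3 * sin (s * y) / y
   - 3 * (c - s) ^+ 2 * cos (s * y) / y ^+ 2
   - 6 * (c - s) * sin (s * y) / y ^+ 3 + 6 * cos (s * y) / y ^+ 4)
   ((c - x) ^+ 3 * cos (x * y)).
  by apply: is_derive_eq; rewrite /GRing.scale/=; field.
rewrite (Rintegral_FTC2 c0 dF (@continuous_cubic c y)).
by rewrite mul0r sin0 cos0; field.
Qed.

Let cubic0 c : 0 <= c -> cubic c 0 = c ^+ 4 / 4.
Proof.
move=> c0; rewrite /cubic.
have dF x : is_derive x 1 (fun s => - (c - s) ^+ 4 / 4) ((c - x) ^+ 3 * cos (x * 0)).
  by rewrite mulr0 cos0; apply: is_derive_eq; rewrite /GRing.scale/=; field.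
by rewrite (Rintegral_FTC2 c0 dF (@continuous_cubic c 0)); field.
Qed.

Let continuous_trunc : continuous (fun s => Num.max (1 - s) 0 ^+ 3 : R).
Proof.
move=> s; apply: (@cvg_comp _ _ _ (fun s => Num.max (1 - s) 0) (fun x => x ^+ 3)).
  have cs : continuous (fun s : R => 1 - s).
    by apply: is_derive_continuous => x; exact: is_derive_eq.
  exact: (@continuous_max _ _ (fun s => 1 - s) (cst 0) s (cs s) (cvg_cst _)).
have : continuous (fun x : R => x ^+ 3); last exact.
by apply: is_derive_continuous => x; exact: is_derive_eq.
Qed.

Lemma continuous_spline : continuous spline.
Proof.
move=> s; apply: cvgM; last exact: cvg_cst.
apply: (@cvgB _ R^o).
  have : continuous (fun s : R => (2 - s) ^+ 3); last exact.
  by apply: is_derive_continuous => x; exact: is_derive_eq.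
by apply: cvgM; [exact: cvg_cst|exact: continuous_trunc].
Qed.

Let continuous_cos y : continuous (fun s => cos (s * y)).
Proof. by apply: is_derive_continuous => x; exact: is_derive_eq. Qed.

Lemma continuous_spline_cos y : continuous (fun s => spline s * cos (s * y)).
Proof.
by move=> s; apply: cvgM; [exact: continuous_spline|exact: continuous_cos].
Qed.

Lemma spline_bounds s : 0 <= s <= 2 -> 0 <= spline s <= 4 / 3.
Proof.
move=> /andP[s0 s2]; rewrite /spline; have [s1|s1] := leP 1 s.
  rewrite max_r ?subr_le0// expr0n/= mulr0 subr0.
  have -> : (2 - s) ^+ 3 = (2 - s) * (2 - s) ^+ 2 by ring.
  have := sqr_ge0 (2 - s); nra.
rewrite max_l; last by rewrite subr_ge0 ltW.
have h1 : 0 <= s ^+ 2 * (2 - s) by rewrite mulr_ge0 ?sqr_ge0// subr_ge0.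
have h2 : 0 <= s * (1 - s) * (2 - s) by rewrite !mulr_ge0 ?subr_ge0// ltW.
have h3 := sqr_ge0 (1 - s).
have -> : ((2 - s) ^+ 3 - 4 * (1 - s) ^+ 3) / 3 = (4 - 3 * (s ^+ 2 * (2 - s))) / 3 by
    field.
by apply/andP; split; nra.
Qed.

Let jackson_cubic y : jackson y = (cubic 2 y - 4 * cubic 1 y) / 3.
Proof.
have cm : continuous (fun s : R => Num.max (1 - s) 0 ^+ 3 * cos (s * y)).
  by move=> s; apply: cvgM; [exact: continuous_trunc|exact: continuous_cos].
(* The truncated cube vanishes beyond 1, so its transform over [[0, 2]] is an integral over
   [[0, 1]]. *)
have -> : cubic 1 y = \int[mu]_(s in `[0, 2]) (Num.max (1 - s) 0 ^+ 3 * cos (s * y)).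
  have := @Rintegral_itvB R (fun s => Num.max (1 - s) 0 ^+ 3 * cos (s * y))
    (BLeft 0) (BRight 2) 1 (@continuous_integrable_itv R _ 0 2 cm).
  rewrite !bnd_simp ler01 ler1n => /(_ isT isT).
  rewrite [X in _ = X -> _](_ : _ = 0); last first.
    rewrite -[RHS](mul0r (fine (mu `]1, 2]))) -Rintegral_cst//.
    apply: eq_Rintegral => s; rewrite inE/= in_itv/= => /andP[s1 _].
    by rewrite max_r ?subr_le0 ?ltW// expr0n/= mul0r.
  move/eqP; rewrite subr_eq0 => /eqP ->; apply: eq_Rintegral => s.
  rewrite inE/= in_itv/= => /andP[_ s1].
  by rewrite max_l// subr_ge0.
have icub : mu.-integrable `[0, 2] (EFin \o (fun s => (2 - s) ^+ 3 * cos (s * y))).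
  exact: (@continuous_integrable_itv R _ 0 2 (@continuous_cubic 2 y)).
have im := @continuous_integrable_itv R _ 0 2 cm.
have im4 : mu.-integrable `[0, 2]
    (EFin \o (fun s => 4 * (Num.max (1 - s) 0 ^+ 3 * cos (s * y)))).
  by rewrite [X in mu.-integrable _ X](_ : _ = (fun s => (4%:E *
    (Num.max (1 - s) 0 ^+ 3 * cos (s * y))%:E)%E))//; exact: integrableZl.
rewrite -RintegralZl// -RintegralB// [RHS]mulrC -RintegralZl//; last first.
  exact: (integrableB _ icub im4).
by apply: eq_Rintegral => s _; rewrite /spline; field.
Qed.

(** The weights 1 and -4 at the knots 2 and 1 cancel the terms in [y^2]; the double angle formula
    makes the remaining trigonometric polynomial a square. *)
Lemma jacksonE y : y != 0 -> jackson y = 4 * (1 - cos y) ^+ 2 / y ^+ 4.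
Proof.
move=> y0; rewrite jackson_cubic !cubicE// mul1r.
by rewrite (mulr_natl y) cos_mulr2n; field.
Qed.

Lemma jackson0 : jackson 0 = 1.
Proof. by rewrite jackson_cubic !cubic0//; field. Qed.

Lemma jacksonN y : jackson (- y) = jackson y.
Proof. by apply: eq_Rintegral => s _; rewrite mulrN cosN. Qed.

Lemma jackson_ge0 y : 0 <= jackson y.
Proof.
have [->|y0] := eqVneq y 0; first by rewrite jackson0.
rewrite jacksonE//; apply: divr_ge0; last exact: exprn_even_ge0.
by rewrite pmulr_rge0// sqr_ge0.
Qed.

(** The cosine transform of a nonnegative function is largest at 0. *)
Lemma jackson_le1 y : jackson y <= 1.
Proof.
rewrite -jackson0; apply: le_Rintegral => //.
- exact: (@continuous_integrable_itv R _ 0 2 (@continuous_spline_cos y)).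
- exact: (@continuous_integrable_itv R _ 0 2 (@continuous_spline_cos 0)).
move=> s /=; rewrite in_itv/= => /spline_bounds/andP[s0 _].
by rewrite mulr0 cos0 ler_wpM2l// cos_le1.
Qed.

Lemma jackson_le_tail y : 0 < y -> jackson y <= 16 / y ^+ 4.
Proof.
move=> y0; rewrite jacksonE ?gt_eqF// ler_pM2r ?invr_gt0 ?exprn_gt0//.
by have := cos_le1 y; have := cos_geN1 y; nra.
Qed.

(** From [1 - cos y >= (y^2 / 2) (1 - y^2 / 12)], whose right side is nonnegative in this range. *)
Lemma jackson_ge_center y : y ^+ 2 <= 12 -> (1 - y ^+ 2 / 12) ^+ 2 <= jackson y.
Proof.
have [->|y0] := eqVneq y 0; first by rewrite jackson0 expr0n/= mul0r subr0 expr1n.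
move=> y12; rewrite jacksonE// ler_pdivlMr; last first.
  by rewrite exprn_even_gt0.
have := cos_le_taylor4 y; have y2 := sqr_ge0 y.
rewrite (_ : y ^+ 4 = y ^+ 2 * y ^+ 2); last by ring.
move: (y ^+ 2) (cos y) y12 y2 => q c q12 q0 h.
have h1 : 0 <= q / 2 * (1 - q / 12) by rewrite mulr_ge0// ?divr_ge0//; lra.
have h2 : q / 2 * (1 - q / 12) <= 1 - c by lra.
have : (q / 2 * (1 - q / 12)) ^+ 2 <= (1 - c) ^+ 2 by rewrite lerXn2r// nnegrE; lra.
lra.
Qed.

Lemma continuous_jackson : continuous jackson.
Proof.
move=> y.
apply: (@continuity_under_integral R _ _ mu (fun y s => spline s * cos (s * y))
  `[0, 2] _ (y - 1) (y + 1) _ _ (fun=> 4 / 3)) => //.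
- move=> z _; exact: (@continuous_integrable_itv R _ 0 2 (@continuous_spline_cos z)).
- apply: aeW => s _ z _; apply: cvgM; first exact: cvg_cst.
  have : continuous (fun z => cos (s * z)); last exact.
  by apply: is_derive_continuous => x; exact: is_derive_eq.
- apply: (@continuous_integrable_itv R _ 0 2); exact: cst_continuous.
- move=> z _; apply: aeW => s; rewrite /= in_itv/= => /spline_bounds/andP[s0 s1].
  rewrite normrM ger0_norm//; apply: le_trans s1.
  by rewrite ler_piMr// cos_max.
- by rewrite inE/= in_itv/=; apply/andP; split; lra.
Qed.

End kernel.

(** * Tails, central mass and symmetry of the kernel *)

Section kernel_mass.
Context {R : realType}.
Implicit Types (a c s v x y z : R).
Notation mu := (@lebesgue_measure R).

Let measurable_jackson : measurable_fun setT (@jackson R).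
Proof. exact: continuous_measurable_fun continuous_jackson. Qed.

Lemma integral_jackson_tail a : 0 < a ->
  (\int[mu]_(v in `[a, +oo[) (jackson v)%:E <= (16 / (3 * a ^+ 3))%:E)%E.
Proof.
move=> a0; pose F v : R := - (16 / 3) * v ^- 3.
have dF v : a <= v -> is_derive v 1 F (16 / v ^+ 4).
  move=> av; have v0 : v != 0 by rewrite gt_eqF// (lt_le_trans a0).
  have dV : is_derive v 1 (fun x : R => (x ^+ 3)^-1) (- (v ^+ 3) ^- 2 *: (3 * v ^+ 2)).
    apply: (@is_deriveV R (fun x : R => x ^+ 3)); first by rewrite expf_neq0.
    by apply: is_derive_eq; rewrite /GRing.scale/=; ring.
  by apply: is_derive_eq; rewrite /GRing.scale/=; field.
have Fl : F x @[x --> +oo] --> (0 : R).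
  rewrite -(mulr0 (- (16 / 3))); apply: cvgM; first exact: cvg_cst.
  apply/gtr0_cvgV0; first by near=> x; rewrite exprn_gt0.
  apply/cvgryPge => A; near=> x.
  apply: (@le_trans _ _ x) => //.
  have x1 : 1 <= x by [].
  by rewrite -[leLHS]expr1 ler_weXn2l.
have cV v : a <= v -> {for v, continuous (fun v => 16 / v ^+ 4)}.
  move=> av; apply: cvgM; first exact: cvg_cst.
  apply: cvgV; first by rewrite expf_neq0// gt_eqF// (lt_le_trans a0).
  have : continuous (fun x : R => x ^+ 4); last exact.
  by apply: is_derive_continuous => x; exact: is_derive_eq.
have -> : 16 / (3 * a ^+ 3) = 0 - F a by rewrite /F; field; rewrite gt_eqF.
rewrite -(ge0_integral_FTC2y _ dF cV Fl); last first.
  by move=> v av; rewrite divr_ge0// exprn_even_ge0.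
have mC : measurable_fun `[a, +oo[ (fun v : R => 16 / v ^+ 4).
  apply: subspace_continuous_measurable_fun; first exact: measurable_itv.
  apply: continuous_in_subspaceT => v; rewrite inE/= in_itv/= andbT => av.
  exact: cV.
apply: ge0_le_integral => //=.
- by move=> v _; rewrite lee_fin jackson_ge0.
- exact/measurable_EFinP/measurable_funTS.
- exact/measurable_EFinP.
- move=> v; rewrite /= in_itv/= andbT => av.
  by rewrite lee_fin jackson_le_tail// (lt_le_trans a0).
Unshelve. all: end_near. Qed.

Lemma integral_jackson_tailN a : 0 < a ->
  (\int[mu]_(v in `]-oo, (- a)%R]) (jackson v)%:E <= (16 / (3 * a ^+ 3))%:E)%E.
Proof.
move=> a0; rewrite ge0_integration_by_substitutionNy.
- under eq_integral do rewrite /= jacksonN.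
  exact: integral_jackson_tail.
- exact: continuous_subspaceT continuous_jackson.
- by move=> x _; exact: jackson_ge0.
Qed.

Lemma integrable_jackson : mu.-integrable setT (EFin \o @jackson R).
Proof.
apply/integrableP; split; first exact/measurable_EFinP.
under eq_integral do rewrite /= ger0_norm ?jackson_ge0//.
have -> : [set: R] = `]-oo, (-1)%R] `|` (`]-1, 1[ `|` `[1, +oo[).
  apply/seteqP; split => // x _; rewrite /= !in_itv/= andbT.
  have [x1|x1] := leP x (-1); first by left.
  by have [x2|x2] := ltP x 1; [right; left|right; right].
have mE (D : set R) : measurable D -> measurable_fun D (fun v => (jackson v)%:E).
  by move=> mD; exact/measurable_EFinP/measurable_funTS.
have pos v : (0 <= (jackson v)%:E)%E by rewrite lee_fin jackson_ge0.
apply: (@le_lt_trans _ _ ((16 / (3 * 1 ^+ 3))%:E + (2%:E + (16 / (3 * 1 ^+ 3))%:E))%E);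
  last by rewrite ltry.
have mU : measurable (`]-1, 1[ `|` `[1, +oo[ : set R) by exact: measurableU.
rewrite ge0_integral_setU//=; last 2 first.
- by apply: mE; exact: measurableU.
- apply/disj_setPS => x [] /=; rewrite !in_itv/= andbT => x1 [] x2; lra.
apply: leeD.
  by apply: integral_jackson_tailN; exact: ltr01.
rewrite ge0_integral_setU//=; last 2 first.
- exact: mE.
- by apply/disj_setPS => x [] /=; rewrite !in_itv/= andbT => x1 x2; lra.
apply: leeD; last by apply: integral_jackson_tail; exact: ltr01.
apply: (@le_trans _ _ (\int[mu]_(x in `](-1)%R, 1%R[) (cst 1%:E x))%E).
  apply: ge0_le_integral => //=; first exact: mE.
  by move=> x _; rewrite lee_fin jackson_le1.
rewrite integral_cst//= mul1e lebesgue_measure_itv/= lte_fin ifT; last lra.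
by rewrite -EFinD lee_fin; lra.
Qed.

(** The polynomial minorant is integrated exactly. The cut 5/2 leaves at most 0.683 outside, little
    enough for the smoothing argument. *)
Lemma jackson_center : 353 / 100 <= \int[mu]_(v in `[(- (5 / 2)), (5 / 2)]) jackson v.
Proof.
pose F v : R := v - v ^+ 3 / 3 / 6 + v ^+ 5 / 5 / 12 / 12.
have dF v : is_derive v 1 F ((1 - v ^+ 2 / 12) ^+ 2).
  by apply: is_derive_eq; rewrite /GRing.scale/=; field.
have cf : continuous (fun v : R => (1 - v ^+ 2 / 12) ^+ 2).
  by apply: is_derive_continuous => x; exact: is_derive_eq.
have := @Rintegral_FTC2 R F _ (- (5 / 2)) (5 / 2) _ dF cf.
move=> /(_ _) h; apply: (@le_trans _ _ (F (5 / 2) - F (- (5 / 2)))).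
  by rewrite /F; lra.
rewrite -h; last lra.
apply: le_Rintegral => //.
- exact: (@continuous_integrable_itv R _ _ _ cf).
- exact: (@continuous_integrable_itv R _ _ _ continuous_jackson).
- move=> v /=; rewrite in_itv/= => /andP[v1 v2]; apply: jackson_ge_center.
  nra.
Qed.

(** Allows an affine bound, averaged against the kernel on a symmetric window, to be replaced by its
    value at the centre. *)
Lemma jackson_odd a : 0 <= a ->
  \int[mu]_(v in `[(- a), a]) (v * jackson v) = 0.
Proof.
move=> a0; have cf : continuous (fun v : R => v * jackson v).
  by move=> v; apply: cvgM; [exact: cvg_id|exact: continuous_jackson].
have h : \int[mu]_(v in `[(- a), a]) (v * jackson v) =
    - \int[mu]_(v in `[(- a), a]) (v * jackson v).
  rewrite -[RHS]mulN1r -RintegralZl; [|by []|exact: (@continuous_integrable_itv R _ _ _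
      cf)].
  rewrite /Rintegral; congr fine.
  have := @integration_by_substitution_oppr R (fun v => v * jackson v) (- a) a.
  rewrite opprK ge0_cp// => ->//; last exact: continuous_subspaceT.
  by apply: eq_integral => v _; rewrite /= jacksonN; congr EFin; ring.
by move/eqP: h; rewrite -addr_eq0 -mulr2n mulrn_eq0 => /eqP.
Qed.

End kernel_mass.

(** * Esseen's smoothing inequality *)

Section cut_exponential.
Context {R : realType}.
Implicit Types (theta s v x y z : R).
Notation mu := (@lebesgue_measure R).

(** The half-line is open at 0, matching the strict inequality in the tail event. *)
Definition cut_exp theta y : R := expR (- (theta * y)) * \1_(`]0, +oo[ : set R) y.

Lemma cut_expE theta y :
  cut_exp theta y = if 0 < y then expR (- (theta * y)) else 0.
Proof.
rewrite /cut_exp indicE; case: ifPn => y0.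
  by rewrite mem_set ?mulr1//= in_itv/= y0.
by rewrite memNset ?mulr0//= in_itv/= andbT; exact/negP.
Qed.

Lemma measurable_cut_exp theta : measurable_fun setT (cut_exp theta).
Proof.
apply: measurable_funM; last exact: measurable_indic.
apply: continuous_measurable_fun.
by apply: is_derive_continuous => x; exact: is_derive_eq.
Qed.

Lemma cut_exp_ge0 theta y : 0 <= cut_exp theta y.
Proof. by rewrite cut_expE; case: ifP => // _; exact: expR_ge0. Qed.

Lemma cut_exp_le1 theta y : 0 <= theta -> cut_exp theta y <= 1.
Proof.
move=> t0; rewrite cut_expE; case: ifPn => // y0.
by rewrite expR_le1 oppr_le0 mulr_ge0// ltW.
Qed.

Lemma cut_exp_shift theta y z : 0 <= theta -> 0 <= z ->
  cut_exp theta (y - z) <= expR (theta * z) * cut_exp theta y.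
Proof.
move=> t0 z0; rewrite !cut_expE; case: ifPn => yz; case: ifPn => y0.
- by rewrite -expRD ler_expR; lra.
- by move: y0; rewrite (lt_le_trans yz)// lerBlDr lerDl.
- by rewrite mulr_ge0 ?expR_ge0.
- by rewrite mulr0.
Qed.

Section laplace.
Variables (theta y s : R).
Hypothesis theta0 : 0 < theta.

Let q : R := theta ^+ 2 + s ^+ 2.

Let q0 : 0 < q.
Proof. by rewrite ltr_pwDl ?sqr_ge0// exprn_gt0. Qed.

Let G b v : R := expR (- (theta * (y + v))) *
  (- theta^-1 + b * ((s * sin (s * v) - theta * cos (s * v)) / q)).

Let dG b v : is_derive v 1 (G b) (expR (- (theta * (y + v))) * (1 + b * cos (s * v))).
Proof.
have tn0 : theta != 0 by rewrite gt_eqF.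
have qn0 : q != 0 by rewrite gt_eqF.
apply: is_derive_eq; rewrite /GRing.scale/= /q; field.
by rewrite -/q qn0 tn0.
Qed.

Let cvgG b : G b v @[v --> +oo] --> 0.
Proof.
apply: norm_cvg0.
pose C := theta^-1 + `|b| * ((`|s| + theta) / q).
have h : C * expR (- (theta * (y + v))) @[v --> +oo] --> 0.
  rewrite -[X in _ --> X](mulr0 C); apply: cvgM; first exact: cvg_cst.
  have c1 : theta * (y + v) @[v --> +oo] --> +oo.
    apply/cvgryPge => A; near=> v.
    rewrite -ler_pdivrMl// -lerBlDl; near: v.
    by apply: nbhs_pinfty_ge; exact: num_real.
  exact: (@cvg_comp _ _ _ (fun v => theta * (y + v)) (fun x => expR (- x)) _ _ _ c1
      (@cvgr_expR R)).
apply: (squeeze_cvgr _ (cvg_cst 0) h).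
apply: nearW => v; rewrite normr_ge0/= /G normrM ger0_norm ?expR_ge0//.
rewrite mulrC ler_wpM2r ?expR_ge0// /C.
have t0 := ltW theta0; have q0' : 0 <= q^-1 by rewrite invr_ge0 ltW.
apply: (le_trans (ler_normD _ _)); rewrite normrN ger0_norm ?invr_ge0//.
rewrite lerD2l normrM ler_wpM2l// normrM (ger0_norm q0') ler_wpM2r//.
apply: (le_trans (ler_normB _ _)); rewrite !normrM (ger0_norm t0).
by rewrite lerD// ler_piMr// ?sin_max ?cos_max.
Unshelve. all: end_near. Qed.

(** The added 1 keeps the integrand nonnegative, so that the improper fundamental theorem for
    nonnegative functions applies; the cosine transform is then the difference of the cases [b = 1]
    and [b = 0]. *)
Lemma laplace_one_add_cos (b : R) : `|b| <= 1 ->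
  (\int[mu]_v (cut_exp theta (y + v) * (1 + b * cos (s * v)))%:E)%E =
  (theta^-1 + b * ((theta * cos (s * y) + s * sin (s * y)) / q))%:E.
Proof.
move=> b1.
have pos v : 0 <= 1 + b * cos (s * v).
  have : `|b * cos (s * v)| <= 1 by rewrite normrM mulr_ile1// cos_max.
  by rewrite ler_norml => /andP[]; lra.
transitivity (\int[mu]_(v in `[(- y)%R, +oo[)
    (expR (- (theta * (y + v))) * (1 + b * cos (s * v)))%:E)%E.
  rewrite -integral_itv_obnd_cbnd; last first.
    apply/measurable_EFinP; apply: measurable_funTS; apply: continuous_measurable_fun.
    by apply: is_derive_continuous => x; exact: is_derive_eq.
  rewrite [RHS]integral_mkcond; apply: eq_integral => v _; rewrite patchE.
  rewrite cut_expE; case: ifPn => yv.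
    by rewrite mem_set//= in_itv/= andbT; lra.
  by rewrite memNset ?mul0r//= in_itv/= andbT; lra.
rewrite (ge0_integral_FTC2y _ (fun v (_ : - y <= v) => dG b v) _ (cvgG b)).
- congr EFin; rewrite /G subrr mulr0 oppr0 expR0 mulrN sinN cosN; field.
  by rewrite /q; rewrite -/q !gt_eqF.
- by move=> v _; rewrite mulr_ge0// expR_ge0.
- by move=> v _; apply: is_derive_continuous => x; exact: is_derive_eq.
Qed.

End laplace.

Lemma integrable_cut_exp theta y : 0 < theta ->
  mu.-integrable setT (fun v => (cut_exp theta (y + v))%:E).
Proof.
move=> theta0; apply/integrableP; split.
  apply/measurable_EFinP; apply: (measurableT_comp (measurable_cut_exp theta)).
  exact: measurable_funD.
have := laplace_one_add_cos y 0 theta0 (b := 0); rewrite normr0 ler01 => /(_ isT) h.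
under eq_integral do rewrite /= ger0_norm ?cut_exp_ge0//.
rewrite (_ : integral _ _ _ = (theta^-1 + 0 * ((theta * cos (0 * y) +
    0 * sin (0 * y)) / (theta ^+ 2 + 0 ^+ 2)))%:E) ?ltry// -h.
by apply: eq_integral => v _; rewrite mul0r addr0 mulr1.
Qed.

Lemma laplace_cos theta y s : 0 < theta ->
  \int[mu]_v (cut_exp theta (y + v) * cos (s * v)) =
  (theta * cos (s * y) + s * sin (s * y)) / (theta ^+ 2 + s ^+ 2).
Proof.
move=> theta0; set q := _ ^+ 2 + _.
have h1 := laplace_one_add_cos y s theta0 (b := 1); rewrite normr1 lexx in h1.
have h0 := laplace_one_add_cos y s theta0 (b := 0); rewrite normr0 ler01 in h0.
have E1 : \int[mu]_v (cut_exp theta (y + v) * (1 + 1 * cos (s * v))) =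
  theta^-1 + 1 * ((theta * cos (s * y) + s * sin (s * y)) / q).
  by rewrite /Rintegral h1.
have E0 : \int[mu]_v (cut_exp theta (y + v)) = theta^-1.
  rewrite -[RHS]addr0 -[X in _ + X](mul0r ((theta * cos (s * y) + s * sin (s * y)) / q)).
  rewrite -[RHS]/(fine _%:E) -h0//; congr fine; apply: eq_integral => v _.
  by rewrite mul0r addr0 mulr1.
have ic : mu.-integrable setT (fun v => (cut_exp theta (y + v) * cos (s * v))%:E).
  apply: (le_integrable _ _ _ (integrable_cut_exp y theta0)) => //.
  - apply/measurable_EFinP/measurable_funM; last first.
      by apply: continuous_measurable_fun; apply: is_derive_continuous => x; exact:
          is_derive_eq.
    by apply: (measurableT_comp (measurable_cut_exp theta)); exact: measurable_funD.
  - by move=> v _; rewrite lee_fin normrM ler_piMr// cos_max.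
move: E1; rewrite (_ : \int[mu]_v _ = \int[mu]_v
   (cut_exp theta (y + v) + cut_exp theta (y + v) * cos (s * v))).
  by rewrite RintegralD//; [rewrite E0 mul1r => /addrI|exact: integrable_cut_exp].
by apply: eq_Rintegral => v _; ring.
Qed.

End cut_exponential.

(** * The smoothed cut exponential on the Fourier side *)

Section smoothing.
Context {R : realType}.
Implicit Types (theta s v x y z c : R).
Notation mu := (@lebesgue_measure R).

Let ks : R -> R := @spline R \_ `[0, 2].

Let ksE s : ks s = if (0 <= s <= 2) then spline s else 0.
Proof.
rewrite /ks patchE; case: ifPn => [|sn].
  by rewrite inE/= in_itv/= => ->.
by case: ifPn => // s02; case/negP: sn; rewrite inE/= in_itv/=.
Qed.

Let mks : measurable_fun setT ks.
Proof.
apply/(measurable_restrict _ _ _).1 => //; rewrite setTI.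
by apply: measurable_funTS; apply: continuous_measurable_fun; exact: continuous_spline.
Qed.

Let ks_ge0 s : 0 <= ks s.
Proof. by rewrite ksE; case: ifP => // /spline_bounds/andP[]. Qed.

Let iks : mu.-integrable setT (EFin \o ks).
Proof.
rewrite /ks -restrict_EFin; apply/integrable_restrict => //; rewrite setTI.
by apply: continuous_integrable_itv; exact: continuous_spline.
Qed.

Let jackson_ks v : jackson v = \int[mu]_s (ks s * cos (s * v)).
Proof.
rewrite /jackson Rintegral_mkcond; apply: eq_Rintegral => s _.
by rewrite /ks !patchE; case: ifP => // _; rewrite mul0r.
Qed.

Let mtrig (f : R -> R) : continuous f -> measurable_fun setT f.
Proof. exact: continuous_measurable_fun. Qed.

Section transform.
Variables (theta : R).
Hypothesis theta0 : 0 < theta.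

Let q s := theta ^+ 2 + s ^+ 2.

Let q0 s : 0 < q s.
Proof. by rewrite ltr_pwDl ?sqr_ge0// exprn_gt0. Qed.

(** Fubini on the cosine representation of the kernel: only frequencies in [[0, 2]] remain, and the
    inner integral is the transform just computed. *)
Lemma jackson_cut_exp y :
  \int[mu]_v (jackson v * cut_exp theta (y + v)) =
  \int[mu]_s (ks s * ((theta * cos (s * y) + s * sin (s * y)) / q s)).
Proof.
pose f (z : R * R) := ks z.2 * cos (z.2 * z.1) * cut_exp theta (y + z.1).
have mf : measurable_fun setT f.
  apply: measurable_funM; first apply: measurable_funM.
  - exact: measurableT_comp.
  - apply: (measurableT_comp (mtrig (@continuous_cos R))).
    exact: measurable_funM.
  - apply: (measurableT_comp (measurable_cut_exp theta)).
    exact: measurable_funD.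
have fle v s : `|f (v, s)| <= cut_exp theta (y + v) * ks s.
  rewrite /f/= normrM (ger0_norm (cut_exp_ge0 _ _)) normrM (ger0_norm (ks_ge0 s)).
  by rewrite mulrC ler_wpM2l ?cut_exp_ge0// ler_piMr// cos_max.
have ih := integrable_cut_exp y theta0.
have := @Rintegral_dominated_Fubini _ _ _ _ R mu mu f (fun v => cut_exp theta (y + v))
    ks mf ih iks fle.
have mcos (x : R) : measurable_fun setT (fun s => cos (s * x)).
  by apply: (measurableT_comp (mtrig (@continuous_cos R))); exact: measurable_funM.
have ikc v : mu.-integrable setT (EFin \o (fun s => ks s * cos (s * v))).
  apply: (le_integrable _ _ _ iks) => //.
    by apply/measurable_EFinP; apply: measurable_funM; [exact: mks|exact: mcos].
  by move=> s _; rewrite lee_fin normrM ler_piMr// cos_max.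
have ihc s : mu.-integrable setT (EFin \o (fun v => cut_exp theta (y + v) * cos (s * v))).
  apply: (le_integrable _ _ _ ih) => //.
    apply/measurable_EFinP; apply: measurable_funM.
      by apply: (measurableT_comp (measurable_cut_exp theta)); exact: measurable_funD.
    by under eq_fun do rewrite mulrC; exact: mcos.
  by move=> v _; rewrite lee_fin normrM ler_piMr// cos_max.
move=> FE; transitivity (\int[mu]_v \int[mu]_s f (v, s)).
  apply: eq_Rintegral => v _; rewrite jackson_ks.
  by rewrite -(RintegralZr _ measurableT (ikc v)).
rewrite FE; apply: eq_Rintegral => s _; rewrite -(laplace_cos y s theta0).
rewrite -(RintegralZl _ measurableT (ihc s)); apply: eq_Rintegral => v _.
by rewrite /f/= -mulrA [cos _ * _]mulrC.
Qed.

Context d (T : measurableType d) (Q : probability T R) (Y : T -> R).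
Hypothesis mY : measurable_fun setT Y.

Definition cut_mean c := \int[Q]_w cut_exp theta (Y w - c).

Let mcutY c : measurable_fun setT (fun w => cut_exp theta (Y w - c)).
Proof.
apply: (measurableT_comp (measurable_cut_exp theta)).
exact: measurable_funB.
Qed.

Let icutY c : Q.-integrable setT (fun w => (cut_exp theta (Y w - c))%:E).
Proof.
apply: (@integrable_bounded _ _ _ Q _ 1) => // w.
by rewrite ger0_norm ?cut_exp_ge0// cut_exp_le1// ltW.
Qed.

Lemma cut_mean_ge0 c : 0 <= cut_mean c.
Proof. by apply: Rintegral_ge0 => w _; exact: cut_exp_ge0. Qed.

Lemma cut_mean_le1 c : cut_mean c <= 1.
Proof.
have -> : 1 = \int[Q]_w 1 :> R.
  by rewrite Rintegral_cst_probability.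
apply: le_Rintegral => //.
- exact: icutY.
- by apply: (@integrable_bounded _ _ _ Q _ 1) => // w; rewrite normr1.
- by move=> w _; rewrite cut_exp_le1// ltW.
Qed.

Lemma cut_mean_shift c z : 0 <= z ->
  cut_mean (c + z) <= expR (theta * z) * cut_mean c.
Proof.
move=> z0; rewrite /cut_mean -RintegralZl//; last exact: icutY.
apply: le_Rintegral => //.
- exact: icutY.
- exact: (integrableZl _ (expR (theta * z)) (icutY c)).
- by move=> w _; rewrite opprD addrA cut_exp_shift// ltW.
Qed.

Lemma measurable_cut_mean : measurable_fun setT cut_mean.
Proof.
pose f (z : R * T) := (cut_exp theta (Y z.2 - z.1))%:E.
have mf : measurable_fun setT f.
  apply/measurable_EFinP; apply: (measurableT_comp (measurable_cut_exp theta)).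
  by apply: measurable_funB => //; exact: measurableT_comp.
apply/measurable_EFinP; rewrite (_ : _ \o _ = fubini_F Q f).
  apply: measurable_fun_fubini_tonelli_F => // z.
  by rewrite lee_fin cut_exp_ge0.
apply/funext => c; rewrite /cut_mean /Rintegral /= fineK//.
exact: integrable_fin_num (icutY c).
Qed.

Let cos_mean s c := \int[Q]_w cos (s * (Y w - c)).
Let sin_mean s c := \int[Q]_w sin (s * (Y w - c)).

(** The previous identity averaged over [Y]. Integrability is part of the conclusion because the
    transforms of two laws will be subtracted. *)
Lemma jackson_cut_mean c :
  mu.-integrable setT (EFin \o (fun s =>
    ks s * ((theta * cos_mean s c + s * sin_mean s c) / q s))) /\
  \int[mu]_v (jackson v * cut_mean (c - v)) =
  \int[mu]_s (ks s * ((theta * cos_mean s c + s * sin_mean s c) / q s)).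
Proof.
pose f (z : R * T) := jackson z.1 * cut_exp theta (Y z.2 - c + z.1).
have mYc : measurable_fun setT (fun w => Y w - c) by exact: measurable_funB.
have mf : measurable_fun setT f.
  apply: measurable_funM.
    apply: (measurableT_comp (continuous_measurable_fun (@continuous_jackson R))).
    exact: measurable_fst.
  apply: (measurableT_comp (measurable_cut_exp theta)).
  by apply: measurable_funD => //; exact: (measurableT_comp mYc measurable_snd).
have i1 : Q.-integrable setT (EFin \o (fun=> 1 : R)).
  by apply: (@integrable_bounded _ _ _ Q _ 1) => // w; rewrite normr1.
have fle v w : `|f (v, w)| <= jackson v * 1.
  rewrite /f/= normrM (ger0_norm (jackson_ge0 _)) ler_wpM2l ?jackson_ge0//.
  by rewrite ger0_norm ?cut_exp_ge0// cut_exp_le1// ltW.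
pose g (z : R * T) := ks z.1 *
  ((theta * cos (z.1 * (Y z.2 - c)) + z.1 * sin (z.1 * (Y z.2 - c))) / q z.1).
have mq : measurable_fun setT (fun s => (q s)^-1).
  apply: continuous_measurable_fun => s; apply: cvgV; first by rewrite gt_eqF.
  have : continuous q; last exact.
  by apply: is_derive_continuous => x; exact: is_derive_eq.
have mprod : measurable_fun setT (fun z : R * T => z.1 * (Y z.2 - c)).
  by apply: measurable_funM => //; exact: (measurableT_comp mYc measurable_snd).
have mg : measurable_fun setT g.
  apply: measurable_funM; first exact: (measurableT_comp mks measurable_fst).
  apply: measurable_funM; last exact: (measurableT_comp mq measurable_fst).
  apply: measurable_funD; apply: measurable_funM => //.
    exact: (measurableT_comp (mtrig (@continuous_cos R))).
  exact: (measurableT_comp (mtrig (@continuous_sin R))).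
(* For [s] in [[0, 2]] the numerator is at most [theta + 2] and the denominator at least
   [theta ^+ 2]. *)
pose C := (theta + 2) / theta ^+ 2.
have t0 := ltW theta0.
have gle s w : `|g (s, w)| <= (ks s * C) * 1.
  rewrite /g/= mulr1 normrM (ger0_norm (ks_ge0 s)) ksE.
  case: ifPn => [/[dup]/spline_bounds/andP[k0 _] /andP[s0 s2]|_]; last by rewrite !mul0r.
  apply: ler_wpM2l => //.
  have qV0 : 0 <= (q s)^-1 by rewrite invr_ge0 ltW.
  rewrite normrM (ger0_norm qV0); apply: ler_pM => //.
    apply: (le_trans (ler_normD _ _)); rewrite !normrM (ger0_norm t0) (ger0_norm s0).
    apply: lerD; first by rewrite ler_piMr// cos_max.
    by apply: le_trans s2; rewrite ler_piMr// sin_max.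
  by rewrite lef_pV2 ?posrE ?exprn_gt0// lerDl sqr_ge0.
have ikC : mu.-integrable setT (EFin \o (fun s => ks s * C)).
  exact: (integrableZr measurableT C iks).
have gE s : \int[Q]_w g (s, w) =
    ks s * ((theta * cos_mean s c + s * sin_mean s c) / q s).
  rewrite /g/=.
  have ic : Q.-integrable setT (EFin \o (fun w => cos (s * (Y w - c)))).
    apply: (@integrable_bounded _ _ _ Q _ 1); last by move=> w; exact: cos_max.
    by apply: (measurableT_comp (mtrig (@continuous_cos R))); exact: measurable_funM.
  have is_ : Q.-integrable setT (EFin \o (fun w => sin (s * (Y w - c)))).
    apply: (@integrable_bounded _ _ _ Q _ 1); last by move=> w; exact: sin_max.
    by apply: (measurableT_comp (mtrig (@continuous_sin R))); exact: measurable_funM.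
  have ict := integrableZl measurableT theta ic.
  have ist := integrableZl measurableT s is_.
  rewrite /cos_mean /sin_mean -RintegralZl// -RintegralZl// -RintegralD//.
  rewrite -RintegralZr//; last exact: (integrableD measurableT ict ist).
  rewrite -RintegralZl//.
  exact: (integrableZr measurableT (q s)^-1 (integrableD measurableT ict ist)).
split.
  have := @integrable_dominated_inner1 _ _ _ _ R mu Q g _ (fun=> 1) mg ikC i1 gle.
  by apply: eq_integrable => // s _; rewrite /= gE.
transitivity (\int[mu]_v \int[Q]_w f (v, w)).
  apply: eq_Rintegral => v _; rewrite /cut_mean -RintegralZl//; last exact: icutY.
  by apply: eq_Rintegral => w _; rewrite /f/= opprB addrA addrAC.
rewrite (@Rintegral_dominated_Fubini _ _ _ _ R mu Q f _ (fun=> 1) mf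
    (@integrable_jackson R) i1 fle).
transitivity (\int[Q]_w \int[mu]_s g (s, w)).
  by apply: eq_Rintegral => w _; exact: (jackson_cut_exp (Y w - c)).
rewrite -(@Rintegral_dominated_Fubini _ _ _ _ R mu Q g _ (fun=> 1) mg ikC i1 gle).
by apply: eq_Rintegral => s _; exact: gE.
Qed.

End transform.
End smoothing.

(** * From a smoothed bound to a pointwise bound *)

Section esseen.
Context {R : realType}.
Implicit Types (theta s v x y z c e m h : R).
Notation mu := (@lebesgue_measure R).

Let a : R := 5 / 2.

Let inner_mass : R := \int[mu]_(v in `[(- a), a]) jackson v.

Let mJ : measurable_fun setT (@jackson R).
Proof. exact: continuous_measurable_fun continuous_jackson. Qed.

(* Esseen's smoothing argument: a function that cannot grow fast is, at an
   almost extremal point, almost extremal on a whole interval. *)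
Section one_sided_lipschitz.
Variables (D : R -> R) (theta m e : R).
Hypothesis mD : measurable_fun setT D.
Hypothesis D1 : forall v, `|D v| <= 1.
Hypothesis theta_bounds : 0 <= theta <= 27 / 200.
Hypothesis m0 : 0 <= m.
Hypothesis e0 : 0 <= e.
Hypothesis D_shift : forall v h, 0 <= h ->
  D (v + h) <= expR (theta * h) * (D v + m * h).
Hypothesis D_smooth : forall c, `|\int[mu]_v (jackson v * D (c - v))| <= e.

Let Delta := sup [set `|D v| | v in setT].

Let Delta_ub v : `|D v| <= Delta.
Proof.
apply: ub_le_sup; last by exists v.
by exists 1 => _ [w _ <-].
Qed.

Let Delta0 : 0 <= Delta.
Proof. exact: le_trans (normr_ge0 _) (Delta_ub 0). Qed.

Let mDc c : measurable_fun setT (fun v => jackson v * D (c - v)).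
Proof.
by apply: measurable_funM => //; apply: (measurableT_comp mD); exact: measurable_funB.
Qed.

Let iD c : mu.-integrable setT (EFin \o (fun v => jackson v * D (c - v))).
Proof.
apply: (le_integrable _ _ _ (@integrable_jackson R)) => //.
  by apply/measurable_EFinP; exact: mDc.
by move=> v _; rewrite lee_fin normrM ler_piMr// D1.
Qed.

(** 683/1000 rounds up the sum of the two tail bounds [16 / (3 a^3)] at [a = 5/2]. *)
Let outer c : `|\int[mu]_(v in ~` `[(- a), a]) (jackson v * D (c - v))| <=
  Delta * (683 / 1000).
Proof.
have mC : measurable (~` `[(- a), a] : set R) by exact: measurableC.
have iK : mu.-integrable (~` `[(- a), a]) (EFin \o @jackson R).
  by apply: integrableS (@integrable_jackson R).
have iDC : mu.-integrable (~` `[(- a), a]) (EFin \o (fun v => jackson v * D (c - v))).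
  by apply: integrableS (iD c).
apply: le_trans; first exact: le_normr_Rintegral.
apply: (@le_trans _ _ (\int[mu]_(v in ~` `[(- a), a]) (Delta * jackson v))).
  apply: le_Rintegral => //.
  - exact: integrable_norm iDC.
  - exact: integrable_EFinZl.
  - by move=> v _; rewrite normrM ger0_norm ?jackson_ge0// mulrC ler_wpM2r ?jackson_ge0.
rewrite RintegralZl// ler_wpM2l//.
have a0 : 0 < a by rewrite /a; lra.
have mE (A : set R) : measurable A -> measurable_fun A (fun v => (jackson v)%:E).
  by move=> mA; apply/measurable_EFinP; exact: measurable_funTS.
have pos v : (0 <= (jackson v)%:E)%E by rewrite lee_fin jackson_ge0.
have : (\int[mu]_(v in ~` `[(- a)%R, a]) (jackson v)%:E <=
    (16 / (3 * a ^+ 3))%:E + (16 / (3 * a ^+ 3))%:E)%E.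
  rewrite setCitv ge0_integral_setU//=; last 2 first.
  - by apply: mE; exact: measurableU.
  - by apply/disj_setPS => x [] /=; rewrite !in_itv/= andbT => x1 x2; lra.
  apply: leeD.
    apply: le_trans (integral_jackson_tailN a0).
    apply: ge0_subset_integral => //=; first exact: mE.
    by move=> x /=; rewrite !in_itv/= => /ltW.
  apply: le_trans (integral_jackson_tail a0).
  apply: ge0_subset_integral => //=; first exact: mE.
  by move=> x /=; rewrite !in_itv/= !andbT => /ltW.
have fK : (\int[mu]_(v in ~` `[(- a)%R, a]) (jackson v)%:E)%E \is a fin_num.
  by apply: integrable_fin_num.
rewrite -EFinD -(fineK fK) lee_fin => /le_trans; apply.
by rewrite /a; lra.
Qed.

Let split_mass c : \int[mu]_v (jackson v * D (c - v)) =
  \int[mu]_(v in `[(- a), a]) (jackson v * D (c - v)) +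
  \int[mu]_(v in ~` `[(- a), a]) (jackson v * D (c - v)).
Proof.
rewrite -Rintegral_setU//.
- by rewrite setUv.
- exact: measurableC.
- by rewrite setUv.
- by rewrite disj_set2E setICr.
Qed.

Let inner_lin x y : \int[mu]_(v in `[(- a), a]) (jackson v * (x + y * v)) =
  x * inner_mass.
Proof.
have i1 : mu.-integrable `[(- a), a] (EFin \o @jackson R).
  by apply: continuous_integrable_itv; exact: continuous_jackson.
have i2 : mu.-integrable `[(- a), a] (EFin \o (fun v => v * jackson v)).
  apply: continuous_integrable_itv => v; apply: cvgM; first exact: cvg_id.
  exact: continuous_jackson.
transitivity (\int[mu]_(v in `[(- a), a]) (x * jackson v + y * (v * jackson v))).
  by apply: eq_Rintegral => v _; ring.
rewrite RintegralD//; last 2 first.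
- exact: (integrableZl _ x i1).
- exact: (integrableZl _ y i2).
by rewrite !RintegralZl// jackson_odd ?mulr0 ?addr0// /a; lra.
Qed.

Let ilin x y : mu.-integrable `[(- a), a] (EFin \o (fun v => jackson v * (x + y * v))).
Proof.
apply: continuous_integrable_itv => v; apply: cvgM; first exact: continuous_jackson.
have : continuous (fun v => x + y * v); last exact.
by apply: is_derive_continuous => z; exact: is_derive_eq.
Qed.

Let iDin c : mu.-integrable `[(- a), a] (EFin \o (fun v => jackson v * D (c - v))).
Proof. by apply: integrableS (iD c). Qed.

Let expR_small h : 0 <= h -> 1 - theta * h <= expR (- (theta * h)).
Proof. by move=> h0; exact: expR_ge1Dx. Qed.

(** The window is centred at [v - a], so its points [v - a - u] lie to the left of [v] by
    [a + u >= 0]; there [D_shift] bounds [D] from below by an affine function of [u], and against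
    the even kernel only its value at [u = 0] counts. *)
Let bound_pos v : 0 <= D v ->
  ((1 - theta * a) * D v - m * a) * inner_mass <= e + Delta * (683 / 1000).
Proof.
move=> Dv0; have [t0 _] := andP theta_bounds.
have := D_smooth (v - a); rewrite split_mass ler_norml => /andP[_ h1].
have := outer (v - a); rewrite ler_norml => /andP[h2 _].
have h3 : ((1 - theta * a) * D v - m * a) * inner_mass <=
    \int[mu]_(u in `[(- a), a]) (jackson u * D (v - a - u)).
  rewrite -(inner_lin _ (- (theta * D v + m))); apply: le_Rintegral => //.
  move=> u /=; rewrite in_itv/= => /andP[u1 u2]; rewrite ler_wpM2l ?jackson_ge0//.
  have h0 : 0 <= a + u by lra.
  have := D_shift (v - a - u) h0.
  rewrite (_ : v - a - u + (a + u) = v); last by ring.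
  have := expR_small h0; have := expR_gt0 (- (theta * (a + u))).
  set E := expR (- _) => E0 E1 h4.
  have : E * D v <= D (v - a - u) + m * (a + u).
    rewrite -(ler_pM2l (expR_gt0 (theta * (a + u)))) mulrA /E expRN.
    by rewrite divff ?mul1r// gt_eqF// expR_gt0.
  nra.
lra.
Qed.

Let bound_neg v : m * (2 * a) <= - D v ->
  (- D v - m * a) * inner_mass <= e + Delta * (683 / 1000).
Proof.
move=> Dv0; have [t0 _] := andP theta_bounds.
have := D_smooth (v + a); rewrite split_mass ler_norml => /andP[h1 _].
have := outer (v + a); rewrite ler_norml => /andP[_ h2].
have h3 : \int[mu]_(u in `[(- a), a]) (jackson u * D (v + a - u)) <=
    (D v + m * a) * inner_mass.
  rewrite -(inner_lin _ (- m)); apply: le_Rintegral => //.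
  move=> u /=; rewrite in_itv/= => /andP[u1 u2]; rewrite ler_wpM2l ?jackson_ge0//.
  have h0 : 0 <= a - u by lra.
  have := D_shift v h0; rewrite addrA.
  have : 1 <= expR (theta * (a - u)) by rewrite -expR0 ler_expR mulr_ge0.
  have : m * (a - u) <= m * (2 * a) by rewrite ler_wpM2l//; lra.
  nra.
lra.
Qed.

(** Where [|D w|] exceeds [2 a m], both signs give [(1 - theta a) |D w| <= m a + e / 3.53 + Delta
    (0.683 / 3.53)]. After passing to the supremum, with [theta <= 27/200], the net coefficient of
    [Delta] is about 0.469, whence 61/100 and 54/10. *)
Lemma esseen_bound v : `|D v| <= 61 / 100 * e + 54 / 10 * m.
Proof.
apply: le_trans (Delta_ub v) _.
have I353 : 353 / 100 <= inner_mass by exact: jackson_center.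
have [t0 t1] := andP theta_bounds.
have key w : m * (2 * a) <= `|D w| ->
    (1 - theta * a) * `|D w| <= m * a + e * (100 / 353) + Delta * (683 / 3530).
  move=> Dw.
  have X0 : ((1 - theta * a) * `|D w| - m * a) * inner_mass <= e + Delta * (683 / 1000).
    have [Dw0|Dw0] := leP 0 (D w); first by rewrite ger0_norm// bound_pos.
    rewrite ltr0_norm// in Dw *.
    apply: le_trans (bound_neg Dw); rewrite ler_wpM2r//; first lra.
    rewrite lerD2r -[leRHS]mul1r ler_wpM2r//; first lra.
    rewrite /a; nra.
  have [X1|X1] := leP 0 ((1 - theta * a) * `|D w| - m * a); last first.
    by move: X1 e0 Delta0; lra.
  have : ((1 - theta * a) * `|D w| - m * a) * (353 / 100) <= e + Delta * (683 / 1000).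
    by apply: le_trans X0; rewrite ler_wpM2l.
  lra.
have Dle w : `|D w| <= Num.max (m * (2 * a))
    ((m * a + e * (100 / 353) + Delta * (683 / 3530)) / (1 - theta * a)).
  rewrite le_max; have [//|/ltW/key h] := leP `|D w| (m * (2 * a)).
  by rewrite ler_pdivlMr 1?mulrC// /a; lra.
have : Delta <= Num.max (m * (2 * a))
    ((m * a + e * (100 / 353) + Delta * (683 / 3530)) / (1 - theta * a)).
  by apply: ge_sup; [exists `|D 0|, 0|move=> _ [w _ <-]].
rewrite le_max => /orP[h|]; first by move: h m0 e0; rewrite /a; lra.
rewrite ler_pdivlMr; last by rewrite /a; lra.
have : Delta * (1 - 27 / 200 * a) <= Delta * (1 - theta * a).
  by rewrite ler_wpM2l// lerD2l lerN2 ler_wpM2r// /a; lra.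
by move: m0 e0 Delta0; rewrite /a; lra.
Qed.

End one_sided_lipschitz.
End esseen.

(** * The normal law and its Mills ratio *)

Section gaussian.
Context {R : realType}.
Implicit Types (s y p x : R).
Notation mu := (@lebesgue_measure R).

Lemma integral_normal_prob (m sigma : R) (f : R -> \bar R) :
  measurable_fun setT f -> (forall x, 0 <= f x)%E ->
  (\int[normal_prob m sigma]_x f x = \int[mu]_x (f x * (normal_pdf m sigma x)%:E))%E.
Proof.
move=> mf f0.
have mw := measurable_normal_pdf m sigma; have w0 := normal_pdf_ge0 m sigma.
rewrite -(@ge0_integral_density _ _ R mu _ mw w0 f mf f0).
by apply: eq_measure_integral => A mA _.
Qed.

Lemma Rintegral_normal_prob (m sigma : R) (f : R -> R) (M : R) :
  measurable_fun setT f -> (forall x, `|f x| <= M) ->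
  \int[normal_prob m sigma]_x f x = \int[mu]_x (f x * normal_pdf m sigma x).
Proof.
move=> mf fM.
have mw := measurable_normal_pdf m sigma; have w0 := normal_pdf_ge0 m sigma.
rewrite -(@Rintegral_density _ _ R mu _ mw w0 (integrable_normal_pdf m sigma) f M mf fM).
by congr fine; apply: eq_measure_integral => A mA _.
Qed.

Lemma cvg_pinfty_mul_bounded (F : R -> R) (K : R) :
  (forall y, `|y| * `|F y| <= K) -> F y @[y --> +oo] --> 0.
Proof.
move=> FK; apply/cvgr0Pnorm_le => e e0; near=> y.
have y0 : 0 < y by near: y; exact: nbhs_pinfty_gt.
rewrite -(ler_pM2l y0); apply: (@le_trans _ _ K).
  by have := FK y; rewrite gtr0_norm.
by rewrite -ler_pdivrMr//; near: y; exact: nbhs_pinfty_ge.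
Unshelve. all: end_near. Qed.

Lemma cvg_ninfty_mul_bounded (F : R -> R) (K : R) :
  (forall y, `|y| * `|F y| <= K) -> F y @[y --> -oo] --> 0.
Proof.
move=> FK; apply/cvgyNP; apply: (@cvg_pinfty_mul_bounded _ K) => y.
by rewrite -normrN; exact: FK.
Qed.

Section characteristic_function.
Variables (sigma : R).
Hypothesis sigma0 : 0 < sigma.

Let phi : R -> R := normal_pdf 0 sigma.

Let phiE y : phi y = normal_peak sigma * expR (- (y ^+ 2 / (2 * sigma ^+ 2))).
Proof.
by rewrite /phi normal_pdfE ?gt_eqF// /normal_fun subr0 mulNr mulr_natl.
Qed.

(** Half of the exponent absorbs [|y|] through [z <= exp (z^2)] with [z = |y| / (2 sigma)]. The
    wider Gaussian dominates the differentiated integrand and gives decay at infinity. *)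
Let phi_bound y : `|y| * phi y <=
  2 * sigma * (normal_peak sigma / normal_peak (Num.sqrt 2 * sigma)) *
  normal_pdf 0 (Num.sqrt 2 * sigma) y.
Proof.
have s20 : 0 < Num.sqrt 2 :> R by rewrite sqrtr_gt0.
have s2 : 0 < Num.sqrt 2 * sigma by rewrite mulr_gt0.
have P2 := normal_peak_gt0 (lt0r_neq0 s2).
rewrite phiE normal_pdfE ?gt_eqF// /normal_fun subr0.
set E := expR (- _ / _).
rewrite [leRHS](_ : _ = 2 * sigma * normal_peak sigma * E); last first.
  by field; rewrite gt_eqF.
rewrite mulrCA [leRHS]mulrAC [leRHS]mulrC ler_pM2l ?normal_peak_gt0 ?gt_eqF//.
have -> : - (y ^+ 2 / (2 * sigma ^+ 2)) =
    - y ^+ 2 / ((Num.sqrt 2 * sigma) ^+ 2 *+ 2) - (`|y| / (2 * sigma)) ^+ 2.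
  rewrite exprMn sqr_sqrtr// expr_div_n real_normK ?num_real//.
  by field; rewrite gt_eqF.
rewrite expRD mulrCA mulrC ler_wpM2r ?expR_ge0//.
rewrite expRN ler_pdivrMr ?expR_gt0// -ler_pdivrMl ?mulr_gt0//.
rewrite mulrC; set z := _ / _.
have := expR_ge1Dx (z ^+ 2); have : 0 <= (z - 1) ^+ 2 by exact: sqr_ge0.
have : 0 <= z ^+ 2 by exact: sqr_ge0.
lra.
Qed.

Let Cb := 2 * sigma * (normal_peak sigma / normal_peak (Num.sqrt 2 * sigma)).

Let idom : mu.-integrable setT (EFin \o (fun y => Cb * normal_pdf 0 (Num.sqrt 2 *
    sigma) y)).
Proof. by apply: integrable_EFinZl => //; exact: integrable_normal_pdf. Qed.

Let mphi : measurable_fun setT phi.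
Proof. exact: measurable_normal_pdf. Qed.

Let phi0 y : 0 <= phi y. Proof. exact: normal_pdf_ge0. Qed.

Let dphi y : is_derive y 1 phi (- (y / sigma ^+ 2) * phi y).
Proof.
pose k : R := - (2 * sigma ^+ 2)^-1; pose c : R := normal_peak sigma.
have -> : phi = fun y => c * expR (k * y ^+ 2).
  by apply/funext => z; rewrite phiE /k; congr (_ * expR _); rewrite -mulrN; exact: mulrC.
apply: is_derive_eq; rewrite /GRing.scale/= /k; field.
by rewrite gt_eqF.
Qed.

Let g p s := \int[mu]_y (cos (s * y + p) * phi y).

Let mtr (f : R -> R) s p : continuous f -> measurable_fun setT (fun y => f (s * y + p)
    * phi y).
Proof.
move=> cf; apply: measurable_funM => //.
apply: (measurableT_comp (continuous_measurable_fun cf)).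
by apply: measurable_funD => //; exact: measurable_funM.
Qed.

Let icos s p : mu.-integrable setT (EFin \o (fun y => cos (s * y + p) * phi y)).
Proof.
apply: (le_integrable _ _ _ (integrable_normal_pdf 0 sigma)) => //.
  by apply/measurable_EFinP; apply: mtr; exact: continuous_cos.
by move=> y _; rewrite lee_fin normrM ler_piMl// cos_max.
Qed.

Let isin s p : mu.-integrable setT (EFin \o (fun y => y * (sin (s * y + p) * phi y))).
Proof.
apply: (le_integrable _ _ _ idom) => //.
  apply/measurable_EFinP; apply: measurable_funM => //.
  by apply: mtr; exact: continuous_sin.
move=> y _; rewrite lee_fin; apply: (le_trans _ (ler_norm _)); apply: (le_trans _
    (phi_bound y)).
rewrite !normrM (ger0_norm (phi0 y)).
by rewrite ler_wpM2l// ler_piMl// sin_max.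
Qed.

(** Differentiation under the integral produces a factor [y], which integration by parts removes,
    since [y phi] is [- sigma^2] times the derivative of [phi]. The phase [p] treats cosine and sine
    at once. *)
Let dg p s : is_derive s 1 (g p) (- (sigma ^+ 2 * s) * g p s).
Proof.
pose f s y := cos (s * y + p) * phi y.
have df x y : is_derive x 1 (f ^~ y) (- (y * (sin (x * y + p) * phi y))).
  by apply: is_derive_eq; rewrite /GRing.scale/=; ring.
have dE x y : partial1of2 f x y = - (y * (sin (x * y + p) * phi y)).
  by rewrite partial1of2E; exact: (@derive_val _ _ _ _ _ _ _ (df x y)).
have Is : `]s - 1, s + 1[%classic s by rewrite /= in_itv/=; lra.
have intf x : `]s - 1, s + 1[%classic x -> mu.-integrable setT (EFin \o f x).
  by move=> _; exact: icos.
have derf x y : `]s - 1, s + 1[%classic x -> setT y -> derivable (f ^~ y) x 1.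
  by move=> _ _; exact: (@ex_derive _ _ _ _ _ _ _ (df x y)).
pose G y := Cb * normal_pdf 0 (Num.sqrt 2 * sigma) y.
have G0 y : 0 <= G y.
  by apply: (le_trans _ (phi_bound y)); rewrite mulr_ge0.
have Gub x y : `]s - 1, s + 1[%classic x -> setT y -> `|partial1of2 f x y| <= G y.
  move=> _ _; rewrite dE normrN !normrM (ger0_norm (phi0 y)).
  apply: (le_trans _ (phi_bound y)).
  by rewrite ler_wpM2l// ler_piMl// sin_max.
have Dg := derivable_under_integral measurableT Is intf derf G0 idom Gub.
have := differentiation_under_integral measurableT Is intf derf G0 idom Gub.
rewrite derive1E => E.
apply: DeriveDef; first exact: Dg.
rewrite E.
transitivity (- \int[mu]_y (y * (sin (s * y + p) * phi y))).
  rewrite -[- Rintegral _ _ _]mulN1r -(RintegralZl _ measurableT (isin s p)).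
  by apply: eq_Rintegral => y _; rewrite dE mulN1r.
pose F y := sigma ^+ 2 * (sin (s * y + p) * phi y).
have dF y : is_derive y 1 F (sigma ^+ 2 * s * (cos (s * y + p) * phi y) -
    y * (sin (s * y + p) * phi y)).
  have := dphi y => ?; apply: is_derive_eq.
  by rewrite /GRing.scale/=; field; rewrite gt_eqF.
have FK y : `|y| * `|F y| <= sigma ^+ 2 * (Cb * normal_peak (Num.sqrt 2 * sigma)).
  rewrite /F normrM (ger0_norm (sqr_ge0 _)) mulrCA ler_wpM2l ?sqr_ge0//.
  rewrite normrM (ger0_norm (phi0 y)); apply: (@le_trans _ _ (`|y| * phi y)).
    by rewrite ler_wpM2l// ler_piMl// sin_max.
  apply: le_trans (phi_bound y) _; rewrite ler_wpM2l//.
    by rewrite !mulr_ge0 ?invr_ge0 ?normal_peak_ge0// ltW.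
  by rewrite normal_pdf_ub// gt_eqF// mulr_gt0 ?sqrtr_gt0.
have : \int[mu]_y (sigma ^+ 2 * s * (cos (s * y + p) * phi y) -
    y * (sin (s * y + p) * phi y)) = 0.
  apply: (Rintegral_FTC2T dF).
  - have ctr (tr : R -> R) : continuous tr -> continuous (fun y => tr (s * y + p) * phi
      y).
      move=> ct z; apply: cvgM; last exact: continuous_normal_pdf (lt0r_neq0 sigma0) z.
      apply: continuous_comp; last exact: ct.
      apply: (@cvgD _ R^o); last exact: cvg_cst.
      by apply: cvgM; [exact: cvg_cst|exact: cvg_id].
    move=> z; apply: (@cvgB _ R^o); apply: cvgM.
    + exact: cvg_cst.
    + exact: ctr (@continuous_cos R) z.
    + exact: cvg_id.
    + exact: ctr (@continuous_sin R) z.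
  - have := integrableB measurableT (integrable_EFinZl (sigma ^+ 2 * s) measurableT
      (icos s p)) (isin s p).
    by apply: eq_integrable.
  - exact: cvg_pinfty_mul_bounded FK.
  - exact: cvg_ninfty_mul_bounded FK.
rewrite RintegralB//; last exact: integrable_EFinZl.
by rewrite RintegralZl// => /eqP; rewrite subr_eq0 => /eqP <-; rewrite mulNr.
Qed.

(** The product of [g p] with [exp (sigma^2 s^2 / 2)] has zero derivative. *)
Lemma normal_cos s p :
  \int[normal_prob 0 sigma]_y cos (s * y + p) =
  cos p * expR (- (sigma ^+ 2 * s ^+ 2 / 2)).
Proof.
rewrite (Rintegral_normal_prob _ _ (M := 1)); last 2 first.
- apply: (measurableT_comp (continuous_measurable_fun (@continuous_cos R))).
  by apply: measurable_funD => //; exact: measurable_funM.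
- by move=> y; exact: cos_max.
rewrite -/phi -/(g p s).
pose h s := g p s * expR (sigma ^+ 2 * s ^+ 2 / 2).
have dh x : is_derive x 1 h 0.
  have := dg p x => ?; apply: is_derive_eq.
  by rewrite /GRing.scale/=; field.
have : h s = h 0 by apply: is_derive_0_is_cst => x; exact: dh.
rewrite /h expr0n/= mulr0 mul0r expR0 mulr1 expRN => hE.
have -> : cos p = g p 0.
  rewrite /g; under eq_Rintegral do rewrite mul0r add0r.
  rewrite RintegralZl//; last exact: integrable_normal_pdf.
  by rewrite /Rintegral /phi integral_normal_pdf mulr1.
by rewrite -hE mulfK// gt_eqF// expR_gt0.
Qed.

Lemma normal_sin s p :
  \int[normal_prob 0 sigma]_y sin (s * y + p) =
  sin p * expR (- (sigma ^+ 2 * s ^+ 2 / 2)).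
Proof.
have E x : sin x = cos (x - pi / 2) :> R.
  by rewrite cosB cos_pihalf sin_pihalf mulr0 mulr1 add0r.
rewrite E -normal_cos; apply: eq_Rintegral => y _.
by rewrite E addrA.
Qed.

End characteristic_function.
End gaussian.

(** * Mills' ratio as a cut exponential mean *)

Section mills.
Context {R : realType}.
Implicit Types (s y p x : R).
Notation mu := (@lebesgue_measure R).

Definition normal_cut_mean (sigma theta : R) : R -> R :=
  cut_mean theta (normal_prob 0 sigma) id.

Let mcut (theta c : R) : measurable_fun setT (fun y => cut_exp theta (y - c)).
Proof.
apply: (measurableT_comp (measurable_cut_exp theta)).
exact: measurable_funB.
Qed.

Let icut (sigma theta c : R) : 0 <= theta ->
  (normal_prob 0 sigma).-integrable setT (EFin \o (fun y => cut_exp theta (y - c))).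
Proof.
move=> t0; apply: (@integrable_bounded _ _ _ (normal_prob 0 sigma) _ 1).
  exact: mcut.
by move=> w; rewrite ger0_norm ?cut_exp_ge0// cut_exp_le1.
Qed.

Lemma normal_prob_itvoc (sigma a b K : R) : a <= b -> 0 <= K ->
  (forall y, a < y -> normal_pdf 0 sigma y <= K) ->
  fine (normal_prob 0 sigma `]a, b]) <= K * (b - a).
Proof.
move=> ab K0 pdfK; have N0 : 0 <= K * (b - a) by rewrite mulr_ge0 ?subr_ge0.
rewrite -[leRHS]/(fine (_)%:E) fine_le//.
  by rewrite fin_num_measure.
apply: (@le_trans _ _ (\int[mu]_(x in `]a, b]) K%:E)%E).
  apply: ge0_le_integral => //=.
  - by move=> x _; rewrite lee_fin normal_pdf_ge0.
  - by apply/measurable_EFinP; apply: measurable_funTS; exact: measurable_normal_pdf.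
  - by move=> x; rewrite in_itv/= => /andP[ax _]; rewrite lee_fin pdfK.
rewrite integral_cst//= lebesgue_measure_itv/= lte_fin.
by case: ltP => [_|ba]; rewrite ?mule0 -?EFinB -?EFinM ?lee_fin.
Qed.

(** A converse to the growth bound: moving the cut to the right loses only the mass of []c, c + z]],
    at most [normal_peak sigma * z]. Combined with the growth bound for an arbitrary law, this is
    the shift condition of the smoothing argument with [m = normal_peak sigma]. *)
Lemma normal_cut_mean_shift (sigma theta c z : R) : sigma != 0 -> 0 <= theta ->
  0 <= z ->
  expR (theta * z) * (normal_cut_mean sigma theta c - normal_peak sigma * z) <=
  normal_cut_mean sigma theta (c + z).
Proof.
move=> s0 t0 z0; have E0 := expR_gt0 (theta * z).
have i1 : (normal_prob 0 sigma).-integrable setT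
    (EFin \o (fun y : R => \1_(`]c, c + z] : set R) y : R)).
  apply: (@integrable_bounded _ _ _ (normal_prob 0 sigma) _ 1).
    exact: measurable_indic.
  by move=> w; rewrite indicE; case: (_ \in _); rewrite ?normr1 ?normr0.
have I1 : \int[normal_prob 0 sigma]_y \1_(`]c, c + z] : set R) y =
    fine (normal_prob 0 sigma `]c, c + z]).
  by rewrite /Rintegral integral_indic// setIT.
rewrite mulrBr lerBlDr.
apply: (@le_trans _ _ (\int[normal_prob 0 sigma]_y (cut_exp theta (y - (c + z)) +
    expR (theta * z) * \1_(`]c, c + z] : set R) y))); last first.
  rewrite RintegralD//; last 2 first.
  - exact: icut.
  - exact: integrable_EFinZl.
  rewrite RintegralZl// I1 lerD2l ler_pM2l//.
  have := @normal_prob_itvoc sigma c (c + z) (normal_peak sigma).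
  rewrite lerDl => /(_ z0 (normal_peak_ge0 _) (fun y _ => normal_pdf_ub 0 y s0)).
  by rewrite addrAC subrr add0r.
rewrite -RintegralZl//; last exact: icut.
apply: le_Rintegral => //.
- by apply: integrable_EFinZl => //; exact: icut.
- have := integrableD measurableT (icut sigma (c + z) t0)
    (integrable_EFinZl (expR (theta * z)) measurableT i1).
  by apply: eq_integrable.
move=> y _; rewrite !cut_expE indicE.
have -> : (y \in (`]c, c + z]%classic : set R)) = (c < y <= c + z).
  by apply/idP/idP => [|h]; [rewrite inE/= in_itv|rewrite inE/= in_itv].
rewrite !subr_gt0; case: (ltP c y) => cy /=; last by rewrite mulr0 addr_ge0
    ?mulr_ge0//; case: ifP.
rewrite (leNgt y); case: (ltP (c + z) y) => czy /=.
  by rewrite mulr0 addr0 -expRD ler_expR; lra.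
rewrite add0r mulr1 -expRD ler_expR gerDl oppr_le0.
by rewrite mulr_ge0// subr_ge0 ltW.
Qed.

Lemma one_sub_PhiE (x : R) :
  1 - Phi x = fine (\int[mu]_(y in `[x, +oo[) (normal_pdf 0 1 y)%:E).
Proof.
have mE (A : set R) : measurable_fun A (EFin \o normal_pdf (0 : R) 1).
  by apply/measurable_EFinP; apply: measurable_funTS; exact: measurable_normal_pdf.
rewrite -integral_itv_obnd_cbnd//.
have -> : (\int[mu]_(y in `]x, +oo[) (normal_pdf 0 1 y)%:E)%E = normal_prob 0 1 `]x,
    +oo[ by [].
have -> : (`]x, +oo[ : set R)%classic = ~` `]-oo, x] by rewrite setCitvl.
rewrite probability_setC// fineB//.
by rewrite fin_num_measure.
Qed.

Lemma one_sub_Phi_ge0 (x : R) : 0 <= 1 - Phi x.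
Proof.
by rewrite one_sub_PhiE fine_ge0// integral_ge0// => y _; rewrite lee_fin normal_pdf_ge0.
Qed.

Definition mills x : R := expR (x ^+ 2 / 2) * (1 - Phi x).

(** Completing the square: with [x = theta sigma], the substitution [y = sigma (z - x)] turns
    [exp (- theta y)] times the density into [exp (x^2 / 2)] times the standard one, and the
    half-line from 0 into the one from [x]. *)
Lemma normal_cut_mean_mills (sigma theta : R) : 0 < sigma -> 0 <= theta ->
  normal_cut_mean sigma theta 0 = mills (theta * sigma).
Proof.
move=> s0 t0; rewrite /mills; set x := theta * sigma.
have sn0 : sigma != 0 by rewrite gt_eqF.
have mE (f : R -> R) (A : set R) : continuous f -> measurable_fun A (EFin \o f).
  by move=> cf; apply/measurable_EFinP; apply: measurable_funTS; exact:
      continuous_measurable_fun.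
pose G y := expR (- (theta * y)) * normal_pdf 0 sigma y.
have cG : continuous G.
  move=> y; apply: cvgM; last exact: continuous_normal_pdf.
  have : continuous (fun y => expR (- (theta * y))); last exact.
  by apply: is_derive_continuous => z; exact: is_derive_eq.
pose F z := sigma * (z - x).
have dF (z : R) : is_derive z 1 F sigma.
  by apply: is_derive_eq; rewrite /GRing.scale/= subr0 mulr1.
have F'E : (F^`())%classic = cst sigma.
  by apply/funext => z; rewrite derive1E; exact: (@derive_val _ _ _ _ _ _ _ (dF z)).
have Fx : F x = 0 by rewrite /F subrr mulr0.
have cF : continuous F by exact: is_derive_continuous dF.
have S := @increasing_ge0_integration_by_substitutiony _ F G x.
have {S} : (\int[mu]_(y in `[0%R, +oo[) (G y)%:E =
    \int[mu]_(z in `[x, +oo[) ((G (F z)) * sigma)%:E)%E.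
  rewrite -Fx S ?Fx//.
  - by apply: eq_integral => z _; rewrite /= F'E.
  - by move=> a b _ _ ab; rewrite /F ltr_pM2l// ltrD2r.
  - by move=> z _; rewrite F'E; exact: cvg_cst.
  - by rewrite F'E; exact: is_cvg_cst.
  - by rewrite F'E; exact: is_cvg_cst.
  - split; first by move=> z _; exact: (@ex_derive _ _ _ _ _ _ _ (dF z)).
    by apply: cvg_at_right_filter; exact: cF.
  - apply: gt0_cvgMry => //; exact: cvg_addrr.
  - exact: continuous_subspaceT.
  - by move=> y _; rewrite mulr_ge0 ?expR_ge0 ?normal_pdf_ge0.
have -> : (\int[mu]_(z in `[x, +oo[) ((G (F z)) * sigma)%:E =
    (expR (x ^+ 2 / 2))%:E * \int[mu]_(z in `[x, +oo[) (normal_pdf 0 1 z)%:E)%E.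
  have E0 : (0 <= (expR (x ^+ 2 / 2))%:E)%E by rewrite lee_fin expR_ge0.
  have m1 : measurable_fun `[x, +oo[ (fun z => (normal_pdf 0 1 z)%:E).
    by apply: mE; apply: continuous_normal_pdf; exact: oner_neq0.
  have p1 z : `[x, +oo[%classic z -> (0 <= (normal_pdf (0 : R) 1 z)%:E)%E.
    by rewrite lee_fin normal_pdf_ge0.
  transitivity (\int[mu]_(z in `[x, +oo[) ((expR (x ^+ 2 / 2))%:E * (normal_pdf 0 1
      z)%:E))%E;
    last exact: ge0_integralZl.
  apply: eq_integral => z _; rewrite -EFinM; congr EFin.
  have P : normal_peak sigma * sigma = normal_peak 1.
    rewrite /normal_peak expr1n mul1r -mulrnAr sqrtrM ?sqr_ge0// sqrtr_sqr gtr0_norm//.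
    by rewrite invfM mulrAC mulVf ?mul1r.
  rewrite /G /F !normal_pdfE ?oner_neq0// /normal_fun !subr0 -P.
  transitivity (normal_peak sigma * sigma * (expR (- (theta * (sigma * (z - x)))) *
      expR (- (sigma * (z - x)) ^+ 2 / (sigma ^+ 2 *+ 2)))); first by ring.
  rewrite [RHS]mulrCA; congr (_ * _).
  by rewrite -!expRD; congr expR; rewrite /x; field.
move=> E.
rewrite one_sub_PhiE /normal_cut_mean /cut_mean /Rintegral.
rewrite integral_normal_prob//; last 2 first.
- by apply/measurable_EFinP; exact: mcut.
- by move=> y; rewrite lee_fin cut_exp_ge0.
transitivity (fine (\int[mu]_(y in `[0%R, +oo[) (G y)%:E)).
  rewrite -integral_itv_obnd_cbnd; last exact: mE.
  rewrite [in RHS]integral_mkcond; congr fine; apply: eq_integral => y _.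
  rewrite patchE subr0 cut_expE.
  have -> : (y \in (`]0%R, +oo[%classic : set R)) = (0 < y).
    by apply/idP/idP => [|h]; [rewrite inE/= in_itv/= andbT|rewrite inE/= in_itv/= andbT].
  by case: ifP; rewrite ?mul0e.
rewrite E fineM//.
apply: integrable_fin_num => //.
by apply: integrableS (integrable_normal_pdf 0 1).
Qed.

End mills.

Section mills_ratio.
Context {R : realType}.
Implicit Types (x y h : R).
Notation mu := (@lebesgue_measure R).

Lemma mills_ge0 x : 0 <= mills x.
Proof. by rewrite mulr_ge0 ?expR_ge0 ?one_sub_Phi_ge0. Qed.

(** Mills' ratio is the normal mean of [exp (- x w)] over [w > 0], and the integrand decreases in
    [x]. *)
Lemma mills_le x y : 0 <= x -> x <= y -> mills y <= mills x.
Proof.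
move=> x0 xy; have y0 := le_trans x0 xy.
rewrite -[x]mulr1 -[y]mulr1 -!normal_cut_mean_mills//.
have icut z : 0 <= z -> (normal_prob 0 (1 : R)).-integrable setT
    (EFin \o (fun w => cut_exp z (w - 0))).
  move=> z0; apply: (@integrable_bounded _ _ _ (normal_prob 0 1) _ 1).
    apply: (measurableT_comp (measurable_cut_exp z)).
    exact: measurable_funB.
  by move=> w; rewrite ger0_norm ?cut_exp_ge0// cut_exp_le1.
apply: le_Rintegral => //; [exact: icut|exact: icut|].
move=> z _; rewrite subr0 !cut_expE; case: ifPn => // z0.
by rewrite ler_expR lerN2 ler_wpM2r// ltW.
Qed.

(** The tail loses at most [h] times the density at [x], and [exp (x^2 / 2)] scales that density to
    its peak. *)
Lemma mills_shift x h : 0 <= x -> 0 <= h ->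
  mills x - h * normal_peak 1 <= mills (x + h).
Proof.
move=> x0 h0.
have E : Phi (x + h) - Phi x <= h * (normal_peak 1 * expR (- (x ^+ 2 / 2))).
  have xxh : x <= x + h by rewrite lerDl.
  have -> : Phi (x + h) = Phi x + fine (normal_prob 0 1 `]x, x + h]).
    rewrite /Phi -fineD ?fin_num_measure// -measureU//.
      by congr (fine (_ _)); rewrite -itv_bndbnd_setU.
    rewrite set_itvE; apply/seteqP; split => // y [] /=; rewrite !in_itv/= => yx
        /andP[xy _].
    by move: (lt_le_trans xy yx); rewrite ltxx.
  rewrite addrAC subrr add0r.
  have K0 : 0 <= normal_peak 1 * expR (- (x ^+ 2 / 2)).
    by rewrite mulr_ge0 ?expR_ge0 ?normal_peak_ge0.
  apply: le_trans (normal_prob_itvoc xxh K0 _) _ => [y xy|].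
    rewrite normal_pdfE ?oner_neq0// /normal_fun subr0 ler_wpM2l ?normal_peak_ge0//.
    rewrite ler_expR expr1n mulNr lerN2 ler_wpM2r//.
    by rewrite lerXn2r ?nnegrE// ltW// (le_lt_trans x0).
  by rewrite addrAC subrr add0r mulrC.
have E1 : expR (x ^+ 2 / 2) <= expR ((x + h) ^+ 2 / 2).
  by rewrite ler_expR ler_wpM2r// lerXn2r ?nnegrE ?addr_ge0// lerDl.
apply: (@le_trans _ _ (expR (x ^+ 2 / 2) * (1 - Phi (x + h)))); last first.
  by rewrite ler_wpM2r ?one_sub_Phi_ge0.
rewrite /mills lerBlDr -lerBlDl -mulrBr.
rewrite [leLHS](_ : _ = expR (x ^+ 2 / 2) * (Phi (x + h) - Phi x)); last by ring.
apply: (@le_trans _ _ (expR (x ^+ 2 / 2) * (h * (normal_peak 1 * expR (- (x ^+ 2 /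
    2)))))).
  by rewrite ler_wpM2l ?expR_ge0.
by rewrite expRN mulrCA ler_wpM2l// mulrCA divff ?mulr1// gt_eqF// expR_gt0.
Qed.

(** [- phi / (1 + y)] has derivative [phi (y^2 + y + 1) / (1 + y)^2], at most [phi]; integrate from
    [x] to infinity. *)
Lemma mills_lower x : 0 <= x -> normal_peak 1 <= (1 + x) * mills x.
Proof.
move=> x0.
pose c : R := normal_peak 1; have c0 : 0 <= c by exact: normal_peak_ge0.
pose phi y : R := c * expR (- (y ^+ 2 / 2)).
have phiE : normal_pdf (0 : R) 1 = phi.
  apply/funext => y; rewrite normal_pdfE ?oner_neq0// /normal_fun subr0 expr1n.
  by rewrite mulNr.
have phi0 y : 0 <= phi y by rewrite mulr_ge0 ?expR_ge0.
pose F y : R := - (phi y / (1 + y)).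
pose f y : R := phi y * ((y * (1 + y) + 1) / (1 + y) ^+ 2).
have dphi y : is_derive y 1 phi (- y * phi y).
  by apply: is_derive_eq; rewrite /GRing.scale/= /phi; field.
have dF y : x <= y -> is_derive y 1 F (f y).
  move=> xy; have y1 : 1 + y != 0 by rewrite gt_eqF// ltr_pwDl// (le_trans x0).
  by have := dphi y => ?; apply: is_derive_eq; rewrite /GRing.scale/= /f; field.
have f0 y : x <= y -> 0 <= f y.
  move=> xy; have y0 := le_trans x0 xy.
  by rewrite mulr_ge0// divr_ge0// ?sqr_ge0// addr_ge0// mulr_ge0// addr_ge0.
have cf y : x <= y -> {for y, continuous f}.
  move=> xy; have y1 : 1 + y != 0 by rewrite gt_eqF// ltr_pwDl// (le_trans x0).
  apply: cvgM; first exact: is_derive_continuous dphi y.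
  apply: cvgM.
    have : continuous (fun y : R => y * (1 + y) + 1); last exact.
    by apply: is_derive_continuous => z; exact: is_derive_eq.
  apply: cvgV; first by rewrite expf_neq0.
  have : continuous (fun y : R => (1 + y) ^+ 2); last exact.
  by apply: is_derive_continuous => z; exact: is_derive_eq.
have phil : - phi y @[y --> +oo] --> 0.
  apply: (@cvg_pinfty_mul_bounded R (fun y => - phi y) c) => y.
  rewrite normrN (ger0_norm (phi0 y)) /phi mulrCA ler_piMr// expRN ler_pdivrMr
      ?expR_gt0// mul1r.
  apply: le_trans (expR_ge1Dx (y ^+ 2 / 2)).
  have := sqr_ge0 (`|y| - 1); rewrite -[y ^+ 2]real_normK ?num_real//.
  by nra.
have Fl : F y @[y --> +oo] --> 0.
  apply: (squeeze_cvgr _ phil (cvg_cst 0)); near=> y.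
  have y0 : 0 <= y by near: y; exact: nbhs_pinfty_ge.
  rewrite /F lerN2 oppr_le0 divr_ge0 ?addr_ge0// andbT.
  by rewrite ler_pdivrMr ?ltr_pwDl// ler_peMr// lerDl.
have := ge0_integral_FTC2y f0 dF cf Fl.
rewrite sub0r /F opprK => E.
have mE (A : set R) : measurable_fun A (EFin \o normal_pdf (0 : R) 1).
  by apply/measurable_EFinP; apply: measurable_funTS; exact: measurable_normal_pdf.
have : phi x / (1 + x) <= 1 - Phi x.
  rewrite one_sub_PhiE -[leLHS]/(fine (_)%:E) -E; apply: fine_le.
  - by rewrite E.
  - apply: integrable_fin_num => //.
    by apply: integrableS (integrable_normal_pdf 0 1).
  apply: ge0_le_integral => //=.
  - by move=> y; rewrite in_itv/= andbT => xy; rewrite lee_fin f0.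
  - apply/measurable_EFinP; apply: subspace_continuous_measurable_fun => //.
    apply: continuous_in_subspaceT => y; rewrite inE/= in_itv/= andbT.
    exact: cf.
  - exact: mE.
  - move=> y; rewrite in_itv/= andbT => xy; rewrite lee_fin phiE /f.
    have y0 := le_trans x0 xy.
    rewrite ler_piMr// ler_pdivrMr ?mul1r ?exprn_gt0 ?ltr_pwDl//.
    by nra.
rewrite ler_pdivrMr ?ltr_pwDl// => h.
rewrite /mills mulrCA -/c.
rewrite -ler_pdivrMl ?expR_gt0// mulrC -expRN -/(phi x).
by rewrite mulrC.
Unshelve. all: end_near. Qed.

End mills_ratio.

(** * Smoothing applied to the distance from the normal law *)

Section smoothing_inequality.
Context {R : realType}.
Notation mu := (@lebesgue_measure R).
Context d (T : measurableType d) (Q : probability T R) (Y : T -> R).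
Variables (theta sigma : R) (r : R -> R).
Hypothesis mY : measurable_fun setT Y.
Hypothesis theta_bounds : 0 < theta <= 27 / 200.
Hypothesis sigma0 : 0 < sigma.
Hypothesis cr : continuous r.
Hypothesis r0 : forall s, 0 <= r s.
Hypothesis cf_close : forall s a b k : R, 0 <= s <= 2 -> 0 <= k ->
  a ^+ 2 + b ^+ 2 <= k ^+ 2 ->
  `|a * (\int[Q]_w cos (s * Y w) - expR (- (sigma ^+ 2 * s ^+ 2 / 2))) +
    b * \int[Q]_w sin (s * Y w)| <= k * (s * r s).

Let theta0 : 0 < theta. Proof. by case/andP: theta_bounds. Qed.

Let D v := cut_mean theta Q Y v - normal_cut_mean sigma theta v.

Notation N := (normal_prob 0 sigma).

Let mid : measurable_fun setT (id : R -> R). Proof. exact: measurable_id. Qed.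

Let icos (g : R -> R) (c s : R) : g = cos \/ g = sin ->
  Q.-integrable setT (EFin \o (fun w => g (s * (Y w - c)))).
Proof.
move=> gE; apply: (@integrable_bounded _ _ _ Q _ 1).
  apply: (measurableT_comp (f := g)).
    by case: gE => ->; apply: continuous_measurable_fun; [exact: continuous_cos|exact:
        continuous_sin].
  by apply: measurable_funM => //; exact: measurable_funB.
by move=> w; case: gE => ->; [exact: cos_max|exact: sin_max].
Qed.

Let cosE c s : \int[Q]_w cos (s * (Y w - c)) =
  cos (s * c) * \int[Q]_w cos (s * Y w) + sin (s * c) * \int[Q]_w sin (s * Y w).
Proof.
have i1 := @icos cos 0 s (or_introl erefl); have i2 := @icos sin 0 s (or_intror erefl).
transitivity (\int[Q]_w (cos (s * c) * cos (s * (Y w - 0)) + sin (s * c) * sin (s * (Y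
    w - 0)))).
  by apply: eq_Rintegral => w _; rewrite subr0 mulrBr cosB; ring.
rewrite RintegralD//; [|exact: integrable_EFinZl|exact: integrable_EFinZl].
rewrite !RintegralZl//.
by congr (_ * _ + _ * _); apply: eq_Rintegral => w _; rewrite subr0.
Qed.

Let sinE c s : \int[Q]_w sin (s * (Y w - c)) =
  cos (s * c) * \int[Q]_w sin (s * Y w) - sin (s * c) * \int[Q]_w cos (s * Y w).
Proof.
have i1 := @icos cos 0 s (or_introl erefl); have i2 := @icos sin 0 s (or_intror erefl).
transitivity (\int[Q]_w (cos (s * c) * sin (s * (Y w - 0)) - sin (s * c) * cos (s * (Y
    w - 0)))).
  by apply: eq_Rintegral => w _; rewrite subr0 mulrBr sinB; ring.
rewrite RintegralB//; [|exact: integrable_EFinZl|exact: integrable_EFinZl].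
rewrite !RintegralZl//.
by congr (_ * _ - _ * _); apply: eq_Rintegral => w _; rewrite subr0.
Qed.

Let NcosE c s : \int[N]_y cos (s * (y - c)) =
  cos (s * c) * expR (- (sigma ^+ 2 * s ^+ 2 / 2)).
Proof.
rewrite -[cos (s * c)]cosN -normal_cos//.
by apply: eq_Rintegral => y _; rewrite mulrBr.
Qed.

Let NsinE c s : \int[N]_y sin (s * (y - c)) =
  - sin (s * c) * expR (- (sigma ^+ 2 * s ^+ 2 / 2)).
Proof.
rewrite -sinN -normal_sin//.
by apply: eq_Rintegral => y _; rewrite mulrBr.
Qed.

(** After the rotation by [s c] the numerator is a scalar product with a vector of norm [sqrt q].
    Dividing by [q] leaves [s / sqrt q <= 1]: the factor [s] in [cf_close] makes the bound uniform
    in [theta]. *)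
Let transform_close c s : 0 <= s <= 2 ->
  `|(theta * \int[Q]_w cos (s * (Y w - c)) + s * \int[Q]_w sin (s * (Y w - c))) /
      (theta ^+ 2 + s ^+ 2) -
    (theta * \int[N]_y cos (s * (y - c)) + s * \int[N]_y sin (s * (y - c))) /
      (theta ^+ 2 + s ^+ 2)| <= r s.
Proof.
move=> s02; have [s0 _] := andP s02.
rewrite -mulrBl cosE sinE NcosE NsinE.
set E := expR _; set C := \int[Q]_w cos _; set S := \int[Q]_w sin _.
set q := theta ^+ 2 + s ^+ 2; have q0 : 0 < q by rewrite ltr_pwDl ?sqr_ge0// exprn_gt0.
pose a := theta * cos (s * c) - s * sin (s * c).
pose b := theta * sin (s * c) + s * cos (s * c).
have abq : a ^+ 2 + b ^+ 2 <= (Num.sqrt q) ^+ 2.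
  rewrite sqr_sqrtr; last exact: ltW.
  rewrite /a /b /q.
  rewrite -[leRHS]mulr1 -(cos2Dsin2 (s * c)) le_eqVlt; apply/orP; left; apply/eqP.
  by ring.
have k0 : 0 <= Num.sqrt q by exact: sqrtr_ge0.
have := cf_close s02 k0 abq; rewrite -/C -/S -/E => h.
rewrite (_ : _ - _ = a * (C - E) + b * S); last by rewrite /a /b; ring.
rewrite normrM (@ger0_norm _ q^-1); last by rewrite invr_ge0; exact: ltW.
rewrite ler_pdivrMr//.
apply: le_trans h _.
rewrite mulrA [leRHS]mulrC ler_wpM2r//.
rewrite -[leRHS]sqr_sqrtr; last exact: ltW.
rewrite expr2 ler_wpM2l// -[leLHS]ger0_norm//.
by rewrite -[leLHS]sqrtr_sqr ler_wsqrtr// lerDr sqr_ge0.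
Qed.

Let J_cut d' (T' : measurableType d') (Q' : probability T' R) (Y' : T' -> R) c :
  measurable_fun setT Y' ->
  mu.-integrable setT (EFin \o (fun v => jackson v * cut_mean theta Q' Y' (c - v))).
Proof.
move=> mY'; apply: (le_integrable _ _ _ (@integrable_jackson R)) => //.
  apply/measurable_EFinP; apply: measurable_funM.
    by apply: continuous_measurable_fun; exact: continuous_jackson.
  apply: (measurableT_comp (measurable_cut_mean theta0 Q' mY')).
  exact: measurable_funB.
move=> v _; rewrite lee_fin normrM ler_piMr// ger0_norm.
  by rewrite cut_mean_le1.
by rewrite cut_mean_ge0.
Qed.

(** 4/3 is the maximum of the spline on [[0, 2]]. *)
Let D_smooth c : `|\int[mu]_v (jackson v * D (c - v))| <=
  4 / 3 * \int[mu]_(s in `[0, 2]) r s.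
Proof.
have -> : \int[mu]_v (jackson v * D (c - v)) =
    \int[mu]_v (jackson v * cut_mean theta Q Y (c - v)) -
    \int[mu]_v (jackson v * cut_mean theta N id (c - v)).
  rewrite -RintegralB//; [|exact: J_cut|exact: J_cut].
  by apply: eq_Rintegral => v _; rewrite -mulrBr.
have [i1 ->] := jackson_cut_mean theta0 Q mY c.
have [i2 ->] := jackson_cut_mean theta0 N mid c.
rewrite -RintegralB//.
have ir : mu.-integrable `[0, 2] (EFin \o r) by exact: continuous_integrable_itv.
have ir' : mu.-integrable setT (EFin \o (fun s => 4 / 3 * (r \_ `[0, 2]) s)).
  apply: integrable_EFinZl => //; rewrite -restrict_EFin.
  by apply/integrable_restrict => //; rewrite setTI.
apply: le_trans; first by apply: le_normr_Rintegral => //; exact: integrable_EFinB.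
rewrite [\int[mu]_(s in `[0, 2]) _]Rintegral_mkcond -RintegralZl//; last first.
  by rewrite -restrict_EFin; apply/integrable_restrict => //; rewrite setTI.
apply: le_Rintegral => //.
  exact: integrable_norm (integrable_EFinB measurableT i1 i2).
move=> s _; rewrite -mulrBr !patchE.
case: ifPn => [|_]; last by rewrite mul0r normr0 mulr0.
rewrite inE/= in_itv/= => s02.
have /andP[k0 k1] := spline_bounds s02.
by rewrite normrM ger0_norm// ler_pM// transform_close.
Qed.

Lemma cut_mean_normal_close :
  `|cut_mean theta Q Y 0 - normal_cut_mean sigma theta 0| <=
  61 / 100 * (4 / 3 * \int[mu]_(s in `[0, 2]) r s) + 54 / 10 * normal_peak sigma.
Proof.
have sn0 : sigma != 0 by rewrite gt_eqF.
have [t0 t1] := andP theta_bounds.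
apply: (@esseen_bound R D theta) => //.
- by apply: measurable_funB; exact: measurable_cut_mean.
- move=> v; rewrite /D.
  have := cut_mean_ge0 theta Q Y v; have := cut_mean_le1 theta0 Q mY v.
  have := cut_mean_ge0 theta N id v; have := cut_mean_le1 theta0 N mid v.
  rewrite /normal_cut_mean ler_norml; lra.
- by rewrite (ltW t0).
- exact: normal_peak_ge0.
- by rewrite mulr_ge0// Rintegral_ge0.
- move=> v h h0; rewrite /D.
  have := cut_mean_shift theta0 Q mY v h0.
  have := @normal_cut_mean_shift R sigma theta v h sn0 (ltW t0) h0.
  lra.
Qed.

End smoothing_inequality.

(** * Characteristic functions *)

Section cf_factor.
Context {R : realType} d (T : measurableType d) (P : {measure set T -> \bar R}).
Variables (eta w : T -> R) (v : R).
Hypothesis meta : measurable_fun setT eta.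
Hypothesis mw : measurable_fun setT w.
Hypothesis w0 : forall x, 0 <= w x.
Hypothesis iw : P.-integrable setT (EFin \o w).
Hypothesis w_mass : \int[P]_x w x = 1.
Hypothesis i1 : P.-integrable setT (EFin \o (fun x => eta x * w x)).
Hypothesis eta_mean : \int[P]_x (eta x * w x) = 0.
Hypothesis i2 : P.-integrable setT (EFin \o (fun x => eta x ^+ 2 * w x)).
Hypothesis eta_var : \int[P]_x (eta x ^+ 2 * w x) = v.
Hypothesis i3 : P.-integrable setT (EFin \o (fun x => `|eta x| ^+ 3 * w x)).
Hypothesis eta_third : \int[P]_x (`|eta x| ^+ 3 * w x) <= v / 2.
Hypothesis v_small : v <= 4^-1.

Let C s := \int[P]_x (cos (s * eta x) * w x).
Let S s := \int[P]_x (sin (s * eta x) * w x).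

Let v0 : 0 <= v.
Proof. by rewrite -eta_var; apply: Rintegral_ge0 => x _; rewrite mulr_ge0 ?sqr_ge0. Qed.

Lemma integrable_cos_weight s : P.-integrable setT (EFin \o (fun x => cos (s * eta x) *
    w x)).
Proof.
apply: (integrable_bounded_mul mw iw (M := 1)) => [|x]; last exact: cos_max.
apply: (measurableT_comp (continuous_measurable_fun (@continuous_cos R))).
exact: measurable_funM.
Qed.

Lemma integrable_sin_weight s : P.-integrable setT (EFin \o (fun x => sin (s * eta x) *
    w x)).
Proof.
apply: (integrable_bounded_mul mw iw (M := 1)) => [|x]; last exact: sin_max.
apply: (measurableT_comp (continuous_measurable_fun (@continuous_sin R))).
exact: measurable_funM.
Qed.

(** Centring removes the linear term, and the remainder [|s eta|^3 / 6] is integrated with the third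
    moment bound [v / 2]. *)
Lemma cf_factor_taylor s a b : 0 <= s -> a ^+ 2 + b ^+ 2 <= 1 ->
  a * (C s - (1 - s ^+ 2 * v / 2)) + b * S s <= s ^+ 3 * v / 12.
Proof.
move=> s0 ab.
have ic := integrable_cos_weight s; have is_ := integrable_sin_weight s.
pose f x := (a * ((cos (s * eta x) * w x - w x) + s ^+ 2 / 2 * (eta x ^+ 2 * w x))) +
  b * (sin (s * eta x) * w x - s * (eta x * w x)).
have j1 := integrable_EFinB measurableT ic iw.
have j2 := integrable_EFinZl (s ^+ 2 / 2) measurableT i2.
have j3 := integrable_EFinD measurableT j1 j2.
have j4 := integrable_EFinZl a measurableT j3.
have k1 := integrable_EFinZl s measurableT i1.
have k2 := integrable_EFinB measurableT is_ k1.
have k3 := integrable_EFinZl b measurableT k2.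
have fE : \int[P]_x f x = a * (C s - (1 - s ^+ 2 * v / 2)) + b * S s.
  rewrite /f RintegralD// RintegralZl// RintegralZl// RintegralD// RintegralB//.
  rewrite RintegralB// !RintegralZl// w_mass eta_mean eta_var -/(C s) -/(S s).
  by ring.
rewrite -fE; apply: (@le_trans _ _ (s ^+ 3 / 6 * \int[P]_x (`|eta x| ^+ 3 * w x)));
    last first.
  rewrite (_ : _ / 12 = s ^+ 3 / 6 * (v / 2)); last by field.
  by rewrite ler_wpM2l// divr_ge0 ?exprn_ge0.
rewrite -RintegralZl//; apply: le_Rintegral => //.
- exact: integrable_EFinD.
- exact: integrable_EFinZl.
move=> x _; rewrite /f.
have := cis_taylor2 (s * eta x) ab.
rewrite normrM (ger0_norm s0) => h.
have {}h := ler_wpM2r (w0 x) h.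
apply: (@le_trans _ _ ((a * (cos (s * eta x) - 1 + (s * eta x) ^+ 2 / 2) +
  b * (sin (s * eta x) - s * eta x)) * w x)).
  by rewrite le_eqVlt; apply/orP; left; apply/eqP; field.
apply: le_trans h _.
by rewrite le_eqVlt; apply/orP; left; apply/eqP; field.
Qed.

End cf_factor.

Section complex_modulus.
Context {R : realType}.
Local Open Scope complex_scope.
Local Notation Re := complex.Re.
Local Notation Im := complex.Im.

(** Tested on the vector [z / |z|]. It brings bounds obtained under real integrals back to complex
    moduli. *)
Lemma normc_leP (z : R[i]) (r : R) : 0 <= r ->
  (forall a b, a ^+ 2 + b ^+ 2 <= 1 -> a * Re z + b * Im z <= r) ->
  `|z| <= r%:C.
Proof.
move=> r0 H; rewrite normc_def lecR.
set q := Num.sqrt _; have q0 : 0 <= q by exact: sqrtr_ge0.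
have qE : q ^+ 2 = Re z ^+ 2 + Im z ^+ 2.
  by rewrite sqr_sqrtr// addr_ge0// sqr_ge0.
move: q0; rewrite le_eqVlt => /predU1P[<-//|q0].
have := H (Re z / q) (Im z / q).
rewrite !expr_div_n -mulrDl -qE divff ?expf_neq0 ?gt_eqF// => /(_ (lexx _)).
rewrite mulrAC [Im z / q * _]mulrAC -mulrDl -!expr2 -qE.
by rewrite expr2 mulfK ?gt_eqF.
Qed.

Lemma le_normc_rotate (z : R[i]) (r a b k : R) : `|z| <= r%:C -> 0 <= k ->
  a ^+ 2 + b ^+ 2 <= k ^+ 2 -> `|a * Re z + b * Im z| <= k * r.
Proof.
rewrite normc_def lecR => zr k0 abk.
have r0 : 0 <= r by exact: le_trans (sqrtr_ge0 _) zr.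
apply: le_trans (ler_wpM2l k0 zr).
rewrite -(ger0_norm k0) -(sqrtr_sqr k) -sqrtrM ?sqr_ge0// -sqrtr_sqr.
rewrite ler_wsqrtr//.
apply: (@le_trans _ _ ((a ^+ 2 + b ^+ 2) * (Re z ^+ 2 + Im z ^+ 2))).
  have := sqr_ge0 (a * Im z - b * Re z); lra.
by rewrite ler_wpM2r// addr_ge0// sqr_ge0.
Qed.

(** Telescoping: one factor changes at a time and the others are bounded by [m]; [e i] is an error
    relative to [m i]. *)
Lemma le_norm_prodB (K : numDomainType) (I : Type) (s : seq I) (a b m e : I -> K) :
  (forall i, `|a i| <= m i) -> (forall i, `|b i| <= m i) ->
  (forall i, `|a i - b i| <= e i * m i) ->
  `|\prod_(i <- s) a i - \prod_(i <- s) b i| <=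
  (\sum_(i <- s) e i) * \prod_(i <- s) m i.
Proof.
move=> am bm abe; have m0 i : 0 <= m i := le_trans (normr_ge0 _) (am i).
elim: s => [|i s IH]; first by rewrite !big_nil subrr normr0 mul0r.
rewrite !big_cons.
set A := \prod_(j <- s) a j in IH *; set B := \prod_(j <- s) b j in IH *.
set M := \prod_(j <- s) m j in IH *.
have BM : `|B| <= M.
  rewrite /B /M normr_prod; apply: ler_prod => j _.
  by rewrite normr_ge0 bm.
rewrite (_ : a i * A - b i * B = a i * (A - B) + (a i - b i) * B); last by ring.
apply: le_trans (ler_normD _ _) _; rewrite !normrM.
rewrite (_ : (e i + _) * _ = m i * ((\sum_(j <- s) e j) * M) + e i * m i * M); last by
    ring.
by apply: lerD; apply: ler_pM.
Qed.

End complex_modulus.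

Section cf_close.
Context {R : realType}.
Local Open Scope complex_scope.

(* [7 / 32 = 3 / 2 * (1 / 12 + 1 / 16)]: the Taylor remainders of [z] and of the
   Gaussian factor [g], and [exp (1 / 3) <= 3 / 2]. *)
Lemma cf_factor_close (z : R[i]) (v s : R) : 0 <= v <= 4^-1 -> 0 <= s <= 2 ->
  (forall a b : R, a ^+ 2 + b ^+ 2 <= 1 ->
     a * (complex.Re z - (1 - s ^+ 2 * v / 2)) + b * complex.Im z <= s ^+ 3 * v / 12) ->
  let g : R := expR (- (s ^+ 2 * v / 2)) in
  let m : R := expR (- (s ^+ 2 * v / 3)) in
  [/\ `|z| <= m%:C, `|g%:C| <= m%:C &
      `|z - g%:C| <= (7 / 32 * s ^+ 3 * v * m)%:C].
Proof.
move=> /andP[v0 v1] /andP[s0 s2] H g m.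
pose p := s ^+ 2 * v.
have p0 : 0 <= p by rewrite mulr_ge0 ?sqr_ge0.
have p1 : p <= 1.
  rewrite (_ : 1 = 2 ^+ 2 * 4^-1 :> R); last by field.
  by rewrite ler_pM ?sqr_ge0// lerXn2r ?nnegrE.
have d0 : 0 <= s ^+ 3 * v / 12 by rewrite divr_ge0// mulr_ge0// exprn_ge0.
have d6 : s ^+ 3 * v / 12 <= p / 6.
  have : s * p <= 2 * p by rewrite ler_wpM2r.
  by rewrite /p; lra.
have zt : `|z - (1 - p / 2)%:C| <= (s ^+ 3 * v / 12)%:C.
  apply: normc_leP => // a b ab; have := H a b ab.
  by case: (z) => x y /=; rewrite oppr0 addr0 /p.
have mlo : 1 - p / 3 <= m by rewrite /m -/p; exact: expR_ge1Dx.
split.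
- apply: le_trans (_ : (1 - p / 3)%:C <= _); last by rewrite lecR.
  rewrite -[z](subrK (1 - p / 2)%:C).
  apply: le_trans (ler_normD _ _) _.
  apply: (@le_trans _ _ ((s ^+ 3 * v / 12)%:C + (1 - p / 2)%:C)).
    apply: lerD => //; rewrite normc_def/= expr0n/= addr0 sqrtr_sqr ger0_norm//; lra.
  by rewrite -rmorphD lecR; lra.
- rewrite normc_def/= expr0n/= addr0 sqrtr_sqr ger0_norm ?expR_ge0//.
  by rewrite lecR ler_expR -/p; lra.
- have gE : `|(1 - p / 2)%:C - g%:C| <= (p ^+ 2 / 8)%:C.
    rewrite -rmorphB normc_def/= expr0n/= addr0 sqrtr_sqr lecR /g -/p ler_norml.
    have := expR_ge1Dx (- (p / 2)).
    have q0 : 0 <= p / 2 by rewrite divr_ge0.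
    have : expR (- (p / 2)) <= 1 - p / 2 + (p / 2) ^+ 2 / 2.
      rewrite -(ler_pM2r (expR_gt0 (p / 2))) expRN mulVf ?gt_eqF ?expR_gt0//.
      have q1 : 0 <= 1 - p / 2 + (p / 2) ^+ 2 / 2 by have := sqr_ge0 (p / 2); lra.
      apply: (le_trans _ (ler_wpM2l q1 (expR_taylor3_ge (p / 2)))).
      have := exprn_ge0 3 q0; have := exprn_ge0 4 q0.
      set q := p / 2 in q0 q1 *; nra.
    have := sqr_ge0 p; lra.
  have -> : z - g%:C = (z - (1 - p / 2)%:C) + ((1 - p / 2)%:C - g%:C) by ring.
  apply: le_trans (ler_normD _ _) _; apply: le_trans (lerD zt gE) _.
  rewrite -rmorphD lecR.
  have k0 : 0 <= s ^+ 3 * v by rewrite mulr_ge0// exprn_ge0.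
  have k1 : p ^+ 2 / 8 <= s ^+ 3 * v / 16.
    have : s * v <= 2 * 4^-1 by rewrite ler_pM.
    rewrite (_ : p ^+ 2 / 8 = s ^+ 3 * v / 8 * (s * v)); last by rewrite /p; field.
    by move=> /(ler_wpM2l (divr_ge0 k0 (ler0n R 8))); lra.
  have m23 : 2 / 3 <= m by lra.
  have : 7 / 32 * s ^+ 3 * v * (2 / 3) <= 7 / 32 * s ^+ 3 * v * m.
    by rewrite ler_wpM2l//; lra.
  by lra.
Qed.

(** The bounds [exp (- s^2 v_j / 3)] of the factors multiply to a Gaussian in the total variance, so
    that the error integrates to order [1 / sigma]. *)
Lemma cf_prod_close (n : nat) (z : 'I_n -> R[i]) (v : 'I_n -> R) (V s a b k : R) :
  \sum_(j < n) v j = V -> (forall j, 0 <= v j <= 4^-1) -> 0 <= s <= 2 ->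
  (forall j (a b : R), a ^+ 2 + b ^+ 2 <= 1 ->
     a * (complex.Re (z j) - (1 - s ^+ 2 * v j / 2)) + b * complex.Im (z j) <=
     s ^+ 3 * v j / 12) ->
  0 <= k -> a ^+ 2 + b ^+ 2 <= k ^+ 2 ->
  `|a * (complex.Re (\prod_(j < n) z j) - expR (- (V * s ^+ 2 / 2))) +
    b * complex.Im (\prod_(j < n) z j)| <=
  k * (s * (7 / 32 * (s ^+ 2 * V * expR (- (V * s ^+ 2 / 3))))).
Proof.
move=> VE v01 s02 H k0 abk.
pose g j : R := expR (- (s ^+ 2 * v j / 2)).
pose m j : R := expR (- (s ^+ 2 * v j / 3)).
have F j := cf_factor_close (v01 j) s02 (H j).
have := @le_norm_prodB _ _ (index_enum 'I_n) z (fun j => (g j)%:C) (fun j => (m j)%:C)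
  (fun j => (7 / 32 * s ^+ 3 * v j)%:C).
have -> : (\sum_j (7 / 32 * s ^+ 3 * v j)%:C) = (7 / 32 * s ^+ 3 * V)%:C.
  by rewrite -rmorph_sum -mulr_sumr VE.
rewrite -!rmorph_prod/=.
have sumE (c : R) : \prod_j expR (- (s ^+ 2 * v j / c)) = expR (- (V * s ^+ 2 / c)).
  rewrite -expR_sum; congr expR; rewrite sumrN; congr (- _).
  by rewrite -mulr_suml -mulr_sumr VE [V * _]mulrC.
rewrite /g /m !sumE -rmorphM/= => /(_ _ _ _) h.
have {}h : `|\prod_j z j - (expR (- (V * s ^+ 2 / 2)))%:C| <=
    (7 / 32 * s ^+ 3 * V * expR (- (V * s ^+ 2 / 3)))%:C.
  by apply: h => j; have [h1 h2 h3] := F j => //; rewrite -rmorphM.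
have := le_normc_rotate h k0 abk.
case: (\prod_j z j) => x y /=; rewrite oppr0 addr0 => /le_trans; apply.
by rewrite le_eqVlt; apply/orP; left; apply/eqP; ring.
Qed.

End cf_close.

(** * The integrated error of the characteristic functions *)

Section rate.
Context {R : realType}.
Notation mu := (@lebesgue_measure R).

Definition cf_rate (sigma s : R) : R :=
  7 / 32 * (s ^+ 2 * sigma ^+ 2 * expR (- (sigma ^+ 2 * s ^+ 2 / 3))).

Lemma cf_rate_ge0 (sigma s : R) : 0 <= cf_rate sigma s.
Proof.
rewrite /cf_rate mulr_ge0//.
by rewrite mulr_ge0 ?expR_ge0// mulr_ge0// sqr_ge0.
Qed.

Lemma continuous_cf_rate (sigma : R) : continuous (cf_rate sigma).
Proof.
apply: is_derive_continuous => s; exact: is_derive_eq.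
Qed.

Lemma half_normal_mass (tau : R) : tau != 0 ->
  \int[mu]_(s in `[0, 2]) normal_fun 0 tau s <= (normal_peak tau)^-1 / 2.
Proof.
move=> t0; have P0 := normal_peak_gt0 t0.
have m1 (A : set R) : measurable_fun A (EFin \o normal_pdf (0 : R) tau).
  by apply/measurable_EFinP; apply: measurable_funTS; exact: measurable_normal_pdf.
have i1 : mu.-integrable `[0, 2] (EFin \o normal_pdf (0 : R) tau).
  by apply: integrableS (integrable_normal_pdf 0 tau).
have half : (\int[mu]_(x in [set x | (0 <= x)%R]) (normal_pdf 0 tau x)%:E)%E = (2^-1)%:E.
  have even : normal_pdf (0 : R) tau =1 normal_pdf 0 tau \o -%R.
    by move=> x; rewrite /= !normal_pdfE// /normal_fun !subr0 sqrrN.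
  have := ge0_symfun_integralT (@normal_pdf_ge0 R 0 tau) (@continuous_normal_pdf R 0
      tau t0) even.
  rewrite integral_normal_pdf; set I := integral _ _ _.
  have : (0 <= I)%E by apply: integral_ge0 => x _; rewrite lee_fin normal_pdf_ge0.
  case: I => [x| |]//=; last by rewrite mulry gtr0_sg// mul1e.
  by rewrite lee_fin => _ [] H; congr EFin; lra.
have : \int[mu]_(s in `[0, 2]) normal_pdf 0 tau s <= 2^-1.
  rewrite -[leRHS]/(fine (2^-1)%:E) -half; apply: fine_le.
  - exact: integrable_fin_num.
  - by rewrite half.
  apply: ge0_subset_integral => //=.
  - by rewrite -set_itvcy.
  - exact: m1.
  - by move=> x _; rewrite lee_fin normal_pdf_ge0.
  - by move=> x /=; rewrite in_itv/= => /andP[].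
rewrite ler_pdivlMl//; apply: le_trans.
rewrite -RintegralZl//.
  by rewrite le_eqVlt; apply/orP; left; apply/eqP; apply: eq_Rintegral => x _; rewrite
      normal_pdfE.
apply: continuous_integrable_itv.
have -> : normal_fun 0 tau = fun x => (normal_peak tau)^-1 * normal_pdf 0 tau x.
  by apply/funext => x; rewrite normal_pdfE// mulrA mulVf ?mul1r// gt_eqF.
by move=> x; apply: cvgM; [exact: cvg_cst|exact: continuous_normal_pdf].
Qed.

(** Integration by parts leaves 3/2 of a Gaussian integral over [[0, 2]], itself at most half the
    total for [tau^2 = 3 / (2 sigma^2)]. The quotient of [(normal_peak tau)^-1] by
    [normal_peak sigma] is [pi sqrt 6], rounded up to 9.8 by [pi < 4]; 7.35 is 3/4 of 9.8. *)
Lemma integral_cf_rate (sigma : R) : 0 < sigma ->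
  \int[mu]_(s in `[0, 2]) cf_rate sigma s <= 7 / 32 * (735 / 100) * normal_peak sigma.
Proof.
move=> s0; have sn0 : sigma != 0 by rewrite gt_eqF.
pose tau := Num.sqrt (3 / 2) / sigma.
have t0 : 0 < tau by rewrite divr_gt0// sqrtr_gt0.
have tn0 : tau != 0 by rewrite gt_eqF.
have t2 : tau ^+ 2 = 3 / 2 / sigma ^+ 2 by rewrite expr_div_n sqr_sqrtr.
pose g s := expR (- (sigma ^+ 2 * s ^+ 2 / 3)).
have gE : g = normal_fun 0 tau.
  apply/funext => s; rewrite /g /normal_fun subr0 t2; congr expR; field.
  by rewrite sn0.
have cg : continuous g by apply: is_derive_continuous => s; exact: is_derive_eq.
pose f s := s ^+ 2 * sigma ^+ 2 * g s.
have cf : continuous f.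
  by apply: is_derive_continuous => s; exact: is_derive_eq.
have ig : mu.-integrable `[0, 2] (EFin \o g) by exact: continuous_integrable_itv.
have if_ : mu.-integrable `[0, 2] (EFin \o f) by exact: continuous_integrable_itv.
rewrite /cf_rate RintegralZl// -mulrA ler_wpM2l//.
pose F s := - (3 / 2 * (s * g s)).
have dF (s : R) : is_derive s 1 F (f s - 3 / 2 * g s).
  by apply: is_derive_eq; rewrite /GRing.scale/= /f /g; field.
have chf : continuous (fun s => f s - 3 / 2 * g s).
  move=> s; apply: (@cvgB _ R^o); first exact: cf.
  by apply: cvgM; [exact: cvg_cst|exact: cg].
have := Rintegral_FTC2 (ler0n R 2) dF chf.
rewrite RintegralB//; last exact: integrable_EFinZl.
rewrite RintegralZl// /F !mul0r mulr0 oppr0 subr0 => /eqP.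
rewrite subr_eq => /eqP ->.
have g2 := expR_ge0 (- (sigma ^+ 2 * 2 ^+ 2 / 3)).
have := half_normal_mass tn0; rewrite -gE.
have : (normal_peak tau)^-1 <= 98 / 10 * normal_peak sigma.
  rewrite -ler_pdivrMr ?normal_peak_gt0// /normal_peak !invrK.
  rewrite -sqrtrM; last by rewrite mulrn_wge0// mulr_ge0 ?sqr_ge0// ltW// pi_gt0.
  rewrite -[leRHS]ger0_norm; last lra.
  rewrite -sqrtr_sqr ler_wsqrtr// t2.
  have p4 : pi < 4 :> R by have := @pihalf_lt2 R; lra.
  have p0 := pi_gt0 R.
  have -> : 3 / 2 / sigma ^+ 2 * pi *+ 2 * (sigma ^+ 2 * pi *+ 2) = 6 * pi ^+ 2.
    by field.
  nra.
rewrite -/(g 2) in g2 *.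
lra.
Qed.

End rate.

Section berry_esseen_cut.
Context {R : realType} d (T : measurableType d) (Q : probability T R) (Y : T -> R).
Variables (theta sigma : R) (n : nat) (z : R -> 'I_n -> R[i]) (v : 'I_n -> R).
Hypothesis mY : measurable_fun setT Y.
Hypothesis theta_bounds : 0 < theta <= 27 / 200.
Hypothesis sigma0 : 0 < sigma.
Hypothesis vE : \sum_(j < n) v j = sigma ^+ 2.
Hypothesis v_bounds : forall j, 0 <= v j <= 4^-1.
Hypothesis cfE : forall s,
  (\int[Q]_w cos (s * Y w) +i* \int[Q]_w sin (s * Y w))%C = \prod_(j < n) z s j.
Hypothesis z_taylor : forall s j (a b : R), 0 <= s -> a ^+ 2 + b ^+ 2 <= 1 ->
  a * (complex.Re (z s j) - (1 - s ^+ 2 * v j / 2)) + b * complex.Im (z s j) <=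
  s ^+ 3 * v j / 12.

(** 6.71 rounds up the product of 0.61, 4/3, 7/32 and 7.35, plus 5.4. *)
Lemma cut_mean_lower :
  mills (theta * sigma) - 671 / 100 * normal_peak sigma <= cut_mean theta Q Y 0.
Proof.
have [t0 _] := andP theta_bounds.
have sc := @cut_mean_normal_close R _ _ Q Y theta sigma (cf_rate sigma) mY
  theta_bounds sigma0 (@continuous_cf_rate R sigma) (cf_rate_ge0 sigma) _.
have {}sc := sc _.
rewrite -normal_cut_mean_mills//; last exact: ltW.
have I := integral_cf_rate sigma0.
have m0 := normal_peak_ge0 sigma.
suff : `|cut_mean theta Q Y 0 - normal_cut_mean sigma theta 0| <=
  61 / 100 * (4 / 3 * \int[lebesgue_measure]_(s in `[0, 2]) cf_rate sigma s) +
  54 / 10 * normal_peak sigma by rewrite ler_norml => /andP[+ _]; lra.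
apply: sc => s a b k s02 k0 abk.
have [s0 _] := andP s02.
have := cf_prod_close (z := z s) vE v_bounds s02 (fun j a b => @z_taylor s j a b s0) k0
    abk.
by rewrite -cfE.
Qed.

End berry_esseen_cut.

(** * Exponential tilting under Bernstein's condition *)

Section cosh_moment.
Context {R : realType} d (T : measurableType d) (P : {measure set T -> \bar R}).
Variables (X : T -> R) (eps v l : R).
Hypothesis mX : measurable_fun setT X.
Hypothesis iX : forall k, P.-integrable setT (EFin \o (fun w => X w ^+ k)).
Hypothesis moment_bound : forall k, (3 <= k)%N ->
  `|\int[P]_w (X w ^+ k)| <= k`!%:R / 2 * eps ^+ (k - 2) * v.
Hypothesis eps0 : 0 < eps.
Hypothesis l0 : 0 <= l.
Hypothesis v0 : 0 <= v.
Let t := l * eps.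
Hypothesis t_small : 3 * t < 1.

Let t0 : 0 <= t. Proof. by rewrite mulr_ge0// ltW. Qed.

(* The coefficients of [cosh]: only even powers occur, so that the partial sums
   increase and the moment condition bounds each term. *)
Let c i : R := (1 + (-1) ^+ i) * l ^+ i.+2 / i.+2`!%:R.

Let c_ge0 i : 0 <= c i.
Proof.
rewrite /c divr_ge0// mulr_ge0// ?exprn_ge0//.
by rewrite -signr_odd; case: (odd i) => /=; rewrite ?expr1 ?expr0; lra.
Qed.

Let cX_ge0 i x : 0 <= c i * x ^+ i.+2.+4.
Proof.
have [oi|ei] := boolP (odd i).
  by rewrite /c -signr_odd oi expr1 subrr !mul0r.
by rewrite mulr_ge0// exprn_even_ge0// /= !negbK.
Qed.

(** After cancelling factorials there remains [(i+6)(i+5)(i+4)(i+3) t^(i+2)], and the polynomial is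
    at most [360 3^i], with equality at [i = 0]; hence the geometric ratio [3 t]. *)
Let c_moment i : c i * \int[P]_w (X w ^+ i.+2.+4) <=
  360 * t ^+ 2 * (eps ^+ 2 * v) * (3 * t) ^+ i.
Proof.
have M0 : 0 <= 360 * t ^+ 2 * (eps ^+ 2 * v) * (3 * t) ^+ i.
  apply: mulr_ge0; last by rewrite exprn_ge0// mulr_ge0.
  apply: mulr_ge0; last by rewrite mulr_ge0// sqr_ge0.
  by apply: mulr_ge0; [exact: ler0n|exact: sqr_ge0].
have [oi|ei] := boolP (odd i); first by rewrite /c -signr_odd oi expr1 subrr !mul0r.
apply: (@le_trans _ _ (2 * l ^+ i.+2 / i.+2`!%:R * ((i.+2.+4)`!%:R / 2 * eps ^+ i.+4 *
    v))).
  rewrite /c -signr_odd (negbTE ei) expr0 ler_wpM2l//.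
    by rewrite divr_ge0// mulr_ge0// exprn_ge0.
  by apply: le_trans (ler_norm _) _; have := @moment_bound i.+2.+4 isT; rewrite subn2.
have -> : 2 * l ^+ i.+2 / i.+2`!%:R * (i.+2.+4`!%:R / 2 * eps ^+ i.+4 * v) =
    (i.+2.+4 * i.+2.+3 * i.+2.+2 * i.+3)%:R * t ^+ i.+2 * (eps ^+ 2 * v).
  have f0 : i.+2`!%:R != 0 :> R by rewrite pnatr_eq0 -lt0n fact_gt0.
  have -> : i.+2.+4`! = (i.+2.+4 * i.+2.+3 * i.+2.+2 * i.+3 * i.+2`!)%N.
    by rewrite (factS i.+2.+3) (factS i.+2.+2) (factS i.+3) (factS i.+2) !mulnA.
  move: (i.+2`!) f0 => q f0; rewrite natrM /t exprMn.
  rewrite (_ : eps ^+ i.+4 = eps ^+ i.+2 * eps ^+ 2); last by rewrite -exprD addn2.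
  by move: (_ * i.+3)%N => N; field.
have nb : (i.+2.+4 * i.+2.+3 * i.+2.+2 * i.+3 <= 360 * 3 ^ i)%N.
  elim: (i) => // k IH; rewrite expnS mulnCA.
  by apply: leq_trans (leq_mul (leqnn 3) IH); nia.
rewrite [leRHS](_ : _ = (360 * 3 ^ i)%:R * t ^+ i.+2 * (eps ^+ 2 * v)); last first.
  rewrite natrM natrX (exprMn i 3 t) -(addn2 i) (exprD t).
  by move: (3 ^+ i : R) (t ^+ i) (360 : R) => a b K; ring.
by rewrite ler_wpM2r ?ler_wpM2r ?exprn_ge0 ?ler_nat// mulr_ge0// sqr_ge0.
Qed.

Let f N w : R := \sum_(i < N) c i * X w ^+ i.+2.+4.
Let F w : R := X w ^+ 4 * (expR (l * X w) + expR (- (l * X w)) - 2).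

Let mf N : measurable_fun setT (f N).
Proof.
apply: measurable_sum => i; apply: measurable_funM => //.
exact: measurable_funX.
Qed.

(** The first two terms of the two exponential series add up to 2, so the sums start at index 2. *)
Let f_cvg w : f N w @[N --> \oo] --> F w.
Proof.
pose y := l * X w.
have E (z : R) : series (exp_coeff z) n @[n --> \oo] --> expR z.
  exact: is_cvg_series_exp_coeff.
have E2 (z : R) : series (exp_coeff z) (n + 2)%N @[n --> \oo] --> expR z.
  by rewrite (cvg_shiftn 2 (series (exp_coeff z))).
have -> : f ^~ w = fun N => X w ^+ 4 *
    (series (exp_coeff y) (N + 2)%N + series (exp_coeff (- y)) (N + 2)%N - 2).
  apply/funext => N; rewrite /series/= addn2 !big_nat_recl//= /exp_coeff/=.
  rewrite !expr0 !expr1 fact0.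
  rewrite (_ : _ - 2 = \sum_(0 <= i < N) (y ^+ i.+2 / i.+2`!%:R + (- y) ^+ i.+2 /
      i.+2`!%:R)); last first.
    by rewrite big_split/=; lra.
  rewrite /f big_mkord mulr_sumr; apply: eq_bigr => i _.
  rewrite (_ : X w ^+ i.+2.+4 = X w ^+ i.+2 * X w ^+ 4); last by rewrite -exprD addn4.
  rewrite /c (exprNn y) /y exprMn.
  have -> : (-1) ^+ i.+2 = (-1) ^+ i :> R by rewrite !exprS !mulN1r opprK.
  by move: (i.+2`!%:R : R) ((-1) ^+ i : R) => q r; ring.
apply: cvgM; first exact: cvg_cst.
apply: (@cvgB _ R^o); last exact: cvg_cst.
by apply: (@cvgD _ R^o); exact: E2.
Qed.

Let f_nd w : {homo f^~ w : m n / (m <= n)%N >-> m <= n}.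
Proof.
move=> m n mn; rewrite /f -!(big_mkord xpredT (fun i => c i * X w ^+ i.+2.+4)).
by rewrite (@big_cat_nat _ _ _ m 0 n)//= lerDl sumr_ge0.
Qed.

Let f_ge0 N w : 0 <= f N w.
Proof. by rewrite /f sumr_ge0. Qed.

Let f_int N : (\int[P]_w (f N w)%:E <= (360 * t ^+ 2 / (1 - 3 * t) * (eps ^+ 2 *
    v))%:E)%E.
Proof.
under eq_integral do rewrite /f -sumEFin.
rewrite integral_sum//; last by move=> i; exact: integrable_EFinZl.
apply: (@le_trans _ _ (\sum_(i < N) (360 * t ^+ 2 * (eps ^+ 2 * v) * (3 * t) ^+ i)%:E)%E).
  apply: lee_sum => i _.
  have -> : (\int[P]_w (c i * X w ^+ i.+2.+4)%:E = (c i * \int[P]_w (X w ^+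
      i.+2.+4))%:E)%E.
    rewrite -RintegralZl// /Rintegral fineK//.
    by apply: integrable_fin_num => //; exact: integrable_EFinZl.
  by rewrite lee_fin.
rewrite sumEFin lee_fin -mulr_sumr.
have : \sum_(i < N) (3 * t) ^+ i <= (1 - 3 * t)^-1.
  rewrite -[leRHS]mul1r ler_pdivlMr ?subr_gt0// mulrC.
  have := subrX1 (3 * t) N; rewrite -opprB -[3 * t - 1]opprB mulNr => /oppr_inj <-.
  by rewrite gerBl exprn_ge0// mulr_ge0.
have := t0; have := sqr_ge0 t; have := sqr_ge0 eps => h1 h2 h3.
move=> /(ler_wpM2l (mulr_ge0 (mulr_ge0 (ler0n _ 360) h2) (mulr_ge0 h1 v0))) /le_trans;
    apply.
by rewrite le_eqVlt; apply/orP; left; apply/eqP; ring.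
Qed.

(** Monotone convergence along the partial sums gives the bound and the integrability together; no
    exponential moment is assumed in advance. *)
Lemma cosh_moment4 :
  P.-integrable setT (EFin \o F) /\
  \int[P]_w F w <= 360 * t ^+ 2 / (1 - 3 * t) * (eps ^+ 2 * v).
Proof.
have F0 w : 0 <= F w.
  rewrite -(cvg_lim _ (@f_cvg w))//; apply: limr_ge; first by apply/cvg_ex; exists (F w).
  by near=> N; exact: f_ge0.
have mE s : measurable_fun setT (fun w => expR (s * X w)).
  by apply: (measurableT_comp (@measurable_expR R)); exact: measurable_funM.
have mF : measurable_fun setT F.
  apply: measurable_funM; first exact: measurable_funX.
  apply: measurable_funB => //; apply: measurable_funD; first exact: mE.
  by under eq_fun do rewrite -mulNr; exact: mE.
have H : (\int[P]_w (F w)%:E <= (360 * t ^+ 2 / (1 - 3 * t) * (eps ^+ 2 * v))%:E)%E.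
  have -> : (\int[P]_w (F w)%:E = limn (fun N => \int[P]_w (f N w)%:E))%E.
    rewrite -monotone_convergence//.
    - apply: eq_integral => w _; apply/esym/cvg_lim => //.
      by apply: cvg_EFin; [near=> N|exact: f_cvg].
    - by move=> N; apply/measurable_EFinP; exact: mf.
    - by move=> N w _; rewrite lee_fin.
    - by move=> w _ m n mn; rewrite lee_fin; exact: f_nd.
  apply: lime_le; last by near=> N; exact: f_int.
  apply: ereal_nondecreasing_is_cvgn => m n mn; apply: ge0_le_integral => //.
  - by move=> w _; rewrite lee_fin.
  - by apply/measurable_EFinP; exact: mf.
  - by apply/measurable_EFinP; exact: mf.
  - by move=> w _; rewrite lee_fin; exact: f_nd.
have iF : P.-integrable setT (EFin \o F).
  apply/integrableP; split; first exact/measurable_EFinP.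
  under eq_integral do rewrite /= ger0_norm//.
  by apply: le_lt_trans H _; rewrite ltry.
split => //; rewrite /Rintegral -[leRHS]/(fine (_)%:E); apply: fine_le => //.
exact: integrable_fin_num.
Unshelve. all: end_near. Qed.

End cosh_moment.

Section tilt_definitions.
Context {R : realType} d (T : measurableType d) (P : {measure set T -> \bar R}).
Implicit Types (X : T -> R) (l x : R).

Definition mgf X l := \int[P]_w expR (l * X w).

(** A function of the value of [X], not of the outcome, so that products of weights fall under the
    independence lemmas. *)
Definition tilt_weight X l x := expR (l * x) / mgf X l.

Definition tilt_mean X l := \int[P]_w (X w * tilt_weight X l (X w)).

Definition tilt_var X l :=
  \int[P]_w ((X w - tilt_mean X l) ^+ 2 * tilt_weight X l (X w)).

End tilt_definitions.

Section tilt.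
Context {R : realType} d (T : measurableType d) (P : probability T R).
Variables (X : T -> R) (eps v l : R).
Hypothesis mX : measurable_fun setT X.
Hypothesis iX : forall k, P.-integrable setT (EFin \o (fun w => X w ^+ k)).
Hypothesis X_mean : \int[P]_w (X w) = 0.
Hypothesis X_var : \int[P]_w (X w ^+ 2) = v.
Hypothesis moment_bound : forall k, (3 <= k)%N ->
  `|\int[P]_w (X w ^+ k)| <= k`!%:R / 2 * eps ^+ (k - 2) * v.
Hypothesis eps0 : 0 < eps.
Hypothesis l0 : 0 <= l.
Local Notation t := (l * eps).
Hypothesis t_small : t <= 3 / 200.

Let t0 : 0 <= t. Proof. by rewrite mulr_ge0// ltW. Qed.

Let E w := expR (l * X w).
Let M k := \int[P]_w (X w ^+ k).
Let A k := \int[P]_w (X w ^+ k * E w).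

Let E0 w : 0 <= E w. Proof. exact: expR_ge0. Qed.

Let mE : measurable_fun setT E.
Proof. by apply: (measurableT_comp (@measurable_expR R)); exact: measurable_funM. Qed.

Let v0 : 0 <= v.
Proof. by rewrite -X_var; apply: Rintegral_ge0 => w _; exact: sqr_ge0. Qed.

Let M0 : M 0 = 1.
Proof.
rewrite /M -[RHS](Rintegral_cst_probability P).
by apply: eq_Rintegral => w _; rewrite expr0.
Qed.

Let M1 : M 1 = 0. Proof. exact: X_mean. Qed.
Let M2 : M 2 = v. Proof. exact: X_var. Qed.

Let M3 : - (3 * eps * v) <= M 3 <= 3 * eps * v.
Proof.
have := @moment_bound 3 isT; rewrite ler_norml (_ : 3`! = 6)%N// expr1.
by rewrite (_ : 6 / 2 = 3 :> R)//; field.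
Qed.

Let M4 : M 4 <= 12 * eps ^+ 2 * v.
Proof.
apply: le_trans (ler_norm _) _; have := @moment_bound 4 isT; rewrite (_ : 4`! = 24)%N//.
by rewrite (_ : 24 / 2 = 12 :> R)//; field.
Qed.

Let M5 : M 5 <= 60 * eps ^+ 3 * v.
Proof.
apply: le_trans (ler_norm _) _; have := @moment_bound 5 isT; rewrite (_ : 5`! = 120)%N//.
by rewrite (_ : 120 / 2 = 60 :> R)//; field.
Qed.

Let F w : R := X w ^+ 4 * (expR (l * X w) + expR (- (l * X w)) - 2).

Let iF : P.-integrable setT (EFin \o F).
Proof.
have t3 : 3 * (l * eps) < 1 by move: t_small; lra.
by have [] := cosh_moment4 mX iX moment_bound eps0 l0 v0 t3.
Qed.

Let F_le : \int[P]_w F w <= 377 * t ^+ 2 * eps ^+ 2 * v.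
Proof.
have t3 : 3 * (l * eps) < 1 by move: t_small; lra.
have [_ /le_trans] := cosh_moment4 mX iX moment_bound eps0 l0 v0 t3; apply.
rewrite mulrA ler_wpM2r// ler_wpM2r ?sqr_ge0//.
have t31 : 0 < 1 - 3 * t by move: t_small; lra.
rewrite ler_pdivrMr// mulrAC ler_wpM2r ?sqr_ge0//; move: t_small; lra.
Qed.

(** With [y = l X], the bound [exp y <= 1 + y + (exp y + exp (- y) - 2)] amounts to
    [1 - y <= exp (- y)]. It passes from the even function [F] to the tilt at the price of a signed
    fifth moment. *)
Let XE4_le w : X w ^+ 4 * E w <= X w ^+ 4 + l * X w ^+ 5 + F w.
Proof.
rewrite /F /E; have x40 : 0 <= X w ^+ 4 by rewrite exprn_even_ge0.
have := expR_ge1Dx (- (l * X w)).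
rewrite -subr_ge0 => /(mulr_ge0 x40); lra.
Qed.

Let iXE4 : P.-integrable setT (EFin \o (fun w => X w ^+ 4 * E w)).
Proof.
have iG := integrable_EFinD measurableT
  (integrable_EFinD measurableT (iX 4) (integrable_EFinZl l measurableT (iX 5))) iF.
apply: (le_integrable _ _ _ iG) => //.
  by apply/measurable_EFinP; apply: measurable_funM => //; exact: measurable_funX.
move=> w _; rewrite lee_fin ger0_norm; last by rewrite mulr_ge0// exprn_even_ge0.
by apply: le_trans (ler_norm _).
Qed.

Let A4 : A 4 <= 1299 / 100 * eps ^+ 2 * v.
Proof.
have i1 := integrable_EFinZl l measurableT (iX 5).
have i2 := integrable_EFinD measurableT (iX 4) i1.
have i3 := integrable_EFinD measurableT i2 iF.
have : A 4 <= \int[P]_w (X w ^+ 4 + l * X w ^+ 5 + F w) by exact: le_Rintegral.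
rewrite RintegralD// RintegralD// RintegralZl// -/(M 4) -/(M 5).
have h5 := ler_wpM2l l0 M5.
have e0 : 0 <= eps ^+ 2 * v by rewrite mulr_ge0 ?sqr_ge0.
have : (12 + 60 * t + 377 * t ^+ 2) * (eps ^+ 2 * v) <= 1299 / 100 * (eps ^+ 2 * v).
  by rewrite ler_wpM2r//; move: t_small t0; move: t => u; nra.
move: M4 F_le h5; lra.
Qed.

Let pow_le (x : R) (k : nat) : (k <= 4)%N -> `|x| ^+ k <= 1 + x ^+ 4.
Proof.
move=> k4; have x4 : x ^+ 4 = `|x| ^+ 4 by rewrite -normrX ger0_norm// exprn_even_ge0.
have [x1|/ltW x1] := leP `|x| 1.
  apply: (@le_trans _ _ 1); first by rewrite exprn_ile1.
  by rewrite lerDl exprn_even_ge0.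
by rewrite x4 (le_trans (ler_weXn2l x1 k4))// lerDr.
Qed.

Lemma integrable_tilt k : (k <= 4)%N ->
  P.-integrable setT (EFin \o (fun w => X w ^+ k * expR (l * X w))).
Proof.
move=> k4.
have ic : P.-integrable setT (EFin \o (fun=> expR l)).
  by apply: (@integrable_bounded _ _ _ P _ (expR l)) => // w; rewrite ger0_norm ?expR_ge0.
have iG := integrable_EFinD measurableT ic (integrable_EFinZl 2 measurableT iXE4).
apply: (le_integrable _ _ _ iG) => //.
  by apply/measurable_EFinP; apply: measurable_funM => //; exact: measurable_funX.
move=> w _; rewrite lee_fin; apply: (le_trans _ (ler_norm _)).
rewrite normrM normrX [`|expR _|]ger0_norm ?expR_ge0// -/(E w).
apply: le_trans (ler_wpM2r (E0 w) (pow_le (X w) k4)) _.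
suff : E w <= expR l + X w ^+ 4 * E w by lra.
have x40 : 0 <= X w ^+ 4 by rewrite exprn_even_ge0.
have [x1|/ltW x1] := leP (X w) 1.
  apply: le_trans (_ : expR l <= _); first by rewrite ler_expR ler_piMr.
  by rewrite lerDl mulr_ge0.
apply: (@le_trans _ _ (X w ^+ 4 * E w)); last by rewrite lerDr expR_ge0.
by rewrite ler_peMl// exprn_ege1.
Qed.

Let sum5 (f : nat -> R) : \sum_(k < 5) f k = f 0 + f 1 + f 2 + f 3 + f 4.
Proof. by rewrite !big_ord_recr big_ord0 /= add0r. Qed.

Let iA (c : R) k : (k <= 4)%N -> P.-integrable setT (EFin \o (fun w => c * (X w ^+ k *
    E w))).
Proof. by move=> k4; apply: integrable_EFinZl => //; exact: integrable_tilt. Qed.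

Let iM (c : R) k : P.-integrable setT (EFin \o (fun w => c * X w ^+ k)).
Proof. exact: integrable_EFinZl. Qed.

(** Coefficient lists of polynomials of degree at most 4; missing entries read as 0, the default of
    the access. *)
Let pol (a : seq R) (x : R) := a`_0 + a`_1 * x + a`_2 * x ^+ 2 + a`_3 * x ^+ 3 + a`_4 *
    x ^+ 4.

Let polE a x : pol a x = \sum_(k < 5) a`_k * x ^+ k.
Proof. by rewrite (sum5 (fun k => a`_k * x ^+ k)) expr0 mulr1 expr1. Qed.

Let int_pol a : P.-integrable setT (EFin \o (fun w => pol a (X w))) /\
  \int[P]_w (pol a (X w)) = a`_0 + a`_2 * v + a`_3 * M 3 + a`_4 * M 4.
Proof.
have := @Rintegral_sum_seq _ _ _ P setT _ (index_enum 'I_5)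
  (fun k w => a`_k * X w ^+ k) measurableT (fun k => iM a`_k k).
rewrite (_ : (fun w => \sum_k _) = fun w => pol a (X w)); last first.
  by apply/funext => w; rewrite polE.
case=> i ->; split => //.
rewrite (eq_bigr (fun k : 'I_5 => a`_k * M k)); last by move=> k _; rewrite RintegralZl.
by rewrite (sum5 (fun k => a`_k * M k)) M0 M1 M2 mulr1 mulr0 addr0.
Qed.

Let int_polE b : P.-integrable setT (EFin \o (fun w => pol b (X w) * E w)) /\
  \int[P]_w (pol b (X w) * E w) = b`_0 * A 0 + b`_1 * A 1 + b`_2 * A 2 + b`_3 * A 3 +
      b`_4 * A 4.
Proof.
have := @Rintegral_sum_seq _ _ _ P setT _ (index_enum 'I_5)
  (fun k w => b`_k * (X w ^+ k * E w)) measurableT (fun k => iA b`_k (ltn_ord k : (k <=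
      4)%N)).
rewrite (_ : (fun w => \sum_k _) = fun w => pol b (X w) * E w); last first.
  by apply/funext => w; rewrite polE mulr_suml; apply: eq_bigr => k _; rewrite mulrA.
case=> i ->; split => //.
rewrite (eq_bigr (fun k : 'I_5 => b`_k * A k)); last first.
  by move=> k _; rewrite RintegralZl//; exact: integrable_tilt (ltn_ord k).
by rewrite (sum5 (fun k => b`_k * A k)).
Qed.

(** Reduces each moment estimate that follows to a pointwise inequality, given by two coefficient
    lists: [a] for the plain moments [M k], [b] for the tilted ones [A k]. *)
Let lin_ge0 (a b : seq R) :
  (forall x, 0 <= pol a x + pol b x * expR (l * x)) ->
  0 <= (a`_0 + a`_2 * v + a`_3 * M 3 + a`_4 * M 4) +
  (b`_0 * A 0 + b`_1 * A 1 + b`_2 * A 2 + b`_3 * A 3 + b`_4 * A 4).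
Proof.
have [i1 <-] := int_pol a; have [i2 <-] := int_polE b.
by move=> H; rewrite -RintegralD//; apply: Rintegral_ge0 => w _; exact: H.
Qed.

Let Z_ge : 1 + l ^+ 2 * v / 2 * (1 - t) <= A 0.
Proof.
have := @lin_ge0 [:: -1; - l; - (l ^+ 2 / 2); - (l ^+ 3 / 6)] [:: 1].
rewrite /pol/= => /(_ _) H.
have {H} : 0 <= -1 + - (l ^+ 2 / 2) * v + - (l ^+ 3 / 6) * M 3 + A 0.
  apply: le_trans (H _) _; last by rewrite le_eqVlt; apply/orP; left; apply/eqP; ring.
  by move=> x; have := expR_taylor3_ge (l * x); rewrite !exprMn; lra.
have [/(ler_wpM2l (exprn_ge0 3 l0)) + _] := andP M3; lra.
Qed.

Let Z_le : A 0 <= 1 + l ^+ 2 / 2 * v + l ^+ 2 / 2 * A 2.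
Proof.
have := @lin_ge0 [:: 1; l; l ^+ 2 / 2] [:: -1; 0; l ^+ 2 / 2].
rewrite /pol/= => /(_ _) H.
have {H} := H _; rewrite -subr_ge0 => H; apply: le_trans (H _) _; last first.
  by rewrite le_eqVlt; apply/orP; left; apply/eqP; ring.
by move=> x; have := expR_taylor1_le (l * x); rewrite !exprMn; lra.
Qed.

Let A2_le : A 2 <= v * (1 + 3 * t + 125 / 10 * t ^+ 2).
Proof.
have := @lin_ge0 [:: 0; 0; 1; l; l ^+ 2 / 2] [:: 0; 0; -1; 0; l ^+ 2 / 2].
rewrite /pol/= => /(_ _) H.
have {H} : 0 <= v + l * M 3 + l ^+ 2 / 2 * M 4 - A 2 + l ^+ 2 / 2 * A 4.
  apply: le_trans (H _) _; last by rewrite le_eqVlt; apply/orP; left; apply/eqP; ring.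
  move=> x; have := ler_wpM2l (sqr_ge0 x) (expR_taylor1_le (l * x)); rewrite !exprMn; lra.
have [_ /(ler_wpM2l l0)] := andP M3.
have := ler_wpM2l (sqr_ge0 l) M4.
have := ler_wpM2l (sqr_ge0 l) A4.
have : 0 <= l ^+ 2 * (eps ^+ 2 * v) by rewrite mulr_ge0 ?sqr_ge0// mulr_ge0 ?sqr_ge0.
lra.
Qed.

Let A2_ge : v * (1 - 3 * t) <= A 2.
Proof.
have := @lin_ge0 [:: 0; 0; -1; - l] [:: 0; 0; 1].
rewrite /pol/= => /(_ _) H.
have {H} : 0 <= - v - l * M 3 + A 2.
  apply: le_trans (H _) _; last by rewrite le_eqVlt; apply/orP; left; apply/eqP; ring.
  move=> x; have := ler_wpM2l (sqr_ge0 x) (expR_ge1Dx (l * x)); lra.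
have [/(ler_wpM2l l0) + _] := andP M3.
lra.
Qed.

(** Stated for [l * A 1] because the remainder has a sign only after multiplication by [l x]; the
    case [l = 0] is treated when [l] is divided out. *)
Let lA1_ge : l ^+ 2 * v * (1 - 3 / 2 * t) <= l * A 1.
Proof.
have := @lin_ge0 [:: 0; - l; - l ^+ 2; - (l ^+ 3 / 2)] [:: 0; l].
rewrite /pol/= => /(_ _) H.
have {H} : 0 <= - l ^+ 2 * v - l ^+ 3 / 2 * M 3 + l * A 1.
  apply: le_trans (H _) _; last by rewrite le_eqVlt; apply/orP; left; apply/eqP; ring.
  move=> x; have := @mul_expR_taylor2 R (l * x) => /andP[+ _]; lra.
have [/(ler_wpM2l (exprn_ge0 3 l0)) + _] := andP M3.
lra.
Qed.

Let lA1_le : l * A 1 <= l ^+ 2 * v * (1 + 3 / 2 * t + 42 / 10 * t ^+ 2).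
Proof.
have := @lin_ge0 [:: 0; l; l ^+ 2; l ^+ 3 / 2; l ^+ 4 / 6] [:: 0; - l; 0; 0; l ^+ 4 / 6].
rewrite /pol/= => /(_ _) H.
have {H} : 0 <= l ^+ 2 * v + l ^+ 3 / 2 * M 3 + l ^+ 4 / 6 * M 4 - l * A 1 + l ^+ 4 / 6
    * A 4.
  apply: le_trans (H _) _; last by rewrite le_eqVlt; apply/orP; left; apply/eqP; ring.
  move=> x; have := @mul_expR_taylor2 R (l * x) => /andP[_].
  rewrite !exprMn; lra.
have [_ /(ler_wpM2l (exprn_ge0 3 l0))] := andP M3.
have := ler_wpM2l (exprn_ge0 4 l0) M4.
have := ler_wpM2l (exprn_ge0 4 l0) A4.
have : 0 <= l ^+ 4 * (eps ^+ 2 * v) by rewrite mulr_ge0 ?exprn_ge0// mulr_ge0 ?sqr_ge0.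
lra.
Qed.

(** The fourth moment dominates the squared variance and is itself at most [12 eps^2 v]. *)
Lemma variance_bound : v <= 12 * eps ^+ 2.
Proof.
have := @lin_ge0 [:: v ^+ 2; 0; - (2 * v); 0; 1] [::].
rewrite /pol/= => /(_ _) H.
have {H} : 0 <= - v ^+ 2 + M 4.
  apply: le_trans (H _) _; last by rewrite le_eqVlt; apply/orP; left; apply/eqP; ring.
  by move=> x; have := sqr_ge0 (x ^+ 2 - v); lra.
move=> h; have [vp|vn] := ltP 0 v; last by rewrite (le_trans vn)// mulr_ge0 ?sqr_ge0.
rewrite -(ler_pM2l vp); move: M4 h; lra.
Qed.

Let Z := mgf P X l.
Let b := tilt_mean P X l.
Let vb := tilt_var P X l.
Let W := fun w => tilt_weight P X l (X w).

Let ZE : Z = A 0.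
Proof. by apply: eq_Rintegral => w _; rewrite expr0 mul1r. Qed.

Lemma mgf_ge1 : 1 <= Z.
Proof.
rewrite ZE; apply: le_trans Z_ge; rewrite lerDl mulr_ge0 ?divr_ge0 ?mulr_ge0 ?sqr_ge0//.
by move: t_small; lra.
Qed.

Let Z0 : 0 < Z. Proof. exact: lt_le_trans mgf_ge1. Qed.

Let int_polW c : P.-integrable setT (EFin \o (fun w => pol c (X w) * W w)) /\
  \int[P]_w (pol c (X w) * W w) =
  (c`_0 * A 0 + c`_1 * A 1 + c`_2 * A 2 + c`_3 * A 3 + c`_4 * A 4) / Z.
Proof.
have [i e] := int_polE c.
have -> : (fun w => pol c (X w) * W w) = fun w => Z^-1 * (pol c (X w) * E w).
  by apply/funext => w; rewrite /W /tilt_weight -/Z /E; ring.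
by split; [exact: integrable_EFinZl|rewrite RintegralZl// e mulrC].
Qed.

Lemma tilt_weight_ge0 x : 0 <= tilt_weight P X l x.
Proof. by rewrite divr_ge0 ?expR_ge0// ltW. Qed.

Lemma tilt_mass : P.-integrable setT (EFin \o W) /\ \int[P]_w W w = 1.
Proof.
have [] := int_polW [:: 1].
rewrite (_ : (fun w => _) = W); last by apply/funext => w; rewrite /pol/=; ring.
by move=> i ->; split => //=; rewrite !mul0r !addr0 mul1r -ZE divff// gt_eqF.
Qed.

Let bE : b = A 1 / Z.
Proof.
have [_] := int_polW [:: 0; 1]; rewrite /= !mul0r !addr0 add0r mul1r => <-.
by apply: eq_Rintegral => w _; rewrite /W /pol/=; ring.
Qed.

Lemma tilt_centered :
  P.-integrable setT (EFin \o (fun w => (X w - b) * W w)) /\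
  \int[P]_w ((X w - b) * W w) = 0.
Proof.
have [] := int_polW [:: - b; 1].
rewrite (_ : (fun w => _ * _) = (fun w => (X w - b) * W w)); last first.
  by apply/funext => w; rewrite /pol/=; ring.
move=> i ->; split => //=; rewrite !mul0r !addr0 mul1r -ZE bE mulNr divfK ?gt_eqF//.
by rewrite addrC subrr mul0r.
Qed.

Let vb_def : P.-integrable setT (EFin \o (fun w => (X w - b) ^+ 2 * W w)) /\
  vb = A 2 / Z - b ^+ 2.
Proof.
have [] := int_polW [:: b ^+ 2; - (2 * b); 1].
rewrite (_ : (fun w => _ * _) = (fun w => (X w - b) ^+ 2 * W w)); last first.
  by apply/funext => w; rewrite /pol/=; ring.
move=> i e; split => //; rewrite /vb /tilt_var e /=.
have -> : A 1 = b * Z by rewrite bE divfK// gt_eqF.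
by rewrite -ZE; field; rewrite gt_eqF.
Qed.

Lemma integrable_tilt_var : P.-integrable setT (EFin \o (fun w => (X w - b) ^+ 2 * W w)).
Proof. by have [] := vb_def. Qed.

Let p0 : 0 <= l ^+ 2 * v. Proof. by rewrite mulr_ge0 ?sqr_ge0. Qed.

Let p_le : l ^+ 2 * v <= 12 * t ^+ 2.
Proof. by have := ler_wpM2l (sqr_ge0 l) variance_bound; rewrite exprMn; lra. Qed.

Let A2_le' : A 2 <= 131 / 125 * v.
Proof.
apply: le_trans A2_le _; rewrite mulrC ler_wpM2r//.
by move: t_small t0; move: t => u; nra.
Qed.

Let Z_le' : Z <= 1 + 123 / 10 * t ^+ 2.
Proof.
rewrite ZE; have := ler_wpM2l (sqr_ge0 l) A2_le'; move: Z_le p_le p0; lra.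
Qed.

Let t2 : t ^+ 2 <= 1 / 4000.
Proof. by move: t_small t0; move: t => u; nra. Qed.

Let A1_ge : l * v * (1 - 3 / 2 * t) <= A 1.
Proof.
have [lp|l00] := ltP 0 l; first by rewrite -(ler_pM2l lp); move: lA1_ge; lra.
have le0 : l = 0 by apply/le_anti/andP.
rewrite le0 !mul0r (_ : A 1 = 0)// -X_mean; apply: eq_Rintegral => w _.
by rewrite /E le0 mul0r expR0 mulr1 expr1.
Qed.

Let A1_le : A 1 <= l * v * (1 + 3 / 2 * t + 42 / 10 * t ^+ 2).
Proof.
have [lp|l00] := ltP 0 l; first by rewrite -(ler_pM2l lp); move: lA1_le; lra.
have le0 : l = 0 by apply/le_anti/andP.
rewrite le0 !mul0r (_ : A 1 = 0)// -X_mean; apply: eq_Rintegral => w _.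
by rewrite /E le0 mul0r expR0 mulr1 expr1.
Qed.

Let lv0 : 0 <= l * v. Proof. exact: mulr_ge0. Qed.

Let A1_0 : 0 <= A 1.
Proof. by apply: le_trans A1_ge; rewrite mulr_ge0//; move: t_small; lra. Qed.

Let b0 : 0 <= b. Proof. by rewrite bE divr_ge0// ltW. Qed.

Let b_A1 : b <= A 1.
Proof. by rewrite bE ler_pdivrMr// ler_peMr// mgf_ge1. Qed.

Let b_le : b <= 128 / 125 * (l * v).
Proof.
apply: le_trans b_A1 (le_trans A1_le _); rewrite mulrC ler_wpM2r//.
by move: t_small t2; lra.
Qed.

Let b2_le : b ^+ 2 <= 1 / 300 * v.
Proof.
apply: (@le_trans _ _ ((128 / 125 * (l * v)) ^+ 2)).
  by rewrite lerXn2r// nnegrE mulr_ge0.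
rewrite (_ : _ ^+ 2 = (128 / 125) ^+ 2 * (l ^+ 2 * v) * v); last by ring.
by rewrite ler_wpM2r//; move: p_le t2; lra.
Qed.

(** The loss [1.5 t] of [A 1] and the excess [12.3 t^2] of [Z] over 1 fit within [2.4 t], the
    coefficient built into [lambda_]. *)
Lemma tilt_mean_ge : l * v * (1 - 24 / 10 * t) <= b.
Proof.
rewrite bE ler_pdivlMr//; apply: le_trans A1_ge.
rewrite -(mulrA (l * v)) ler_wpM2l//.
apply: (@le_trans _ _ ((1 - 24 / 10 * t) * (1 + 123 / 10 * t ^+ 2))).
  by rewrite ler_wpM2l//; move: t_small; lra.
by move: t_small t0; move: t => u; nra.
Qed.

Lemma tilt_var_ge : 47 / 50 * v <= vb.
Proof.
have [_ ->] := vb_def.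
suff : 119 / 125 * v <= A 2 / Z by move: b2_le v0; lra.
rewrite ler_pdivlMr//; apply: le_trans A2_ge.
have -> : 119 / 125 * v * Z = v * (119 / 125 * Z) by ring.
by rewrite ler_wpM2l//; move: Z_le' t2 t_small; lra.
Qed.

Lemma tilt_var_le : vb <= v * (1 + 6 * t).
Proof.
have [_ ->] := vb_def; apply: (@le_trans _ _ (A 2)).
  apply: (@le_trans _ _ (A 2 / Z)); first by rewrite gerBl sqr_ge0.
  rewrite ler_pdivrMr// ler_peMr ?mgf_ge1//.
  by apply: le_trans A2_ge; rewrite mulr_ge0//; move: t_small; lra.
apply: le_trans A2_le _; rewrite ler_wpM2l//.
by move: t_small t0; move: t => u; nra.
Qed.

(** In units of [9 eps] the variance is at most 1/4. *)
Lemma tilt_var_bound : vb <= 81 / 4 * eps ^+ 2.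
Proof.
apply: le_trans tilt_var_le _; apply: (@le_trans _ _ (v * (109 / 100))).
  by rewrite ler_wpM2l//; move: t_small; lra.
by have := variance_bound; have := sqr_ge0 eps; lra.
Qed.

(** [2 rho |y|^3 <= rho^2 y^2 + y^4] with [rho = 9/2 eps] reduces the odd absolute moment to even
    ones. It remains to bound the fourth central moment by [rho^2 vb]: in units of [eps^2 v], about
    17.5 against at least 19. *)
Lemma integrable_tilt_third :
  P.-integrable setT (EFin \o (fun w => `|X w - b| ^+ 3 * W w)) /\
  \int[P]_w (`|X w - b| ^+ 3 * W w) <= 9 / 2 * eps * vb.
Proof.
have [i4 e4] := int_polW [:: b ^+ 4; - (4 * b ^+ 3); 6 * b ^+ 2; - (4 * b); 1].
have iV := integrable_tilt_var.
pose rho := 9 / 2 * eps; have r0 : 0 < rho by rewrite mulr_gt0.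
have ptw w : `|X w - b| ^+ 3 * W w <= rho / 2 * ((X w - b) ^+ 2 * W w) +
    (2 * rho)^-1 * (pol [:: b ^+ 4; - (4 * b ^+ 3); 6 * b ^+ 2; - (4 * b); 1] (X w) * W
        w).
  set q4 := pol _ (X w).
  rewrite [leRHS](_ : _ = (rho / 2 * (X w - b) ^+ 2 + (2 * rho)^-1 * q4) * W w); last
      by ring.
  rewrite ler_wpM2r ?tilt_weight_ge0// /q4.
  have -> : pol [:: b ^+ 4; - (4 * b ^+ 3); 6 * b ^+ 2; - (4 * b); 1] (X w) = `|X w -
      b| ^+ 4.
    rewrite -normrX ger0_norm ?exprn_even_ge0// /pol/=; ring.
  rewrite -[(X w - b) ^+ 2]real_normK ?num_real//.
  set y : R := `|X w - b|; have y0 : 0 <= y by exact: normr_ge0.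
  rewrite -(ler_pM2l (mulr_gt0 (ltr0n R 2) r0)).
  rewrite [leRHS](_ : _ = rho ^+ 2 * y ^+ 2 + y ^+ 4); last by field; rewrite gt_eqF.
  by have := sqr_ge0 (y * (rho - y)); lra.
have j1 := integrable_EFinZl (rho / 2) measurableT iV.
have j2 := integrable_EFinZl (2 * rho)^-1 measurableT i4.
have mW : measurable_fun setT W.
  by apply: measurable_funM.
have i3 : P.-integrable setT (EFin \o (fun w => `|X w - b| ^+ 3 * W w)).
  apply: (le_integrable _ _ _ (integrable_EFinD measurableT j1 j2)) => //.
    apply/measurable_EFinP; apply: measurable_funM => //; apply: measurable_funX.
    by apply: (measurableT_comp (@normr_measurable R setT)); exact: measurable_funB.
  move=> w _; rewrite lee_fin; apply: (le_trans _ (ler_norm _)).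
  by rewrite ger0_norm// mulr_ge0 ?tilt_weight_ge0 ?exprn_ge0.
split => //; apply: (@le_trans _ _ (\int[P]_w (rho / 2 * ((X w - b) ^+ 2 * W w) +
    (2 * rho)^-1 * (pol [:: b ^+ 4; - (4 * b ^+ 3); 6 * b ^+ 2; - (4 * b); 1] (X w) * W
        w)))).
  by apply: le_Rintegral => //; exact: integrable_EFinD.
rewrite RintegralD// RintegralZl// RintegralZl//.
rewrite -[\int[P]_w ((X w - b) ^+ 2 * W w)]/vb.
set Q4 := \int[P]_w (pol _ _ * _).
suff : Q4 <= rho ^+ 2 * vb.
  rewrite -(ler_pM2l (_ : 0 < (2 * rho)^-1)) ?invr_gt0 ?mulr_gt0//.
  rewrite (_ : (2 * rho)^-1 * (rho ^+ 2 * vb) = rho / 2 * vb); last by field; rewrite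
      gt_eqF.
  by rewrite -/rho; lra.
have [k4 f4] := int_polW [:: 11 ^+ 3 * b ^+ 4; 0; 0; 0; (11 / 10) ^+ 3].
have : Q4 <= \int[P]_w (pol [:: 11 ^+ 3 * b ^+ 4; 0; 0; 0; (11 / 10) ^+ 3] (X w) * W w).
  apply: le_Rintegral => // w _; rewrite ler_wpM2r ?tilt_weight_ge0// /pol/=.
  move: (X w) (quartic_shift_le (X w) b) => x; lra.
rewrite f4 /= !mul0r !addr0 -ZE => /le_trans; apply.
have -> : (11 ^+ 3 * b ^+ 4 * Z + (11 / 10) ^+ 3 * A 4) / Z = 11 ^+ 3 * b ^+ 4 + (11 /
    10) ^+ 3 * (A 4 / Z).
  by field; rewrite gt_eqF.
have e0 : 0 <= eps ^+ 2 * v by rewrite mulr_ge0 ?sqr_ge0.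
have b4 : b ^+ 4 <= 1 / 300 / 25 * (eps ^+ 2 * v).
  have : (b ^+ 2) ^+ 2 <= (1 / 300 * v) ^+ 2.
    by apply: lerXn2r; [exact: sqr_ge0|rewrite nnegrE; move: v0; lra|exact: b2_le].
  by have := ler_wpM2l v0 variance_bound; lra.
have a4 : A 4 / Z <= 1299 / 100 * eps ^+ 2 * v.
  have K0 : 0 <= 1299 / 100 * eps ^+ 2 * v by move: e0; lra.
  rewrite ler_pdivrMr; last exact: Z0.
  by apply: le_trans A4 _; apply: ler_peMr; [exact: K0|exact: mgf_ge1].
have := ler_wpM2l (sqr_ge0 eps) tilt_var_ge.
by rewrite /rho; lra.
Qed.

(** [1 + q >= exp (q / (1 + q))] puts the lower bound on [Z] in exponential form, and [q <= 6 t^2]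
    by the variance bound. To leading order [l b] costs [l^2 v] and [Z] returns half of it; the
    coefficient 6 absorbs the corrections in [t]. *)
Lemma tilt_normalizer_ge : expR (- (l ^+ 2 * v / 2 * (1 + 6 * t))) <= Z * expR (- (l *
    b)).
Proof.
pose q := l ^+ 2 * v / 2 * (1 - t).
have q0 : 0 <= q by rewrite mulr_ge0 ?divr_ge0//; move: t_small; lra.
have q6 : q <= 6 * t ^+ 2.
  apply: (@le_trans _ _ (l ^+ 2 * v / 2)); last by move: p_le; lra.
  by rewrite ler_piMr ?divr_ge0//; move: t0; lra.
have q1 : 0 < 1 + q by rewrite ltr_pwDl.
have Zs : expR (q * (1 - 6 * t ^+ 2)) <= Z.
  rewrite ZE; apply: le_trans Z_ge; rewrite -/q.
  apply: (@le_trans _ _ (expR (q / (1 + q)))).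
    rewrite ler_expR ler_wpM2l// -[leRHS]mul1r ler_pdivlMr//.
    by have := sqr_ge0 t; move: q6 q0; move: (t ^+ 2) => u; nra.
  have := expR_ge1Dx (- (q / (1 + q))).
  rewrite (_ : 1 - q / (1 + q) = (1 + q)^-1); last by field; rewrite gt_eqF.
  by rewrite expRN lef_pV2// posrE ?expR_gt0.
have lb : l * b <= l ^+ 2 * v * (1 + 3 / 2 * t + 42 / 10 * t ^+ 2).
  by apply: le_trans lA1_le; rewrite ler_wpM2l.
apply: le_trans (ler_wpM2r (expR_ge0 _) Zs).
rewrite -expRD ler_expR /q.
have : 0 <= (l ^+ 2 * v / 2) * (2 * t - 144 / 10 * t ^+ 2 + 6 * t ^+ 3).
  rewrite mulr_ge0 ?divr_ge0//.
  by move: t_small t0; move: t => u; nra.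
move: lb; lra.
Qed.

End tilt.

Lemma measurable_tail d (T : measurableType d) (R : realType) (P : probability T R)
    (n : nat) (X : 'I_n -> {RV P >-> R}) (c : R) :
  measurable [set w | c < \sum_(j < n) X j w].
Proof.
rewrite -[X in measurable X]setTI.
rewrite (_ : [set w | _] = (fun w => \sum_(j < n) X j w) @^-1` `]c, +oo[); last first.
  by apply/seteqP; split => w /=; rewrite in_itv/= andbT.
have : measurable_fun setT (fun w => \sum_(j < n) X j w).
  by apply: measurable_sum => j; exact: measurable_funPT.
exact.
Qed.

Lemma prod_cis {R : realType} (n : nat) (r a : 'I_n -> R) :
  (\prod_(j < n) (cos (a j) * r j +i* (sin (a j) * r j))%C =
   (cos (\sum_(j < n) a j) * \prod_(j < n) r j) +i*
   (sin (\sum_(j < n) a j) * \prod_(j < n) r j))%C.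
Proof.
elim: n r a => [|n IH] r a.
  by rewrite !big_ord0 cos0 sin0 mul1r mul0r.
rewrite !big_ord_recl IH.
set c := \sum_(j < n) _; set q := \prod_(j < n) r _.
by rewrite cosD sinD; congr (_ +i* _)%C; ring.
Qed.

(** * The tilted sum and its tail *)

Section tail_lower_bound.
Context d (T : measurableType d) (R : realType) (P : probability T R).
Context (n : nat) (X : 'I_n -> {RV P >-> R}).
Variables (eps l th : R) (v : 'I_n -> R).
Hypothesis indX : mutually_independent X.
Hypothesis iX : forall j k, P.-integrable setT (EFin \o (fun w => X j w ^+ k)).
Hypothesis X_mean : forall j, \int[P]_w (X j w) = 0.
Hypothesis X_var : forall j, \int[P]_w (X j w ^+ 2) = v j.
Hypothesis moment_bound : forall j k, (3 <= k)%N ->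
  `|\int[P]_w (X j w ^+ k)| <= k`!%:R / 2 * eps ^+ (k - 2) * v j.
Hypothesis eps0 : 0 < eps.
Hypothesis l0 : 0 <= l.
Hypothesis t_small : l * eps <= 3 / 200.
Hypothesis l_th : l <= th.
Hypothesis th_bounds : 0 < 9 * eps * th <= 27 / 200.
Hypothesis v_gt0 : 0 < \sum_(j < n) v j.

Let mX j : measurable_fun setT (X j : T -> R).
Proof. exact: measurable_funPT. Qed.

Let Z j := mgf P (X j) l.
Let b j := tilt_mean P (X j) l.
Let vb j := tilt_var P (X j) l.
Let wt j := tilt_weight P (X j) l.

Let Z1 j : 1 <= Z j.
Proof. exact: (mgf_ge1 (mX j) (iX j) (X_mean j) (X_var j) (moment_bound j) eps0 l0
    t_small). Qed.

Let Z0 j : 0 < Z j. Proof. exact: lt_le_trans (Z1 j). Qed.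

Let wt0 j x : 0 <= wt j x.
Proof. by apply: divr_ge0; [exact: expR_ge0|exact: ltW (Z0 j)]. Qed.

Let mwt j : measurable_fun setT (wt j).
Proof.
apply: measurable_funM => //.
by apply: (measurableT_comp (@measurable_expR R)); exact: measurable_funM.
Qed.

Let iwt j : P.-integrable setT (EFin \o (fun w => wt j (X j w))).
Proof. exact: (tilt_mass (mX j) (iX j) (X_mean j) (X_var j) (moment_bound j) eps0 l0
    t_small).1. Qed.

Let wt1 j : \int[P]_w wt j (X j w) = 1.
Proof. exact: (tilt_mass (mX j) (iX j) (X_mean j) (X_var j) (moment_bound j) eps0 l0
    t_small).2. Qed.

Let W w := \prod_(j < n) wt j (X j w).

Let mW : measurable_fun setT W.
Proof. by apply: measurable_prod => j _; exact: measurableT_comp. Qed.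

Let W0 w : 0 <= W w. Proof. exact: prodr_ge0. Qed.

Let iW : P.-integrable setT (EFin \o W).
Proof. exact: independent_integrable_prod. Qed.

Let W_mass : density P mW W0 setT = 1%E.
Proof.
rewrite /density; have -> : (\int[P]_x (W x)%:E = (\int[P]_x W x)%:E)%E.
  by rewrite /Rintegral fineK//; exact: integrable_fin_num iW.
by rewrite /W independent_Rintegral_prod// big1.
Qed.

Let Q := prob_density W_mass.

Let Rintegral_Q (f : T -> R) : measurable_fun setT f -> (forall x, `|f x| <= 1) ->
  \int[Q]_x f x = \int[P]_x (f x * W x).
Proof. by move=> mf f1; exact: (Rintegral_density mW W0 iW mf f1). Qed.

(* With the scale [9 eps], the third absolute moment of [eta j] under the tilted
   law is at most half its variance. *)
Let eta j x := (x - b j) / (9 * eps).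

Let Y w := \sum_(j < n) eta j (X j w).

Let meta j : measurable_fun setT (eta j).
Proof. by apply: measurable_funM => //; exact: measurable_funB. Qed.

Let mY : measurable_fun setT Y.
Proof. by apply: measurable_sum => j; exact: measurableT_comp. Qed.

Let z s j : R[i] := (\int[P]_w (cos (s * eta j (X j w)) * wt j (X j w)) +i*
  \int[P]_w (sin (s * eta j (X j w)) * wt j (X j w)))%C.

Let mtrig (g : R -> R) s j : continuous g -> measurable_fun setT (fun x => g (s * eta j
    x) * wt j x).
Proof.
move=> cg; apply: measurable_funM => //.
apply: (measurableT_comp (continuous_measurable_fun cg)).
exact: measurable_funM.
Qed.

Let mgY (g : R -> R) s : continuous g -> measurable_fun setT (fun w => g (s * Y w)).
Proof.
by move=> cg; apply: (measurableT_comp (continuous_measurable_fun cg)); exact: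
    measurable_funM.
Qed.

Let cfE s : (\int[Q]_w cos (s * Y w) +i* \int[Q]_w sin (s * Y w))%C = \prod_(j < n) z s j.
Proof.
rewrite -(independent_Rintegral_prod_complex indX (mtrig s ^~ (@continuous_cos R))
  (mtrig s ^~ (@continuous_sin R))); last 2 first.
- move=> j; apply: (integrable_cos_weight (P := P) (eta := fun w => eta j (X j w)) (w
    := fun w => wt j (X j w))) => //.
  + exact: measurableT_comp.
  + exact: measurableT_comp.
- move=> j; apply: (integrable_sin_weight (P := P) (eta := fun w => eta j (X j w)) (w
    := fun w => wt j (X j w))) => //.
  + exact: measurableT_comp.
  + exact: measurableT_comp.
rewrite (Rintegral_Q (mgY s (@continuous_cos R))); last by move=> x; exact: cos_max.
rewrite (Rintegral_Q (mgY s (@continuous_sin R))); last by move=> x; exact: sin_max.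
by congr (_ +i* _)%C; apply: eq_Rintegral => w _; rewrite prod_cis/= -mulr_sumr.
Qed.

Let c9 : 0 < 9 * eps. Proof. by rewrite mulr_gt0. Qed.

Let w_var j := vb j / (9 * eps) ^+ 2.

Let z_taylor s j (p q : R) : 0 <= s -> p ^+ 2 + q ^+ 2 <= 1 ->
  p * (complex.Re (z s j) - (1 - s ^+ 2 * w_var j / 2)) + q * complex.Im (z s j) <=
  s ^+ 3 * w_var j / 12.
Proof.
move=> s0 pq.
have [ic c0] := tilt_centered (mX j) (iX j) (X_mean j) (X_var j) (moment_bound j) eps0
    l0 t_small.
have iv := integrable_tilt_var (mX j) (iX j) (X_mean j) (X_var j) (moment_bound j) eps0
    l0 t_small.
have [i3 e3] := integrable_tilt_third (mX j) (iX j) (X_mean j) (X_var j) (moment_bound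
    j) eps0 l0 t_small.
have E1 : (fun w => eta j (X j w) * wt j (X j w)) =
    fun w => (9 * eps)^-1 * ((X j w - b j) * wt j (X j w)).
  by apply/funext => w; rewrite /eta; ring.
have E2 : (fun w => eta j (X j w) ^+ 2 * wt j (X j w)) =
    fun w => ((9 * eps) ^+ 2)^-1 * ((X j w - b j) ^+ 2 * wt j (X j w)).
  by apply/funext => w; rewrite /eta expr_div_n; ring.
have E3 : (fun w => `|eta j (X j w)| ^+ 3 * wt j (X j w)) =
    fun w => ((9 * eps) ^+ 3)^-1 * (`|X j w - b j| ^+ 3 * wt j (X j w)).
  apply/funext => w; rewrite /eta normrM (@ger0_norm _ (_^-1)) ?invr_ge0//; last exact:
      ltW.
  by rewrite expr_div_n; ring.
apply: (cf_factor_taylor (P := P) (eta := fun w => eta j (X j w))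
  (w := fun w => wt j (X j w))) => //.
- exact: measurableT_comp.
- exact: measurableT_comp.
- by rewrite E1; exact: integrable_EFinZl.
- by rewrite E1 RintegralZl// c0 mulr0.
- by rewrite E2; exact: integrable_EFinZl.
- by rewrite E2 RintegralZl// mulrC.
- by rewrite E3; exact: integrable_EFinZl.
- rewrite E3 RintegralZl// -ler_pdivlMl ?invr_gt0 ?exprn_gt0// invrK.
  apply: le_trans e3 _; rewrite le_eqVlt; apply/orP; left; apply/eqP.
  by rewrite /w_var -/(vb j); field; rewrite gt_eqF.
Qed.

Let vb0 j : 0 <= vb j.
Proof. by apply: Rintegral_ge0 => w _; rewrite mulr_ge0 ?sqr_ge0// wt0. Qed.

Let w_var_bounds j : 0 <= w_var j <= 4^-1.
Proof.
rewrite divr_ge0 ?sqr_ge0// ler_pdivrMr ?exprn_gt0//=.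
have := tilt_var_bound (mX j) (iX j) (X_mean j) (X_var j) (moment_bound j) eps0 l0
    t_small.
by rewrite exprMn -/(vb j); lra.
Qed.

Let Vb := \sum_(j < n) vb j.

Lemma tilt_var_sum_ge : 47 / 50 * \sum_(j < n) v j <= Vb.
Proof.
rewrite mulr_sumr; apply: ler_sum => j _.
exact: (tilt_var_ge (mX j) (iX j) (X_mean j) (X_var j) (moment_bound j) eps0 l0 t_small).
Qed.

Lemma tilt_var_sum_le : Vb <= (\sum_(j < n) v j) * (1 + 6 * (l * eps)).
Proof.
rewrite mulr_suml; apply: ler_sum => j _.
exact: (tilt_var_le (mX j) (iX j) (X_mean j) (X_var j) (moment_bound j) eps0 l0 t_small).
Qed.

Lemma tilt_mean_sum_ge : l * (\sum_(j < n) v j) * (1 - 24 / 10 * (l * eps)) <= \sum_(j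
    < n) b j.
Proof.
rewrite mulr_sumr mulr_suml; apply: ler_sum => j _.
exact: (tilt_mean_ge (mX j) (iX j) (X_mean j) (X_var j) (moment_bound j) eps0 l0 t_small).
Qed.

(** The factor [E exp (l S) exp (- l B)], kept as a product over the summands so that it can be
    bounded factor by factor. *)
Let K := \prod_(j < n) (Z j * expR (- (l * b j))).

Let K_ge : expR (- (l ^+ 2 * (\sum_(j < n) v j) / 2 * (1 + 6 * (l * eps)))) <= K.
Proof.
rewrite (_ : expR _ = \prod_(j < n) expR (- (l ^+ 2 * v j / 2 * (1 + 6 * (l * eps))))).
  apply: ler_prod => j _; rewrite expR_ge0/=.
  exact: (tilt_normalizer_ge (mX j) (iX j) (X_mean j) (X_var j) (moment_bound j) eps0
      l0 t_small).
by rewrite -expR_sum sumrN; congr (expR (- _)); rewrite -!mulr_suml -mulr_sumr.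
Qed.

Let A := [set w | \sum_(j < n) b j < \sum_(j < n) X j w].

(** Pointwise on the event, weight, cut and normalizer multiply to [exp ((l - th) (S - B))], at most
    1 because [l <= th]. *)
Let cut_le_tail : K * cut_mean (9 * eps * th) Q Y 0 <= fine (P A).
Proof.
have mA : measurable A by exact: measurable_tail.
have [th0 _] := andP th_bounds.
have mc : measurable_fun setT (fun w => cut_exp (9 * eps * th) (Y w - 0)).
  apply: (measurableT_comp (measurable_cut_exp _)); exact: measurable_funB.
have c1 w : `|cut_exp (9 * eps * th) (Y w - 0)| <= 1.
  by rewrite ger0_norm ?cut_exp_ge0// cut_exp_le1// ltW.
rewrite /cut_mean Rintegral_Q//.
have icW := integrable_bounded_mul mW iW mc c1.
rewrite -RintegralZl//.
have -> : fine (P A) = \int[P]_w (\1_A w : R).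
  by rewrite /Rintegral integral_indic// setIT.
apply: le_Rintegral => //.
- exact: integrable_EFinZl.
- apply: (@integrable_bounded _ _ _ P _ 1) => // w.
  by rewrite indicE; case: (_ \in _); rewrite ?normr1 ?normr0.
move=> w _; rewrite cut_expE subr0 indicE.
have YE : Y w = (\sum_(j < n) X j w - \sum_(j < n) b j) / (9 * eps).
  by rewrite /Y /eta -mulr_suml sumrB.
have Ypos : (0 < Y w) = (\sum_(j < n) b j < \sum_(j < n) X j w).
  by rewrite YE pmulr_lgt0 ?invr_gt0// subr_gt0.
have -> : (w \in A) = (0 < Y w).
  by rewrite Ypos; apply/idP/idP => [|h]; [rewrite inE|rewrite inE].
case: ifPn => [Y0|_]; last by rewrite mul0r mulr0.
have -> : W w = expR (l * \sum_(j < n) X j w) / \prod_(j < n) Z j.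
  by rewrite /W /wt /tilt_weight prodf_div -expR_sum mulr_sumr.
have Zp : 0 < \prod_(j < n) Z j by exact: prodr_gt0.
rewrite /K big_split/= -expR_sum.
rewrite [leLHS](_ : _ = expR (\sum_(j < n) - (l * b j)) * expR (- (9 * eps * th * Y w)) *
  expR (l * \sum_(j < n) X j w)); last by field; rewrite gt_eqF.
rewrite -!expRD expR_le1 YE sumrN -mulr_sumr.
set SX := \sum_(j < n) X j w; set SB := \sum_(j < n) b j.
rewrite (_ : _ + _ + _ = (l - th) * (SX - SB)); last by field; rewrite gt_eqF.
by rewrite mulr_le0_ge0 ?subr_le0// subr_ge0 ltW// -Ypos.
Qed.

Lemma tail_lower :
  expR (- (l ^+ 2 * (\sum_(j < n) v j) / 2 * (1 + 6 * (l * eps)))) *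
  (mills (th * Num.sqrt Vb) - 671 / 100 * normal_peak (Num.sqrt Vb / (9 * eps))) <=
  fine (P A).
Proof.
set sb := Num.sqrt Vb.
have Vb0 : 0 < Vb by apply: lt_le_trans tilt_var_sum_ge; rewrite mulr_gt0.
have sb0 : 0 < sb by rewrite sqrtr_gt0.
have s0 : 0 < sb / (9 * eps) by rewrite divr_gt0.
have vE : \sum_(j < n) w_var j = (sb / (9 * eps)) ^+ 2.
  by rewrite /w_var -mulr_suml expr_div_n sqr_sqrtr// ltW.
have := cut_mean_lower mY th_bounds s0 vE w_var_bounds cfE z_taylor.
rewrite (_ : 9 * eps * th * (sb / (9 * eps)) = th * sb); last by field; rewrite gt_eqF.
move=> h; have P0 : 0 <= fine (P A) by rewrite fine_ge0.
set br := _ - _ in h *.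
(* A negative bracket makes the claim trivial; a nonnegative one may be multiplied by the lower
   bound for [K]. *)
have [br0|br0] := leP 0 br; last first.
  by apply: le_trans P0; rewrite mulr_ge0_le0 ?expR_ge0// ltW.
apply: (le_trans _ cut_le_tail); apply: ler_pM => //; exact: expR_ge0.
Qed.

End tail_lower_bound.

Section saddlepoint_lower.
Context d (T : measurableType d) (R : realType) (P : probability T R).
Context (n : nat) (X : 'I_n -> {RV P >-> R}).
Variables (eps l : R) (v : 'I_n -> R).
Hypothesis indX : mutually_independent X.
Hypothesis iX : forall j k, P.-integrable setT (EFin \o (fun w => X j w ^+ k)).
Hypothesis X_mean : forall j, \int[P]_w (X j w) = 0.
Hypothesis X_var : forall j, \int[P]_w (X j w ^+ 2) = v j.
Hypothesis moment_bound : forall j k, (3 <= k)%N ->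
  `|\int[P]_w (X j w ^+ k)| <= k`!%:R / 2 * eps ^+ (k - 2) * v j.
Hypothesis eps0 : 0 < eps.
Hypothesis l0 : 0 <= l.
Variable sigma : R.
Hypothesis sigma0 : 0 < sigma.
Hypothesis sigmaE : sigma ^+ 2 = \sum_(j < n) v j.
Hypothesis tu_small : l * eps + eps / sigma <= 3 / 200.

Lemma saddlepoint_lower_bound (xc : R) : xc = l * sigma / (1 - l * eps) ^+ 3 ->
  (1 - Phi xc) * (1 - 67 * (1 + xc) * (eps / sigma)) <=
  fine (P [set w | l * sigma ^+ 2 * (1 - 24 / 10 * (l * eps)) < \sum_(j < n) X j w]).
Proof.
move=> xcE; set u := eps / sigma; set t := l * eps.
have u0 : 0 < u by rewrite divr_gt0.
have t0 : 0 <= t by rewrite mulr_ge0// ltW.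
have tu : t + u <= 3 / 200 by [].
have t_small : t <= 3 / 200 by move: u0 tu; lra.
have u_small : u <= 3 / 200 by move: t0 tu; lra.
(* The smoothing argument needs [th > 0], also when [l = 0]. *)
pose th := l + u / sigma.
have l_th : l <= th by rewrite lerDl divr_ge0// ltW.
have th_eps : eps * th = t + u ^+ 2 by rewrite /th /t /u; field; rewrite gt_eqF.
have th_bounds : 0 < 9 * eps * th <= 27 / 200.
  rewrite -mulrA th_eps; apply/andP; split.
    by rewrite mulr_gt0// ltr_wpDl// exprn_gt0.
  have : u ^+ 2 <= u by rewrite expr2 ler_piMr ?ltW//; move: u_small; lra.
  by move: tu; lra.
have v_gt0 : 0 < \sum_(j < n) v j by rewrite -sigmaE exprn_gt0.
have TL := tail_lower indX iX X_mean X_var moment_bound eps0 l0 t_small l_th th_bounds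
    v_gt0.
have VG := tilt_var_sum_ge iX X_mean X_var moment_bound eps0 l0 t_small.
have VL := tilt_var_sum_le iX X_mean X_var moment_bound eps0 l0 t_small.
have BG := tilt_mean_sum_ge iX X_mean X_var moment_bound eps0 l0 t_small.
rewrite -sigmaE -/t in TL VG VL BG.
set Vb := \sum_(j < n) tilt_var _ _ _ in TL VG VL.
set B := \sum_(j < n) tilt_mean _ _ _ in TL BG.
set sb := Num.sqrt Vb in TL.
have sb0 : 0 <= sb by exact: sqrtr_ge0.
have sbE : sb ^+ 2 = Vb.
  by rewrite sqr_sqrtr// (le_trans _ VG)// mulr_ge0// sqr_ge0.
have t1 : 0 < 1 - t by move: t_small; lra.
have t13 : 0 < (1 - t) ^+ 3 by rewrite exprn_gt0.
have inv3 : 1 + 3 * t <= ((1 - t) ^+ 3)^-1.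
  rewrite -[leRHS]mul1r ler_pdivlMr//.
  by move: t0 t_small; clearbody t; nra.
have sb_up : sb <= sigma * (1 + 3 * t).
  have : 0 <= sigma * (1 + 3 * t) by rewrite mulr_ge0 ?ltW// ltr_wpDr// mulr_ge0.
  move=> h; rewrite -(ler_pXn2r (ltn0Sn 1)) ?nnegrE// sbE.
  apply: le_trans VL _; rewrite exprMn ler_wpM2l ?sqr_ge0//.
  by have := sqr_ge0 t; lra.
(* The square of 26/25 times 47/50 exceeds 1. *)
have sb_lo : sigma <= 26 / 25 * sb.
  have : 0 <= 26 / 25 * sb by rewrite mulr_ge0.
  move=> h; rewrite -(ler_pXn2r (ltn0Sn 1)) ?nnegrE ?(ltW sigma0)// exprMn sbE.
  by have := sqr_ge0 sigma; move: VG; lra.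
have xc0 : 0 <= xc by rewrite xcE divr_ge0 ?mulr_ge0// ltW.
have lsb : l * sb <= xc.
  rewrite xcE -mulrA ler_wpM2l//; apply: le_trans sb_up _.
  by rewrite ler_wpM2l// ltW.
have sbp : 0 < sb.
  by move: sb_lo sigma0; lra.
(* The summand [u / sigma] of [th] costs [u (1 + 3 t) <= 2 u]. *)
have thsb : th * sb <= xc + 2 * u.
  rewrite /th mulrDl lerD// mulrAC ler_pdivrMr//.
  rewrite [leRHS](_ : _ = u * (2 * sigma)); last by ring.
  rewrite ler_wpM2l ?(ltW u0)//; apply: le_trans sb_up _.
  by rewrite mulrC ler_wpM2r ?(ltW sigma0)//; move: t_small; lra.
pose m1 : R := normal_peak 1.
have m10 : 0 <= m1 by exact: normal_peak_ge0.
have peakE : normal_peak (sb / (9 * eps)) = 9 * eps / sb * m1.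
  have s90 : 0 <= sb / (9 * eps) by rewrite divr_ge0// mulr_ge0// ltW.
  rewrite /m1 /normal_peak expr1n mul1r -mulrnAr sqrtrM ?sqr_ge0// sqrtr_sqr ger0_norm//.
  by rewrite invfM invf_div.
have eps_sb : eps / sb <= 26 / 25 * u.
  rewrite ler_pdivrMr//.
  rewrite [leRHS](_ : _ = eps / sigma * (26 / 25 * sb)); last by rewrite /u; ring.
  by rewrite mulrAC ler_pdivlMr// ler_wpM2l// ltW.
(* The budget of the constant: 6.71 times 9 times 26/25 is below 63, moving Mills' ratio by [2 u]
   adds 2, and the total stays below 67. [mills_lower] makes the error relative. *)
have bracket : mills xc * (1 - 67 * (1 + xc) * u) <=
    mills (th * sb) - 671 / 100 * normal_peak (sb / (9 * eps)).
  have h1 := mills_le (mulr_ge0 (le_trans l0 l_th) sb0) thsb.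
  have h2 := mills_shift xc0 (mulr_ge0 (ler0n R 2) (ltW u0)).
  have h3 := ler_wpM2r m10 eps_sb.
  have h4 := ler_wpM2r (ltW u0) (mills_lower xc0).
  have h5 := mulr_ge0 m10 (ltW u0).
  rewrite peakE; move: h1 h2 h3 h4 h5; rewrite -/m1; lra.
have PS : fine (P [set w | B < \sum_(j < n) X j w]) <=
    fine (P [set w | l * sigma ^+ 2 * (1 - 24 / 10 * t) < \sum_(j < n) X j w]).
  have mG (c : R) := measurable_tail X c.
  apply: fine_le; [exact: fin_num_measure|exact: fin_num_measure|].
  apply: le_measure; rewrite ?inE//.
  by move=> w /=; exact: le_lt_trans BG.
have [c0|/ltW c0] := leP 0 (1 - 67 * (1 + xc) * u); last first.
  by apply: (@le_trans _ _ 0); rewrite ?mulr_ge0_le0 ?one_sub_Phi_ge0 ?fine_ge0.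
apply: le_trans PS; apply: (le_trans _ TL).
rewrite (_ : 1 - Phi xc = expR (- (xc ^+ 2 / 2)) * mills xc); last first.
  by rewrite /mills expRN mulrA mulVf ?mul1r// gt_eqF// expR_gt0.
rewrite -(mulrA (expR _)); apply: ler_pM => //.
  by rewrite mulr_ge0// mills_ge0.
(* Comparison of exponents: [(1 - t)^-6 >= (1 + 3 t)^2 >= 1 + 6 t]. *)
rewrite ler_expR lerN2 xcE.
rewrite -/t; set q := _^-1 in inv3 *.
rewrite [leRHS](_ : _ = l ^+ 2 * sigma ^+ 2 / 2 * q ^+ 2); last by field.
apply: ler_wpM2l; first by rewrite divr_ge0// mulr_ge0 ?sqr_ge0.
apply: (@le_trans _ _ ((1 + 3 * t) ^+ 2)); first by have := sqr_ge0 t; lra.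
have h : 0 <= 1 + 3 * t by rewrite addr_ge0// mulr_ge0.
by apply: lerXn2r => //; rewrite nnegrE// (le_trans h).
Qed.

End saddlepoint_lower.

(** * The saddle point *)

Section bernstein_tail.
Context d (T : measurableType d) (R : realType) (P : probability T R).
Context (n : nat) (xi : 'I_n -> {RV P >-> R}) (eps : R).
Hypothesis bern : bernstein_family xi eps.
Hypothesis var_gt0 : 0 < sigma2 xi.

Lemma bernstein_tail (l sigma : R) : sigma = Num.sqrt (sigma2 xi) ->
  0 <= l -> l * eps + eps / sigma <= 3 / 200 ->
  (1 - Phi (l * sigma / (1 - l * eps) ^+ 3)) *
    (1 - 67 * (1 + l * sigma / (1 - l * eps) ^+ 3) * (eps / sigma)) <=
  fine (P [set w | l * sigma ^+ 2 * (1 - 24 / 10 * (l * eps)) <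
                   \sum_(j < n) xi j w]).
Proof.
move=> sE l0 tu; have [ind iX mean eps0 bound] := bern.
have expE f : ('E_P[f] = \int[P]_w (f w)%:E)%E by rewrite expectation.unlock.
have intE j k : (\int[P]_w (xi j w ^+ k)%:E = (\int[P]_w (xi j w ^+ k))%:E)%E.
  by rewrite /Rintegral fineK//; exact: integrable_fin_num (iX j k).
apply: (saddlepoint_lower_bound (v := fun j => \int[P]_w (xi j w ^+ 2)) ind iX) => //.
- by move=> j; have := mean j; rewrite expE /Rintegral => ->.
- move=> j k k3; have := bound j k k3; rewrite !expE !intE.
  by rewrite -EFinM lee_fin.
- by rewrite sE sqrtr_gt0.
- rewrite sE sqr_sqrtr ?ltW// /sigma2; apply: eq_bigr => j _.
  by rewrite expE.
Qed.

End bernstein_tail.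


(** * The explicit parameters and constants *)

Section saddlepoint.
Context {R : realType}.
Implicit Types (x eps sigma alpha : R).

(** [lambda_] is the rationalized form of the root; expressing [x eps / sigma] through the square
    root [r] makes the identity rational in [r]. *)
Lemma lambda_saddlepoint x eps sigma : 0 < sigma -> 0 <= x ->
  c96 * x * eps / sigma <= 1 ->
  lambda_ x eps sigma * sigma ^+ 2 * (1 - 24 / 10 * (lambda_ x eps sigma * eps)) =
  x * sigma.
Proof.
move=> s0 x0 h.
set r := Num.sqrt (1 - c96 * x * eps / sigma).
have r0 : 0 <= r by exact: sqrtr_ge0.
have r2 : r ^+ 2 = 1 - c96 * x * eps / sigma by rewrite sqr_sqrtr// subr_ge0.
have r1 : 1 + r != 0 by rewrite gt_eqF// ltr_wpDr.
have sn0 : sigma != 0 by rewrite gt_eqF.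
have E : x * eps / sigma = (1 - r ^+ 2) * (5 / 48).
  by rewrite r2 /c96; field.
rewrite /lambda_ -/r.
rewrite [LHS](_ : _ = 2 * x * sigma / (1 + r) * (1 - 48 / 10 * (x * eps / sigma) / (1 +
    r))); last first.
  by field; rewrite sn0 r1.
by rewrite E; field.
Qed.

Lemma lambda_ge0 x eps sigma : 0 <= sigma -> 0 <= x -> 0 <= lambda_ x eps sigma.
Proof.
by move=> s0 x0; rewrite /lambda_ divr_ge0 ?divr_ge0 ?mulr_ge0 ?addr_ge0 ?sqrtr_ge0.
Qed.

Lemma lambda_eps_le x eps sigma : 0 < sigma -> 0 <= x -> 0 < eps ->
  lambda_ x eps sigma * eps <= 2 * (x * eps / sigma).
Proof.
move=> s0 x0 e0; rewrite /lambda_.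
rewrite [leLHS](_ : _ = 2 * (x * eps / sigma) / (1 + Num.sqrt (1 - c96 * x * eps /
    sigma))); last by ring.
have h : 0 <= 2 * (x * eps / sigma) by rewrite mulr_ge0// divr_ge0 ?mulr_ge0// ltW.
by rewrite ler_pdivrMr ?ltr_wpDr ?sqrtr_ge0// ler_peMr// lerDl sqrtr_ge0.
Qed.

(** 5/48 is 1/9.6, the range where the square root is real. There [t <= 5/24], so
    [(1 - t)^3 >= 2/5], and 5 is 2 divided by 2/5. The bound from below makes [t] small when the
    claim is not vacuous; the one from above serves the asymptotic statement. *)
Lemma xcheck_eps x eps sigma : 0 < sigma -> 0 <= x -> 0 < eps ->
  x * eps / sigma <= 5 / 48 ->
  [/\ 0 <= xcheck x eps sigma,
    lambda_ x eps sigma * eps <= xcheck x eps sigma * (eps / sigma) &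
    xcheck x eps sigma * (eps / sigma) <= 5 * (x * eps / sigma)].
Proof.
move=> s0 x0 e0 y1.
have l0 := lambda_ge0 eps (ltW s0) x0.
have := lambda_eps_le s0 x0 e0.
rewrite /xcheck; set l := lambda_ _ _ _ in l0 *; set t := l * eps => t1.
have t0 : 0 <= t by rewrite mulr_ge0// ltW.
have t2 : t <= 5 / 24 by move: t1 y1; lra.
have b0 : 0 < 1 - t by move: t2; lra.
have c0 : 0 < (1 - t) ^+ 3 by rewrite exprn_gt0.
have E : l * sigma / (1 - t) ^+ 3 * (eps / sigma) = t / (1 - t) ^+ 3.
  by rewrite /t; field; rewrite !gt_eqF// -/t.
split.
- by apply: divr_ge0; [apply: mulr_ge0 => //; exact: ltW|exact: ltW].
- by rewrite E ler_pdivlMr// ler_piMr// exprn_ile1 ?(ltW b0)//; move: t0; lra.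
have c3 : 3 / 4 <= 1 - t by move: t2; lra.
have c4 : (3 / 4) ^+ 3 <= (1 - t) ^+ 3.
  by apply: lerXn2r => //; rewrite nnegrE ?ltW//; lra.
have c5 : 2 / 5 <= (1 - t) ^+ 3 by move: c4; lra.
rewrite E ler_pdivrMr//; apply: (le_trans t1).
have y0 : 0 <= x * eps / sigma by rewrite divr_ge0 ?mulr_ge0// ltW.
by have := ler_wpM2r y0 c5; lra.
Qed.

(** The numerator is at least [(1 - t)^3] and the denominator at most [(1 - t)^7]. *)
Lemma Rfun_ge1 (t : R) : 0 <= t -> t < 3^-1 -> 1 <= Rfun t.
Proof.
move=> t0 t3; rewrite /Rfun.
have a0 : 0 < 1 - 3 * t by lra.
have b0 : 0 < 1 - t by lra.
have s0 : 0 < Num.sqrt (1 - 3 * t) by rewrite sqrtr_gt0.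
have s1 : Num.sqrt (1 - 3 * t) <= 1.
  by rewrite -[leRHS]sqrtr1 ler_wsqrtr//; lra.
rewrite ler_pdivlMr ?mul1r; last by rewrite !mulr_gt0// exprn_gt0.
apply: (@le_trans _ _ ((1 - t) ^+ 3)); last first.
  by apply: lerXn2r; rewrite ?nnegrE; have := sqr_ge0 t; lra.
apply: (@le_trans _ _ (1 * (1 - t) ^+ 7)).
  apply: ler_wpM2r; first by rewrite exprn_ge0// ltW.
  apply: (@le_trans _ _ (1 * 1)); last by rewrite mulr1.
  by apply: ler_pM => //; [exact: ltW a0|lra].
by rewrite mul1r; apply: ler_wiXn2l => //; [exact: ltW|lra].
Qed.

(** The argument of [Rfun] is at most [2 alpha <= 5/24 < 1/3], inside its finite range. *)
Lemma c_alpha_ge alpha : 0 <= alpha -> alpha <= c96^-1 -> 67 <= c_alpha alpha.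
Proof.
move=> a0 a1; rewrite /c_alpha.
have R1 : 1 <= Rfun (2 * alpha / (1 + Num.sqrt (1 - c96 * alpha))).
  have d1 : 1 <= 1 + Num.sqrt (1 - c96 * alpha) by rewrite lerDl sqrtr_ge0.
  have d0 := lt_le_trans ltr01 d1.
  apply: Rfun_ge1; first by rewrite divr_ge0 ?mulr_ge0// ltW.
  have : 2 * alpha / (1 + Num.sqrt (1 - c96 * alpha)) <= 2 * alpha.
    by rewrite ler_pdivrMr// ler_peMr// mulr_ge0.
  by move: a1; rewrite /c96 invf_div; lra.
have k : 67 <= 6738%:R / 100%:R :> R.
  by rewrite ler_pdivlMr// -natrM ler_nat.
by apply: (le_trans k); rewrite ler_peMr// (le_trans _ k).
Qed.

End saddlepoint.

(** * The lower tail bound and its asymptotic form *)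

Lemma bernstein_lower_tail (R : realType) d (T : measurableType d)
    (P : probability T R) (n : nat) (xi : 'I_n -> {RV P >-> R}) (eps alpha x : R) :
  bernstein_family xi eps -> 0 < sigma2 xi ->
  0 <= alpha -> alpha <= c96^-1 ->
  0 <= x -> x <= alpha * Num.sqrt (sigma2 xi) / eps ->
  (((1 - Phi (xcheck x eps (Num.sqrt (sigma2 xi))))
     * (1 - c_alpha alpha * (1 + xcheck x eps (Num.sqrt (sigma2 xi)))
            * (eps / Num.sqrt (sigma2 xi))))%:E
   <= P [set w | (x * Num.sqrt (sigma2 xi) < \sum_(i < n) xi i w)%R])%E.
Proof.
move=> bern var0 a0 a1 x0 xa.
have [_ _ _ eps0 _] := bern.
set sigma := Num.sqrt (sigma2 xi) in xa *.
have s0 : 0 < sigma by rewrite sqrtr_gt0.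
set lam := lambda_ x eps sigma.
have lam0 : 0 <= lam by rewrite lambda_ge0// ltW.
have y0 : 0 <= x * eps / sigma by rewrite divr_ge0 ?mulr_ge0// ltW.
have y1 : x * eps / sigma <= 5 / 48.
  have : x * eps / sigma <= alpha.
    by rewrite ler_pdivrMr// -ler_pdivlMr// -mulrA -[sigma / eps]mulrC mulrA in xa *.
  by move=> /le_trans; apply; move: a1; rewrite /c96 invf_div.
have y96 : c96 * x * eps / sigma <= 1.
  by rewrite -!mulrA [x * _]mulrA; move: y1; rewrite /c96; lra.
have lamt := lambda_eps_le s0 x0 eps0; rewrite -/lam in lamt.
set xc := xcheck _ _ _; set u := eps / sigma.
have u0 : 0 < u by rewrite divr_gt0.
set A := [set w | _].
have PA : P A = (fine (P A))%:E by rewrite fineK// fin_num_measure//; exact: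
    measurable_tail.
rewrite PA lee_fin.
(* Where the bound is not vacuous, [67 (1 + xc) u < 1] forces both [lam eps]
   and [u] to be small. *)
have [c0|c0] := leP (1 - c_alpha alpha * (1 + xc) * u) 0.
  by apply: (@le_trans _ _ 0); rewrite ?mulr_ge0_le0 ?one_sub_Phi_ge0 ?fine_ge0.
have [xc0 xcut _] := xcheck_eps s0 x0 eps0 y1; rewrite -/xc -/u -/lam in xc0 xcut.
have cge := c_alpha_ge a0 a1.
have cu : 67 * (1 + xc) * u <= c_alpha alpha * (1 + xc) * u.
  by apply: ler_wpM2r; [exact: ltW|apply: ler_wpM2r => //; exact: addr_ge0].
have tu : lam * eps + u <= 3 / 200 by move: cu c0 xcut; lra.
have := bernstein_tail bern var0 (erefl sigma) lam0 tu.
rewrite lambda_saddlepoint// -/(xcheck x eps sigma) -/xc -/u -/A => /(le_trans _); apply.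
by rewrite ler_wpM2l ?one_sub_Phi_ge0// lerD2l lerN2.
Qed.

Theorem theorem3 (R : realType) :
  (forall (d : measure_display) (T : measurableType d) (P : probability T R)
     (n : nat) (xi : 'I_n -> {RV P >-> R}) (eps alpha x : R),
     bernstein_family xi eps ->
     0 < sigma2 xi ->
     0 <= alpha -> alpha <= c96^-1 ->
     0 <= x -> x <= alpha * Num.sqrt (sigma2 xi) / eps ->
     (((1 - Phi (xcheck x eps (Num.sqrt (sigma2 xi))))
        * (1 - c_alpha alpha * (1 + xcheck x eps (Num.sqrt (sigma2 xi)))
               * (eps / Num.sqrt (sigma2 xi))))%:E
      <= P [set w | (x * Num.sqrt (sigma2 xi) < \sum_(i < n) xi i w)%R])%E)
  /\
  (forall eta : R, 0 < eta -> exists delta : R, 0 < delta /\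
     forall (d : measure_display) (T : measurableType d) (P : probability T R)
       (n : nat) (xi : 'I_n -> {RV P >-> R}) (eps x : R),
       bernstein_family xi eps ->
       0 < sigma2 xi ->
       eps / Num.sqrt (sigma2 xi) <= delta ->
       0 <= x -> x * eps / Num.sqrt (sigma2 xi) <= delta ->
       (((1 - Phi (xcheck x eps (Num.sqrt (sigma2 xi)))) * (1 - eta))%:E
        <= P [set w | (x * Num.sqrt (sigma2 xi) < \sum_(i < n) xi i w)%R])%E).
Proof.
split=> [d T P n xi eps alpha x|eta eta0]; first exact: bernstein_lower_tail.
have C67 : 67 <= c_alpha (c96^-1) :> R.
  by apply: c_alpha_ge => //; rewrite /c96 invr_ge0 divr_ge0.
set C := c_alpha _ in C67.
have C0 : 0 < C by rewrite (lt_le_trans _ C67).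
(* 1/10 is below 5/48, so the largest [alpha], 1/9.6, is admissible and [C] is an absolute constant;
   [(1 + xcheck) eps / sigma] is at most [delta + 5 delta], whence the 6. *)
exists (Num.min (10^-1) (eta / (6 * C))); split.
  by rewrite lt_min invr_gt0 ltr0n divr_gt0// mulr_gt0.
move=> d T P n xi eps x bern var0.
have [_ _ _ eps0 _] := bern.
set sigma := Num.sqrt (sigma2 xi).
have s0 : 0 < sigma by rewrite sqrtr_gt0.
rewrite !le_min => /andP[u1 u2] x0 /andP[y1 y2].
have y5 : x * eps / sigma <= 5 / 48 by move: y1; lra.
have xa : x <= c96^-1 * sigma / eps.
  by rewrite ler_pdivlMr// -ler_pdivrMr// /c96 invf_div.
have [xc0 _ xcu] := xcheck_eps s0 x0 eps0 y5.
have a0 : 0 <= c96^-1 :> R by rewrite /c96 invr_ge0 divr_ge0.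
have := bernstein_lower_tail bern var0 a0 (lexx _) x0 xa.
apply: le_trans; rewrite lee_fin ler_wpM2l ?one_sub_Phi_ge0// lerD2l lerN2 -/C -/sigma.
have : (1 + xcheck x eps sigma) * (eps / sigma) <= eta / C.
  have -> : eta / C = 6 * (eta / (6 * C)) by field; rewrite gt_eqF.
  by move: xcu u2 y2; lra.
rewrite ler_pdivlMr// => h; apply: le_trans h.
by rewrite le_eqVlt; apply/orP; left; apply/eqP; ring.
Qed.
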